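(* Assume that Assumptions 0, 1, 2, 3 (see context) hold, and let $\rho_f,\rho_u>0$ be the radii described in the context. For all $F^h\in(\mathcal U_{h,\#}^{1,1}(\mathcal L))^*$ with $\|F^h\|_{(\mathcal U_{h,\#}^{1,1})^*}<\rho_f$, the solution $u_h^0$ of the coarse-grained problem $$\text{find } u_h^0\in\mathcal U_{h,\#}(\mathcal L)\ \text{ s.t. }\quad \langle \delta E^0(u_h^0),v_h\rangle_{\mathcal L}=\langle F^h,v_h\rangle_h\quad\forall v_h\in\mathcal U_{h,\#}^{1,1}(\mathcal L)$$ exists and is unique in the ball $\{w\in\mathcal U_\#(\mathcal L): |w-\chi^\epsilon_*|_{1,\infty}<\rho_u\}$. Moreover, with $u$ the solution of the atomistic equilibrium problem with external force $f\in\mathcal U_\#(\mathcal L)$ and $u_h^{\rm c}:=\mathcal I_\#\big(u_h^0+\epsilon\chi^\epsilon(Du_h^0)\big)$, the following a posteriori estimate holds: $$|u_h^{\rm c}-u|_{1,\infty}\le \mathrm{Const}\big(c_0^{-1}C_\Phi^{(1,1)}\big)\max_{x\in\mathcal N_h}|Du_h^0(x)-Du_h^0(x-\epsilon)|+c_0^{-1}\|(h-\epsilon)f\|_\infty+\max_{\substack{v_h\in\mathcal U_{h,\#}(\mathcal L)\\ |v_h|_{1,1}=1}}\big|\langle F^h,v_h\rangle_h-\langle f,v_h\rangle_{\mathcal L}\big| ,$$ where $C_\Phi^{(1,1)}:=\max_{y\in\mathcal P}\sum_{r=1}^R |r\,\delta\Phi_r(\cdot;y)|_{C^{0,1}}$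.
   Context: Lattices. $p$, $R$ are positive integers, $N$ is a positive multiple of $p$, $\epsilon=1/N$, $\mathcal L=\{\epsilon,2\epsilon,\dots,N\epsilon\}$, $\mathcal P=\{1,\dots,p\}$. $\mathcal U(\mathcal L)$ is the space of functions $u:\epsilon\mathbb Z\to\mathbb R$ with $u(x+\epsilon N)=u(x)$; $\langle u\rangle_{\mathcal L}=\frac1N\sum_{x\in\mathcal L}u(x)$, $\langle u,v\rangle_{\mathcal L}=\langle uv\rangle_{\mathcal L}$, $\mathcal U_\#(\mathcal L)=\{u\in\mathcal U(\mathcal L):\langle u\rangle_{\mathcal L}=0\}$, $\mathcal I_\# u=u-\langle u\rangle_{\mathcal L}$. $D_ru(x)=\frac{u(x+r\epsilon)-u(x)}{r\epsilon}$, $D=D_1$. Likewise $\mathcal U(\mathcal P)$ is the space of $p$-periodic functions $\mathbb Z\to\mathbb R$, $\langle\eta\rangle_{\mathcal P}=\frac1p\sum_{y=1}^p\eta(y)$, $\langle\eta,\zeta\rangle_{\mathcal P}=\langle\eta\zeta\rangle_{\mathcal P}$, $\mathcal U_\#(\mathcal P)$ is its zero-mean subspace, $D_{y,r}\eta(y)=\frac{\eta(y+r)-\eta(y)}{r}$. Norms: $\|u\|_q=\langle|u|^q\rangle^{1/q}$, $\|u\|_\infty=\max|u|$, $|u|_{1,q}=\|Du\|_q$ (with $D_{y,1}$ in place of $D$ on $\mathcal P$), $|u|_{-1,\infty}=\sup\{\langle u,v\rangle_{\mathcal L}: v\in\mathcal U_\#(\mathcal L),\ |v|_{1,1}=1\}$.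 Potentials and atomistic problem. For $1\le r\le R$, $\Phi_r(\cdot;y)$ is a real function of one real variable, $p$-periodic in $y\in\mathbb Z$; $\delta\Phi_r,\delta^2\Phi_r$ are its first and second derivatives in the first variable; $\Phi_r^\epsilon(z;x)=\Phi_r(z;x/\epsilon)$. The energy is $E(u)=\big\langle\sum_{r=1}^R\Phi_r^\epsilon(D_ru(x);x)\big\rangle_{x\in\mathcal L}$, and $\langle\delta E(u),v\rangle_{\mathcal L}=\frac{d}{dt}E(u+tv)|_{t=0}$. The atomistic equilibrium problem is: find $u\in\mathcal U_\#(\mathcal L)$ with $\langle\delta E(u),v\rangle_{\mathcal L}=\langle f,v\rangle_{\mathcal L}$ for all $v\in\mathcal U_\#(\mathcal L)$. Assumptions. There exist $\chi_*\in\mathcal U_\#(\mathcal P)$ and $\rho_\Phi$ such that: (0) $y\mapsto y+\chi_*(y)$ is strictly increasing on $\mathbb Z$. (1) For all $1\le r\le R$ and $y\in\mathcal P$, $\Phi_r(\cdot;y)$ is defined in the neighborhood $U(y)\subset\mathbb R$ of $D_{y,r}\chi_*(y)$ of radius $\rho_\Phi$ and is $C^{2,1}$ there (second derivative Lipschitz). (2) $\sum_{r=1}^R\langle\delta\Phi_r(D_{y,r}\chi_* ),D_{y,r}\eta\rangle_{\mathcal P}=0$ for all $\eta\in\mathcal U_\#(\mathcal P)$. (3) $\frac12\min_y\delta^2\Phi_1(D_{y,1}\chi_*(y);y)-\sum_{r=2}^R\max_y|\delta^2\Phi_r(D_{y,r}\chi_*(y);y)|>0$. Homogenization. For $z$ in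 a suitable neighborhood of $0$, $\chi(z)=\chi(z;\cdot)\in\mathcal U_\#(\mathcal P)$ is the solution near $\chi_*$ (in $|\cdot|_{1,\infty}$) of $\sum_{r=1}^R\langle\delta\Phi_r(z+D_{y,r}\chi(z)),D_{y,r}\eta\rangle_{\mathcal P}=0$ for all $\eta\in\mathcal U_\#(\mathcal P)$, with $\chi(0)=\chi_*$; it exists and is unique there under the assumptions. $\Phi^0(z)=\sum_{r=1}^R\langle\Phi_r(z+D_{y,r}\chi(z;y);y)\rangle_{y\in\mathcal P}$ and $E^0(u)=\langle\Phi^0(Du)\rangle_{\mathcal L}$, so $\langle\delta E^0(u),v\rangle_{\mathcal L}=\langle\delta\Phi^0(Du),Dv\rangle_{\mathcal L}$. $\chi^\epsilon(z;x)=\chi(z;x/\epsilon)$, $\chi_*^\epsilon(x)=\chi_*(x/\epsilon)$, and $\chi^\epsilon(Du)$ is the function $x\mapsto\chi^\epsilon(Du(x);x)$. Radii. $\rho_f>0$ and $\rho_u>0$ are radii, whose existence is part of the theory under these assumptions, such that for every $f\in\mathcal U_\#(\mathcal L)$ with $|f|_{-1,\infty}<\rho_f$ the atomistic equilibrium problem has a unique solution $u$ with $|u-\chi^\epsilon_*|_{1,\infty}<\rho_u$, and the homogenized problem $\langle\delta E^0(u^0),v\rangle_{\mathcal L}=\langle f,v\rangle_{\mathcal L}$ for all $v\in\mathcal U_\#(\mathcal L)$ has a unique solution $u^0\in\mathcal U_\#(\mathcal L)$ with $|u^0|_{1,\infty}<\rho_u$. The atomistic solution $u$ is understood in this sense.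 Constants. $c_0>0$ is a coercivity constant, which exists by Assumption 3, such that $\inf_{|\eta|_{1,\infty}=1}\sup_{|\zeta|_{1,1}=1}\sum_{r=1}^R\langle\delta^2\Phi_r(D_{y,r}\chi_* )D_{y,r}\eta,D_{y,r}\zeta\rangle_{\mathcal P}\ge2c_0$ (over $\eta,\zeta\in\mathcal U_\#(\mathcal P)$); $\inf_{|w|_{1,\infty}=1}\sup_{|v|_{1,1}=1}\sum_{r=1}^R\langle a_r D_rw,D_rv\rangle_{\mathcal L}\ge2c_0$ with $a_r(x)=\delta^2\Phi_r(D_{y,r}\chi_*(y);y)|_{y=x/\epsilon}$ (over $w,v\in\mathcal U_\#(\mathcal L)$); and $\inf_{|w|_{1,\infty}=1}\sup_{|v|_{1,1}=1}\langle\delta^2\Phi^0(0)Dw,Dv\rangle_{\mathcal L}\ge2c_0$, $\delta^2\Phi^0(0)\ge2c_0$. $|\cdot|_{C^{0,1}}$ is the smallest Lipschitz constant. ''$\mathrm{Const}(a)$'' denotes a constant that may depend on $a$. Mesh. $\mathcal N_h\subset\mathcal L$ is the set of nodes of a triangulation of $(0,1]$ (understood periodically). Each element $T\in\mathcal T_h$ is $T=\mathcal L\cap[\xi,\eta)$ for two consecutive nodes $\xi<\eta$, with size $h_T=\eta-\xi$; $h\in\mathcal U(\mathcal L)$ is defined by $h(x)=h_T$ for $x\in T$. $\mathcal U_h(\mathcal L)=\{u\in\mathcal U(\mathcal L): Du(\xi-\epsilon)=Du(\xi)\ \forall\xi\in\mathcal L\setminus\mathcal N_h\}$ (piecewise affine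 functions), $\mathcal U_{h,\#}(\mathcal L)=\mathcal U_h(\mathcal L)\cap\mathcal U_\#(\mathcal L)$; $\mathcal U_{h,\#}^{1,1}(\mathcal L)$ is this space with norm $|\cdot|_{1,1}$, $(\mathcal U_{h,\#}^{1,1}(\mathcal L))^*$ is its dual, and $\langle\cdot,\cdot\rangle_h$ the duality pairing. $F^h$ is a numerical approximation to $f$, extended to $\mathcal U_h(\mathcal L)$ by $\langle F^h,1\rangle_h=0$.
   Formalization: The last term carries a factor c_0^{-1}, without which the bound fails for small c_0; the ball for u_h^0 is centred at 0 instead of χ_*^ε, and the atomistic ball at εχ_*^ε; ρ_u ranges over all small enough radii; Const may depend on the period p. *)

(* Defs.v *)
From HB Require Import structures.
From mathcomp Require Import all_boot all_order all_algebra.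
From mathcomp Require Import all_classical all_reals all_analysis.
Import Order.TTheory GRing.Theory Num.Theory.
Import numFieldNormedType.Exports.

Set Implicit Arguments.
Unset Strict Implicit.
Unset Printing Implicit Defensive.

Local Open Scope ring_scope.
Local Open Scope classical_set_scope.

(* Every lattice function is indexed by the integers.  A function u on eps Z
   is encoded by k |-> u (eps k), where eps = 1/N, so that x / eps is the index
   itself and the sites eps, ..., N eps are the indices 1, ..., N.  Functions
   on the cell {1, ..., p} use the same operations, with mesh width 1. *)

Section LatticeFunctions.
Variable R : realType.
Implicit Types (u v f : int -> R) (n r : nat) (e : R).

Definition lat_periodic n u : Prop := forall k : int, u (k + n%:Z) = u k.

Definition mean n u : R := n%:R^-1 * \sum_(1 <= k < n.+1) u k%:Z.

Definition inner n u v : R := mean n (fun k => u k * v k).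

Definition zero_mean n u : Prop := lat_periodic n u /\ mean n u = 0.

Definition center n u : int -> R := fun k => u k - mean n u.

Definition fdiff e r u : int -> R :=
  fun k => (u (k + r%:Z) - u k) / (r%:R * e).

Definition norm1 n u : R := mean n (fun k => `|u k|).

Definition normoo n u : R := \big[Num.max/0]_(1 <= k < n.+1) `|u k%:Z|.

(* The difference quotients D_r on the fine lattice and D_{y,r} on the cell. *)
Definition Dl n r u : int -> R := fdiff n%:R^-1 r u.
Definition Dc r u : int -> R := fdiff 1 r u.

Definition norm_1oo n u : R := normoo n (Dl n 1 u).
Definition norm_11 n u : R := norm1 n (Dl n 1 u).
Definition cnorm_1oo n u : R := normoo n (Dc 1 u).
Definition cnorm_11 n u : R := norm1 n (Dc 1 u).

(* [sup] is 0 on the empty set, which only occurs for n = 1. *)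
Definition norm_neg1oo n f : R :=
  sup [set inner n f v | v in [set v | zero_mean n v /\ norm_11 n v = 1]].

(* An infimum over an empty set of test functions (zero-mean space reduced to
   0) is +oo, hence the extended reals. *)
Definition infsup (W V : set (int -> R)) (b : (int -> R) -> (int -> R) -> R) :
    \bar R :=
  ereal_inf [set ereal_sup [set (b w v)%:E | v in V] | w in W].

Definition infsup_ge (m : R) (W V : set (int -> R))
    (b : (int -> R) -> (int -> R) -> R) : Prop := (m%:E <= infsup W V b)%E.

Definition lip_const (A : set R) (g : R -> R) : R :=
  inf [set l | 0 <= l /\ l.-lipschitz_A g].

End LatticeFunctions.

Section Model.
Variable R : realType.
Implicit Types (Phi : nat -> R -> int -> R) (chis : int -> R).
Implicit Types (chi : R -> int -> R) (u v w f : int -> R).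

(* n-th derivative in the first variable of z |-> Phi_r(z; y) *)
Definition dPhi Phi (n r : nat) (z : R) (y : int) : R :=
  derive1n n (fun s => Phi r s y) z.

(* U(y); it depends on r as well *)
Definition dom chis (rPhi : R) (r : nat) (y : int) : set R :=
  ball (Dc r chis y) rPhi.

Definition C21_on (A : set R) (g : R -> R) : Prop :=
  [/\ forall z, A z -> derivable g z 1,
      forall z, A z -> derivable (derive1 g) z 1 &
      exists l : R, l.-lipschitz_A (derive1n 2 g)].

(* sum_r < delta Phi_r(z + D_{y,r} chi), D_{y,r} eta >_P = 0 for all eta *)
Definition cell_equation (p Rmax : nat) Phi (z : R) (c : int -> R) : Prop :=
  forall eta : int -> R, zero_mean p eta ->
    \sum_(1 <= r < Rmax.+1)
      inner p (fun y => dPhi Phi 1 r (z + Dc r c y) y) (Dc r eta) = 0.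

Record assumptions (p Rmax : nat) Phi chis (rPhi : R) : Prop := Assumptions {
  Phi_periodic : forall r : nat, (1 <= r <= Rmax)%N ->
    forall (z : R) (y : int), Phi r z (y + p%:Z) = Phi r z y;
  chis_zero_mean : zero_mean p chis;
  rPhi_gt0 : 0 < rPhi;
  assumption0 : {homo (fun y : int => y%:~R + chis y) : x y / x < y};
  assumption1 : forall r y : nat, (1 <= r <= Rmax)%N -> (1 <= y <= p)%N ->
    C21_on (dom chis rPhi r y%:Z) (fun z => Phi r z y%:Z);
  assumption2 : cell_equation p Rmax Phi 0 chis;
  (* The minimum starts from its value at y = 1, which belongs to the cell. *)
  assumption3 :
    let a r (y : int) := dPhi Phi 2 r (Dc r chis y) y in
    0 < 2^-1 * \big[Num.min/a 1%N 1]_(1 <= y < p.+1) a 1%N y%:Z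
        - \sum_(2 <= r < Rmax.+1)
            \big[Num.max/0]_(1 <= y < p.+1) `|a r y%:Z| }.

(* The solution branch z |-> chi(z) of the cell problem for |z| < rz, unique in
   the ball of radius rchi around chi_*.  The bound on rz + rchi keeps all the
   arguments z + D_{y,r} chi(z) in the domains U(y) of the potentials. *)
Record corrector (p Rmax : nat) Phi chis (rPhi : R) chi (rz rchi : R) : Prop :=
  Corrector {
    corrector_rz : 0 < rz;
    corrector_rchi : 0 < rchi;
    corrector_dom : rz + rchi <= rPhi;
    corrector0 : chi 0 = chis;
    correctorP : forall z : R, `|z| < rz ->
      unique (fun c => [/\ zero_mean p c,
                           cnorm_1oo p (fun y => c y - chis y) < rchi &
                           cell_equation p Rmax Phi z c]) (chi z) }.

Definition Phi0 (p Rmax : nat) Phi chi (z : R) : R :=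
  \sum_(1 <= r < Rmax.+1) mean p (fun y => Phi r (z + Dc r (chi z) y) y).

Definition energy (N Rmax : nat) Phi u : R :=
  mean N (fun x => \sum_(1 <= r < Rmax.+1) Phi r (Dl N r u x) x).

Definition energy0 (N p Rmax : nat) Phi chi u : R :=
  mean N (fun x => Phi0 p Rmax Phi chi (Dl N 1 u x)).

(* < delta E(u), v > *)
Definition variation (E : (int -> R) -> R) u v : R :=
  derive1 (fun t : R => E (fun k => u k + t * v k)) 0.

(* The reference configuration is eps chi_*(x / eps): its difference quotient
   D_r is D_{y,r} chi_*, at which the potentials are defined. *)
Definition atomistic_solution (N Rmax : nat) Phi chis (ru : R) f u : Prop :=
  [/\ zero_mean N u,
      norm_1oo N (fun k => u k - N%:R^-1 * chis k) < ru &
      forall v, zero_mean N v ->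
        variation (energy N Rmax Phi) u v = inner N f v].

Definition homogenized_solution (N p Rmax : nat) Phi chi (ru : R) f u0 : Prop :=
  [/\ zero_mean N u0,
      norm_1oo N u0 < ru &
      forall v, zero_mean N v ->
        variation (energy0 N p Rmax Phi chi) u0 v = inner N f v].

Definition radii (N p Rmax : nat) Phi chis chi (rf ru : R) : Prop :=
  forall f, zero_mean N f -> norm_neg1oo N f < rf ->
    (exists! u, atomistic_solution N Rmax Phi chis ru f u) /\
    (exists! u0, homogenized_solution N p Rmax Phi chi ru f u0).

(* The conditions defining the coercivity constant c0: first those that do not
   involve the fine lattice, then those on the lattice with N sites. *)
Definition cell_coercive (p Rmax : nat) Phi chis chi (c0 : R) : Prop :=
  infsup_ge (2 * c0)
    [set eta | zero_mean p eta /\ cnorm_1oo p eta = 1]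
    [set zeta | zero_mean p zeta /\ cnorm_11 p zeta = 1]
    (fun eta zeta => \sum_(1 <= r < Rmax.+1)
       inner p (fun y => dPhi Phi 2 r (Dc r chis y) y * Dc r eta y)
               (Dc r zeta))
  /\ 2 * c0 <= derive1n 2 (Phi0 p Rmax Phi chi) 0.

Definition lattice_coercive (N p Rmax : nat) Phi chis chi (c0 : R) : Prop :=
  let W := [set w | zero_mean N w /\ norm_1oo N w = 1] in
  let V := [set v | zero_mean N v /\ norm_11 N v = 1] in
  infsup_ge (2 * c0) W V (fun w v => \sum_(1 <= r < Rmax.+1)
    inner N (fun x => dPhi Phi 2 r (Dc r chis x) x * Dl N r w x) (Dl N r v))
  /\ infsup_ge (2 * c0) W V (fun w v =>
    inner N (fun x => derive1n 2 (Phi0 p Rmax Phi chi) 0 * Dl N 1 w x)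
            (Dl N 1 v)).

Definition C_Phi11 (p Rmax : nat) Phi chis (rPhi : R) : R :=
  \big[Num.max/0]_(1 <= y < p.+1) \sum_(1 <= r < Rmax.+1)
    lip_const (dom chis rPhi r y%:Z) (fun z => r%:R * dPhi Phi 1 r z y%:Z).

End Model.

Section Mesh.
Variable R : realType.
Implicit Types (node : pred int) (u v f h : int -> R).

(* The set of nodes, extended N-periodically to all indices. *)
Definition mesh (N : nat) node : Prop :=
  (forall k : int, node (k + N%:Z) = node k) /\ exists k : int, node k.

Definition consecutive node (xi eta : int) : Prop :=
  [/\ node xi, node eta, xi < eta &
      forall k : int, xi < k < eta -> ~~ node k].

(* h is the mesh size function: h = h_T on each element T = [xi, eta). *)
Definition mesh_size (N : nat) node h : Prop :=
  forall xi eta : int, consecutive node xi eta ->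
    forall x : int, xi <= x < eta -> h x = (eta - xi)%:~R * N%:R^-1.

Definition coarse (N : nat) node u : Prop :=
  lat_periodic N u /\
  forall xi : int, ~~ node xi -> Dl N 1 u (xi - 1) = Dl N 1 u xi.

Definition coarse_zero_mean (N : nat) node u : Prop :=
  coarse N node u /\ mean N u = 0.

(* Elements of the dual of the zero-mean coarse space, extended to the whole
   coarse space by 0 on constants; values outside it are irrelevant. *)
Definition coarse_functional (N : nat) node (F : (int -> R) -> R) : Prop :=
  (forall (a : R) u v, coarse N node u -> coarse N node v ->
     F (fun k => a * u k + v k) = a * F u + F v)
  /\ F (fun=> 1) = 0.

Definition coarse_unit_sphere (N : nat) node : set (int -> R) :=
  [set v | coarse_zero_mean N node v /\ norm_11 N v = 1].

Definition dual_norm (N : nat) node (F : (int -> R) -> R) : R :=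
  sup [set `|F v| | v in coarse_unit_sphere N node].

Definition coarse_force_error (N : nat) node (F : (int -> R) -> R) f : R :=
  sup [set `|F v - inner N f v| | v in coarse_unit_sphere N node].

Definition max_jump (N : nat) node u : R :=
  \big[Num.max/0]_(1 <= x < N.+1 | node x%:Z)
    `|Dl N 1 u x%:Z - Dl N 1 u (x%:Z - 1)|.

Definition coarse_solution (N p Rmax : nat) (Phi : nat -> R -> int -> R)
    (chi : R -> int -> R) (ru : R) node (F : (int -> R) -> R) u : Prop :=
  [/\ coarse_zero_mean N node u,
      norm_1oo N u < ru &
      forall v, coarse_zero_mean N node v ->
        variation (energy0 N p Rmax Phi chi) u v = F v].

(* u^c = I_#(u + eps chi^eps(Du)) *)
Definition recovered (N : nat) (chi : R -> int -> R) u : int -> R :=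
  center N (fun k => u k + N%:R^-1 * chi (Dl N 1 u k) k).

End Mesh.

(* Main.v *)
(* Everything is done at the level of the strain t = Du.  By a discrete
   integration by parts the atomistic equation says that the local stress at t,
   minus a potential g of the force, is constant.  Assumption 3 makes the stress
   a row-dominant perturbation of multiplication by delta^2 Phi_1: the weighted
   and recentred fixed-point map is a contraction in the sup norm, uniformly in
   N, which gives existence and uniqueness for the atomistic and cell problems
   and a strictly increasing delta Phi^0 (inverted by the intermediate value
   theorem for the homogenized problem).  A coarse load is the restriction of a
   fine load with the same dual norm, whose homogenized solution is constant on
   elements by strict monotonicity, hence solves the coarse problem.  For the
   error estimate, the inf-sup condition is perturbed to a nonlinear stability
   estimate for the stress, and for constant strain z the stress of z + D chi(z)
   is constant, equal to delta Phi^0(z), so the stress of the recovered strain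
   differs from delta Phi^0(Du_h) by a multiple of the jumps of Du_h. *)
Require Import Defs.
From HB Require Import structures.
From mathcomp Require Import all_boot all_order all_algebra.
From mathcomp Require Import all_classical all_reals all_analysis.
From mathcomp Require Import ring lra zify.
Import Order.TTheory GRing.Theory Num.Theory.
Import numFieldNormedType.Exports.

Set Implicit Arguments.
Unset Strict Implicit.
Unset Printing Implicit Defensive.

Local Open Scope ring_scope.
Local Open Scope classical_set_scope.

(** The radii must not depend on N, so strains are measured only in the sup norm and tested only in
    the mean 1-norm; the one Poincare constant that enters the bounds is that of the cell, namely p.
    Assumption 3 and the inf-sup condition have separate tasks: dominance gives solvability and
    monotonicity, while the constants of the error bound involve [c0] and not the dominance gap.
    Half of [2 * c0] is spent on the linearization error. Since [radii] provides solutions only for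
    forces on the fine lattice, the coarse problem is reduced to a homogenized one. The factor of
    the jumps is [c0^-1 * K * (1 + 2 * X)], with [K] a Lipschitz constant of the stress and
    [X = p * (K / c0)] one of [chi]. [K] carries a factor p because [C_Phi11] is a maximum over
    sites of sums over r, whereas the estimates bound each r at all sites before summing. The weight
    h - eps, rather than h, reflects that the interpolation error of a test function, normalised at
    one node, vanishes at all nodes. *)

Section PeriodicMean.
Variable R : realType.
Implicit Types (u v s t g : int -> R) (n r : nat) (B d e : R).

Lemma periodic_mulz n u : lat_periodic n u ->
  forall k m : int, u (k + m * n%:Z) = u k.
Proof.
move=> pu k; elim=> [|m IH|m IH]; first by rewrite mul0r addr0.
  by rewrite intS mulrDl mul1r (addrC n%:Z) addrA pu.
rewrite -IH -[in LHS](pu (k + _)); congr u; rewrite !mulNr intS mulrDl; lia.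
Qed.

Lemma periodic_modz n u : lat_periodic n u -> forall k, u (k %% n%:Z)%Z = u k.
Proof.
by move=> pu k; rewrite [in RHS](divz_eq k n%:Z) addrC periodic_mulz.
Qed.

Lemma periodic_dvd p n u : (p %| n)%N -> lat_periodic p u -> lat_periodic n u.
Proof.
move=> /dvdnP[m ->] pu k; rewrite PoszM; exact: periodic_mulz.
Qed.

Lemma periodic_bound n u B : (0 < n)%N -> lat_periodic n u ->
  (forall i, (i < n)%N -> `|u i%:Z| <= B) -> forall k, `|u k| <= B.
Proof.
move=> n0 pu h k; rewrite -(periodic_modz pu).
have m0 : (0 <= (k %% n%:Z)%Z) by rewrite modz_ge0 // -lt0n.
have mn : ((k %% n%:Z)%Z < n%:Z) by rewrite ltz_pmod.
by case: (k %% n%:Z)%Z m0 mn => // i _; rewrite ltz_nat; exact: h.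
Qed.

(** Carries hypotheses given on the sites 1, ..., p, such as the regularity assumption, to all
    integers. The shift by 1 in the proof aligns the remainders 0, ..., p - 1 with the cell. *)
Lemma periodic_cell p (P : int -> Prop) : (0 < p)%N ->
  (forall k, P (k + p%:Z) <-> P k) ->
  (forall y : nat, (1 <= y <= p)%N -> P y%:Z) -> forall k, P k.
Proof.
move=> p0 pP Pc k.
have pm m (j : int) : P (j + m%:Z * p%:Z) <-> P j.
  elim: m j => [|m IH] j; first by rewrite mul0r addr0.
  by rewrite intS mulrDl mul1r (addrC p%:Z) addrA pP IH.
have pz (m j : int) : P (j + m * p%:Z) <-> P j.
  case: m => m; first exact: pm.
  rewrite NegzE -(pm m.+1 (j + _)) mulNr addrNK; exact: iff_refl.
have -> : k = (((k - 1) %% p%:Z)%Z + 1) + ((k - 1) %/ p%:Z)%Z * p%:Z.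
  by have := divz_eq (k - 1) p%:Z; lia.
rewrite pz.
have m0 : (0 <= ((k - 1) %% p%:Z)%Z) by rewrite modz_ge0 // -lt0n.
have mn : (((k - 1) %% p%:Z)%Z < p%:Z) by rewrite ltz_pmod.
case: ((k - 1) %% p%:Z)%Z m0 mn => // i _; rewrite ltz_nat => ip.
have -> : (i%:Z + 1 = i.+1%:Z) by lia.
exact: Pc.
Qed.

(** Moving the window by one site drops a value and gains an equal one, so the window sum is
    1-periodic in its starting point, hence constant. *)
Lemma window_sum_shift n u : lat_periodic n u -> forall x y : int,
  \sum_(0 <= i < n) u (x + i%:Z) = \sum_(0 <= i < n) u (y + i%:Z).
Proof.
move=> pu x y.
pose w (x : int) := \sum_(0 <= i < n) u (x + i%:Z).
have w1 : lat_periodic 1 w.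
  move=> k; rewrite {}/w; case: n pu => [|m] pu; first by rewrite !big_nil.
  rewrite big_nat_recr //= [in RHS]big_nat_recl //= addrC.
  have -> : k + 1%:Z + m%:Z = k + m.+1%:Z by lia.
  rewrite pu addr0; congr (_ + _); apply: eq_bigr => i _; congr u; lia.
rewrite -/(w x) -/(w y).
by rewrite -(periodic_mulz w1 x (y - x)) mulr1 addrC subrK.
Qed.

Lemma mean_window n u : lat_periodic n u -> forall x : int,
  mean n u = n%:R^-1 * \sum_(0 <= i < n) u (x + i%:Z).
Proof.
move=> pu x; rewrite /mean (window_sum_shift pu x 1) big_add1 /=.
by congr (_ * _); apply: eq_bigr => i _; congr u; lia.
Qed.

Lemma mean_shift n u (j : int) : lat_periodic n u ->
  mean n (fun k => u (k + j)) = mean n u.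
Proof.
move=> pu; rewrite (mean_window pu (1 + j)) /mean big_add1 /=.
by congr (_ * _); apply: eq_bigr => i _; congr u; lia.
Qed.

Lemma eq_mean n u v : u =1 v -> mean n u = mean n v.
Proof. by move=> uv; congr (_ * _); apply: eq_bigr => i _. Qed.

Lemma meanD n u v : mean n (fun k => u k + v k) = mean n u + mean n v.
Proof. by rewrite /mean big_split mulrDr. Qed.

Lemma meanZ n (a : R) u : mean n (fun k => a * u k) = a * mean n u.
Proof. by rewrite /mean -mulr_sumr mulrCA. Qed.

Lemma meanN n u : mean n (fun k => - u k) = - mean n u.
Proof. by rewrite /mean sumrN mulrN. Qed.

Lemma meanB n u v : mean n (fun k => u k - v k) = mean n u - mean n v.
Proof. by rewrite meanD meanN. Qed.

Lemma mean_sum n I (r : seq I) (P : pred I) (F : I -> int -> R) :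
  mean n (fun k => \sum_(i <- r | P i) F i k) = \sum_(i <- r | P i) mean n (F i).
Proof. by rewrite /mean exchange_big /= mulr_sumr. Qed.

Lemma mean_cst n (a : R) : (0 < n)%N -> mean n (fun=> a) = a.
Proof.
move=> n0; rewrite /mean big_const_nat subSS subn0 iter_addr_0 -[a *+ n]mulr_natl mulrA.
by rewrite mulVf ?mul1r // pnatr_eq0 -lt0n.
Qed.

Lemma ler_mean n u v : (forall k, u k <= v k) -> mean n u <= mean n v.
Proof.
by move=> uv; apply: ler_wpM2l; [rewrite invr_ge0 ler0n | apply: ler_sum].
Qed.

Lemma mean_ge0 n u : (forall k, 0 <= u k) -> 0 <= mean n u.
Proof.
move=> u0; apply: mulr_ge0; [by rewrite invr_ge0 ler0n | exact: sumr_ge0].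
Qed.

Lemma ler_norm_mean n u : `|mean n u| <= mean n (fun k => `|u k|).
Proof.
rewrite /mean normrM ger0_norm ?invr_ge0 ?ler0n //.
by apply: ler_wpM2l; [rewrite invr_ge0 ler0n | exact: ler_norm_sum].
Qed.

Lemma mean_gt0 n u : (0 < n)%N -> (forall k, 0 < u k) -> 0 < mean n u.
Proof.
case: n => // n _ u0; rewrite /mean big_nat_recr //= mulr_gt0 ?invr_gt0 ?ltr0n //.
by rewrite ltr_wpDl //; apply: sumr_ge0 => i _; exact: ltW.
Qed.

Lemma mean_eq0 n u : (0 < n)%N -> lat_periodic n u -> (forall k, 0 <= u k) ->
  mean n u = 0 -> forall k, u k = 0.
Proof.
move=> n0 pu u0 /eqP; rewrite /mean mulf_eq0 invr_eq0 pnatr_eq0 eqn0Ngt n0 /=.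
rewrite psumr_eq0 // => /allP h; apply: (@periodic_cell n) => //.
  by move=> k; rewrite pu.
by move=> y yn; apply/eqP/h; rewrite mem_index_iota.
Qed.

Lemma normoo_ge n u : (0 < n)%N -> lat_periodic n u -> forall k, `|u k| <= normoo n u.
Proof.
move=> n0 pu; apply: (@periodic_cell n) => // [k|y yn]; first by rewrite pu.
by apply: (Order.TotalTheory.le_bigmax_seq 0 y xpredT (fun k : nat => `|u k%:Z|));
  rewrite ?mem_index_iota.
Qed.

Lemma normoo_ge0 n u : 0 <= normoo n u.
Proof. by rewrite /normoo; apply: bigmax_ge_id. Qed.

Lemma normoo_le n u B : 0 <= B -> (forall k, `|u k| <= B) -> normoo n u <= B.
Proof. by move=> B0 h; apply: bigmax_le. Qed.

Lemma normooZ n (a : R) u : normoo n (fun k => a * u k) = `|a| * normoo n u.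
Proof.
rewrite /normoo; apply: (big_ind2 (fun x y => x = `|a| * y)); first by rewrite mulr0.
  by move=> x1 x2 y1 y2 -> ->; rewrite maxr_pMr.
by move=> i _; rewrite normrM.
Qed.

Lemma inner_le n g t B : (forall k, `|g k| <= B) ->
  `|inner n g t| <= B * norm1 n t.
Proof.
move=> gB; rewrite (le_trans (ler_norm_mean _ _)) // /norm1 -meanZ.
by apply: ler_mean => k; rewrite normrM ler_wpM2r.
Qed.

Lemma mean_center n u : (0 < n)%N -> mean n (Defs.center n u) = 0.
Proof. by move=> n0; rewrite meanB mean_cst // subrr. Qed.

Lemma zero_mean_center n u : (0 < n)%N -> lat_periodic n u -> zero_mean n (Defs.center n u).
Proof. by move=> n0 pu; split; [move=> k; rewrite /Defs.center pu | exact: mean_center]. Qed.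

(* du Bois-Reymond *)
Lemma ortho_zero_mean n g : (0 < n)%N -> lat_periodic n g ->
  (forall t, zero_mean n t -> inner n g t = 0) -> forall k, g k = mean n g.
Proof.
move=> n0 pg h k; apply/eqP; rewrite -subr_eq0 -sqrf_eq0; apply/eqP.
have cg := zero_mean_center n0 pg.
apply: (@mean_eq0 n (fun k => Defs.center n g k ^+ 2) n0) => [j|j|]; first by rewrite cg.1.
  exact: sqr_ge0.
rewrite (_ : mean n _ = inner n g (Defs.center n g)
   - mean n g * mean n (Defs.center n g)); last first.
  rewrite -meanZ /inner -meanB; apply: eq_mean => j; rewrite /Defs.center; ring.
by rewrite h // mean_center // mulr0 subrr.
Qed.

End PeriodicMean.

(** * Difference quotients as averages, primitives, summation by parts *)

Section Gradients.
Variable R : realType.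
Implicit Types (u v s t f g c : int -> R) (n r : nat) (B d e : R).

(** By [fdiff_avg] this operator turns [D_1] into [D_r], so every interaction is expressed by the
    nearest-neighbour strain; [avgT] is its adjoint for the periodic inner product ([inner_avg]).
    Neither increases the sup norm, whatever r is. *)
Definition avg r s (k : int) : R := r%:R^-1 * \sum_(0 <= j < r) s (k + j%:Z).
Definition avgT r s (k : int) : R := r%:R^-1 * \sum_(0 <= j < r) s (k - j%:Z).

Lemma ler_average r (F : nat -> R) B : 0 <= B ->
  (forall j, (j < r)%N -> `|F j| <= B) ->
  `|r%:R^-1 * \sum_(0 <= j < r) F j| <= B.
Proof.
case: r => [|r] B0 FB; first by rewrite invr0 mul0r normr0.
rewrite normrM ger0_norm ?invr_ge0 ?ler0n // ler_pdivrMl ?ltr0n //.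
rewrite (le_trans (ler_norm_sum _ _ _)) //.
have -> : r.+1%:R * B = \sum_(0 <= j < r.+1) B.
  by rewrite big_const_nat subn0 iter_addr addr0 mulr_natl.
rewrite big_nat [leRHS]big_nat; apply: ler_sum => j /andP[_ jr]; exact: FB.
Qed.

Lemma ler_avg r s B : 0 <= B -> (forall k, `|s k| <= B) -> forall k, `|avg r s k| <= B.
Proof. by move=> B0 sB k; apply: ler_average. Qed.

Lemma average_cst r (a : R) : (0 < r)%N -> r%:R^-1 * \sum_(0 <= j < r) a = a.
Proof.
move=> r0; rewrite big_const_nat subn0 iter_addr addr0 -[a *+ r]mulr_natl mulrA.
by rewrite mulVf ?mul1r // pnatr_eq0 -lt0n.
Qed.

Lemma avg_cst r (a : R) k : (0 < r)%N -> avg r (fun=> a) k = a.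
Proof. exact: average_cst. Qed.

Lemma avgD r s t k : avg r (fun j => s j + t j) k = avg r s k + avg r t k.
Proof. by rewrite /avg big_split mulrDr. Qed.

Lemma avgB r s t k : avg r (fun j => s j - t j) k = avg r s k - avg r t k.
Proof. by rewrite /avg sumrB mulrBr. Qed.

Lemma avgTB r s t k : avgT r (fun j => s j - t j) k = avgT r s k - avgT r t k.
Proof. by rewrite /avgT sumrB mulrBr. Qed.

Lemma avg1 s k : avg 1 s k = s k.
Proof. by rewrite /avg big_nat1 invr1 mul1r addr0. Qed.

Lemma avgT1 s k : avgT 1 s k = s k.
Proof. by rewrite /avgT big_nat1 invr1 mul1r subr0. Qed.

Lemma avg_periodic n r s : lat_periodic n s -> lat_periodic n (avg r s).
Proof.
by move=> ps k; congr (_ * _); apply: eq_bigr => j _; rewrite addrAC ps.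
Qed.

Lemma avgT_periodic n r s : lat_periodic n s -> lat_periodic n (avgT r s).
Proof.
by move=> ps k; congr (_ * _); apply: eq_bigr => j _; rewrite addrAC ps.
Qed.

Lemma inner_avg n r s t : lat_periodic n s -> lat_periodic n t ->
  inner n t (avg r s) = inner n (avgT r t) s.
Proof.
move=> ps pt; rewrite /inner.
transitivity (r%:R^-1 * \sum_(0 <= j < r) mean n (fun k => t k * s (k + j%:Z))).
  rewrite -mean_sum -meanZ; apply: eq_mean => k.
  by rewrite /avg mulrCA mulr_sumr.
transitivity (r%:R^-1 * \sum_(0 <= j < r) mean n (fun k => t (k - j%:Z) * s k)).
  congr (_ * _); apply: eq_bigr => j _.
  rewrite -(mean_shift (n := n) (u := fun k => t (k - j%:Z) * s k) j%:Z).
    by apply: eq_mean => k; rewrite addrK.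
  by move=> k; rewrite addrAC pt ps.
rewrite -mean_sum -meanZ; apply: eq_mean => k.
by rewrite /avgT -mulrA mulr_suml.
Qed.

Lemma telescope_int u r (k : int) :
  \sum_(0 <= j < r) (u (k + j%:Z + 1) - u (k + j%:Z)) = u (k + r%:Z) - u k.
Proof.
rewrite -[X in _ - u X]addr0 -(telescope_sumr (fun j : nat => u (k + j%:Z))) //.
by apply: eq_bigr => j _; congr (u _ - _); rewrite -addrA -PoszD addn1.
Qed.

Lemma fdiffE e u k : fdiff e 1 u k = (u (k + 1) - u k) / e.
Proof. by rewrite /fdiff mul1r. Qed.

Lemma fdiff_avg e r u : fdiff e r u = avg r (fdiff e 1 u).
Proof.
apply/funext => k; rewrite /avg /fdiff -telescope_int invfM mulrCA -mulr_suml.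
by rewrite mul1r mulrA mulrAC -!mulrA; congr (_ * _); rewrite mulrC.
Qed.

Lemma fdiff_periodic n e r u : lat_periodic n u -> lat_periodic n (fdiff e r u).
Proof. by move=> pu k; rewrite /fdiff addrAC !pu. Qed.

Lemma zero_mean_fdiff n e u : lat_periodic n u -> zero_mean n (fdiff e 1 u).
Proof.
move=> pu; split; first exact: fdiff_periodic.
rewrite (eq_mean n (v := fun k => e^-1 * (u (k + 1) - u k))); last first.
  by move=> k; rewrite fdiffE mulrC.
by rewrite meanZ meanB mean_shift // subrr mulr0.
Qed.

Lemma increment_le s d : (forall k, `|s (k + 1) - s k| <= d) ->
  forall (k : int) (j : nat), `|s (k + j%:Z) - s k| <= j%:R * d.
Proof.
move=> sd k; elim=> [|j IH]; first by rewrite addr0 subrr normr0 mul0r.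
have -> : s (k + j.+1%:Z) - s k =
    (s (k + j%:Z + 1) - s (k + j%:Z)) + (s (k + j%:Z) - s k).
  by rewrite addrA subrK; congr (s _ - _); lia.
by rewrite -natr1 mulrDl mul1r [leRHS]addrC (le_trans (ler_normD _ _)) ?lerD.
Qed.

(** Discrete Poincare inequality: the window starting at k has zero mean, so [- c k] is the average
    of the increments [c (k + j) - c k]. *)
Lemma zero_mean_le n c d : (0 < n)%N -> zero_mean n c ->
  (forall k, `|c (k + 1) - c k| <= d) -> forall k, `|c k| <= n%:R * d.
Proof.
move=> n0 [pc c0] cd k.
have d0 : 0 <= d by apply: le_trans (cd 0).
have -> : c k = - (n%:R^-1 * \sum_(0 <= j < n) (c (k + j%:Z) - c k)).
  rewrite sumrB mulrBr -(mean_window pc k) c0 sub0r opprK average_cst //.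
rewrite normrN; apply: ler_average => [|j jn]; first by rewrite mulr_ge0.
by rewrite (le_trans (increment_le cd _ _)) // ler_wpM2r // ler_nat ltnW.
Qed.

(** Summing up to the residue of k makes the primitive periodic for every t, and centring picks the
    zero-mean one. The mesh width [e] is 1 on the cell and 1/N on the lattice. *)
Definition prim n e t : int -> R :=
  Defs.center n (fun k => e * \sum_(0 <= j < `|(k %% n%:Z)%Z|%N) t j%:Z).

Lemma zero_mean_prim n e t : (0 < n)%N -> zero_mean n (prim n e t).
Proof.
move=> n0; apply: zero_mean_center => // k.
by rewrite modzDr.
Qed.

Lemma fdiff_prim n e t : (0 < n)%N -> e != 0 -> zero_mean n t ->
  fdiff e 1 (prim n e t) = t.
Proof.
move=> n0 e0 [pt t0]; apply/funext => k; apply/eqP; rewrite -subr_eq0 -normr_le0.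
have [pv _] := zero_mean_prim e t n0.
apply: (@periodic_bound _ n (fun k => fdiff e 1 (prim n e t) k - t k)) => //.
  by move=> j; rewrite (fdiff_periodic _ _ pv) pt.
move=> i i_n; rewrite normr_le0 subr_eq0 fdiffE /prim /Defs.center.
rewrite opprB addrA subrK -mulrBr mulrAC divff // mul1r.
rewrite -PoszD addn1 !modz_nat !absz_nat (modn_small i_n).
(* At the last residue the primitive returns to the empty sum; the difference quotient is still
   right there because t has zero mean. *)
have [/eqP ni|ni] := boolP (i.+1 == n); last first.
  have i1n : (i.+1 < n)%N by rewrite ltn_neqAle ni.
  by rewrite modn_small // big_nat_recr //= addrAC subrr add0r.
rewrite ni modnn big_nil sub0r.
have := t0; rewrite (mean_window pt 0) => /eqP; rewrite mulf_eq0 invr_eq0 pnatr_eq0.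
rewrite eqn0Ngt n0 /=.
under eq_bigr do rewrite add0r.
by rewrite -ni big_nat_recr //= addrC addr_eq0 => /eqP ->.
Qed.

Lemma fdiff_inj n e u v : (0 < n)%N -> e != 0 -> zero_mean n u -> zero_mean n v ->
  fdiff e 1 u = fdiff e 1 v -> u = v.
Proof.
move=> n0 e0 [pu u0] [pv v0] uv; apply/funext => k; apply/eqP.
rewrite -subr_eq0 -normr_le0 -[leRHS](mulr0 n%:R).
apply: (@zero_mean_le n (fun k => u k - v k)) => //.
  by split; [move=> j; rewrite pu pv | rewrite meanB u0 v0 subrr].
move=> j; have := congr1 (fun w => w j) uv; rewrite /= !fdiffE.
move=> /(mulIf _); rewrite invr_eq0 => /(_ e0) h.
by rewrite normr_le0 -(subrr (u (j + 1) - u j)) {2}h opprB; apply/eqP; ring.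
Qed.

Lemma inner_fdiff n e g v : lat_periodic n g -> lat_periodic n v ->
  inner n g (fdiff e 1 v) = inner n (fun k => (g (k - 1) - g k) / e) v.
Proof.
move=> pg pv; rewrite /inner.
transitivity (e^-1 * (mean n (fun k => g k * v (k + 1)) - mean n (fun k => g k * v k))).
  by rewrite -meanB -meanZ; apply: eq_mean => k; rewrite fdiffE; ring.
rewrite -(@mean_shift _ n (fun k => g k * v (k + 1)) (-1)).
  by rewrite -meanB -meanZ; apply: eq_mean => k; rewrite subrK; ring.
by move=> k; rewrite addrAC pg pv.
Qed.

Lemma force_potential n e f : (0 < n)%N -> e != 0 -> zero_mean n f ->
  exists2 g, lat_periodic n g & forall k, f k = (g (k - 1) - g k) / e.
Proof.
move=> n0 e0 zf; have [pv _] := zero_mean_prim e f n0.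
exists (fun k => - prim n e f (k + 1)) => [k|k]; first by rewrite addrAC pv.
by rewrite -{1}(fdiff_prim n0 e0 zf) fdiffE subrK opprK addrC.
Qed.

Definition delta n (i k : int) : R := ((k - i) %% n%:Z == 0)%Z%:R.

Lemma delta_periodic n i : lat_periodic n (delta n i).
Proof. by move=> k; rewrite /delta addrAC modzDr. Qed.

Lemma mean_delta n g i : (0 < n)%N -> lat_periodic n g ->
  mean n (fun k => g k * delta n i k) = n%:R^-1 * g i.
Proof.
move=> n0 pg; rewrite (@mean_window _ n _ _ i); last first.
  by move=> k; rewrite pg delta_periodic.
congr (_ * _); case: n n0 pg => // n _ pg; rewrite big_nat_recl //= big_nat big1.
  by rewrite !addr0 /delta subrr mod0z eqxx mulr1.
move=> j /andP[_ jn]; rewrite /delta addrAC subrr add0r modz_nat modn_small //.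
by rewrite mulr0.
Qed.

Lemma delta_sum n g k : (0 < n)%N -> lat_periodic n g ->
  g k = \sum_(1 <= i < n.+1) g i%:Z * delta n i%:Z k.
Proof.
move=> n0 pg.
have dC i : delta n i k = delta n k i.
  rewrite /delta; congr (_%:R); congr nat_of_bool.
  by rewrite -!(sameP dvdz_mod0P eqP) !dvdzE -[in RHS]opprB abszN.
have := mean_delta k n0 pg; rewrite /mean => /(mulfI _).
rewrite invr_eq0 pnatr_eq0 -lt0n => /(_ n0) <-.
by apply: eq_bigr => i _; rewrite dC.
Qed.

End Gradients.

(** * Regularity of the potentials *)

Section Potentials.
Variable R : realType.

(** The intermediate point lies in every closed ball containing both endpoints. Quantifying over
    that ball lets it be located both near the reference strain and near an endpoint. *)
Lemma mvt_ball (f : R -> R) (c rho a b : R) :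
  (forall z, ball c rho z -> derivable f z 1) ->
  ball c rho a -> ball c rho b ->
  exists x, (forall c' d : R, `|a - c'| <= d -> `|b - c'| <= d -> `|x - c'| <= d)
    /\ f b - f a = derive1 f x * (b - a).
Proof.
rewrite -ball_normE /= => df.
wlog ab : a b / a <= b => [hw ca cb|ca cb].
  have [/hw|/ltW/hw] := leP a b; first exact.
  move=> /(_ cb ca)[x [x1 x3]]; exists x; split => [c' d da db|]; first exact: x1.
  by rewrite -opprB x3; ring.
have sub z : a <= z <= b -> `|c - z| < rho.
  move=> /andP[az zb]; move: ca cb; rewrite !ltr_norml => /andP[? ?] /andP[? ?].
  by apply/andP; split; lra.
have [||x xab h] := @MVT_segment R f (derive1 f) a b ab.
- move=> z; rewrite in_itv /= => /andP[/ltW az /ltW zb].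
  by rewrite derive1E; apply: derivableP; apply: df; apply: sub; rewrite az.
- apply: derivable_within_continuous => z; rewrite in_itv /= => zab.
  exact/df/sub.
exists x; move: xab; rewrite in_itv /= => /andP[ax xb]; split => //.
by move=> c' d; rewrite !ler_norml => /andP[? ?] /andP[? ?]; apply/andP; split; lra.
Qed.

(** An infimum over the empty set is 0 by convention, so [lip_const] is meaningful only once some
    Lipschitz constant exists; [stress_lipschitz] provides one for the potentials. *)
Lemma lip_constP (A : set R) (g : R -> R) :
  (exists2 l, 0 <= l & l.-lipschitz_A g) ->
  0 <= lip_const A g /\
  forall x y, A x -> A y -> `|g x - g y| <= lip_const A g * `|x - y|.
Proof.
move=> [l l0 lg].
have ne : [set l | 0 <= l /\ l.-lipschitz_A g] !=set0 by exists l.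
split; first by apply: lb_le_inf => // m [].
move=> x y Ax Ay; have [->|xy] := eqVneq x y.
  by rewrite !subrr normr0 mulr0.
have xy0 : 0 < `|x - y| by rewrite normr_gt0 subr_eq0.
rewrite -ler_pdivrMr //; apply: lb_le_inf => // m [m0 mg].
by rewrite ler_pdivrMr //; exact: (mg (x, y)).
Qed.

Variables (p Rmax : nat) (Phi : nat -> R -> int -> R) (chis : int -> R) (rPhi : R).
Hypothesis p_gt0 : (0 < p)%N.
Hypothesis HA : assumptions p Rmax Phi chis rPhi.
Implicit Types (r n : nat) (x : R) (y : int).

Lemma dPhi_periodic n r : (1 <= r <= Rmax)%N ->
  forall x y, dPhi Phi n r x (y + p%:Z) = dPhi Phi n r x y.
Proof.
move=> rR x y; rewrite /dPhi; congr (derive1n _ _ _); apply/funext => s.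
exact: Phi_periodic HA _ rR _ _.
Qed.

Lemma Dc_chis_periodic r : lat_periodic p (Dc r chis).
Proof. by apply: fdiff_periodic; case: (chis_zero_mean HA). Qed.

Lemma potential_C21 r : (1 <= r <= Rmax)%N -> forall y,
  C21_on (dom chis rPhi r y) (fun z => Phi r z y).
Proof.
move=> rR; apply: (@periodic_cell p) => // [y|y yp]; last exact: assumption1 HA _ _ rR yp.
rewrite /dom Dc_chis_periodic.
by under eq_fun do rewrite (Phi_periodic HA rR).
Qed.

Lemma potential_is_derive r x y : (1 <= r <= Rmax)%N ->
  `|x - Dc r chis y| < rPhi ->
  is_derive x 1 (fun z => Phi r z y) (dPhi Phi 1 r x y).
Proof.
move=> rR xc; have [d1 _ _] := potential_C21 rR y.
rewrite /dPhi derive1n1 derive1E; apply: derivableP; apply: d1.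
by rewrite /dom -ball_normE /= distrC.
Qed.

(** The slope is frozen at the reference strain while both arguments move: the error is the
    variation of the second derivative, at most [L * d], between the reference and a mean-value
    point. *)
Definition linearization_modulus (L : R) : Prop :=
  forall r x x' y d, (1 <= r <= Rmax)%N -> d < rPhi ->
    `|x - Dc r chis y| <= d -> `|x' - Dc r chis y| <= d ->
    `|dPhi Phi 1 r x y - dPhi Phi 1 r x' y
      - dPhi Phi 2 r (Dc r chis y) y * (x - x')| <= L * d * `|x - x'|.

Lemma potential_linearization : exists2 L : R, 0 <= L & linearization_modulus L.
Proof.
have H r (y : nat) : exists l : R, 0 <= l /\
   ((1 <= r <= Rmax)%N -> (1 <= y <= p)%N ->
     l.-lipschitz_(dom chis rPhi r y%:Z) (derive1n 2 (fun z => Phi r z y%:Z))).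
  have [/andP[rR yp]|h] := boolP ((1 <= r <= Rmax) && (1 <= y <= p))%N; last first.
    by exists 0; split => // rR yp; move: h; rewrite rR yp.
  have [_ _ [l lP]] := potential_C21 rR y%:Z.
  exists (Num.max 0 l); split; first by rewrite le_max lexx.
  move=> _ _ z zA; apply: (le_trans (lP z zA)); rewrite ler_wpM2r //.
  by rewrite le_max lexx orbT.
pose l r (y : nat) := projT1 (cid (H r y)).
have l0 r (y : nat) : 0 <= l r y by case: (projT2 (cid (H r y))).
(* The sum of the finitely many Lipschitz constants dominates each of them. *)
exists (\sum_(1 <= r < Rmax.+1) \sum_(1 <= y < p.+1) l r y).
  by apply: sumr_ge0 => r _; apply: sumr_ge0.
move=> r x x' y d rR drho.
have d0 : (`|x - Dc r chis y| <= d) -> 0 <= d by apply: le_trans.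
move: y x x' {d0}; apply: (@periodic_cell p) => // [y|y yp x x' xd x'd].
  rewrite Dc_chis_periodic; split => h x x' hx hx'; move: (h x x' hx hx');
  by rewrite !dPhi_periodic.
have d0 : 0 <= d by apply: le_trans xd.
have [d1 d2 _] := potential_C21 rR y%:Z.
have bx z : `|z - Dc r chis y%:Z| <= d -> dom chis rPhi r y%:Z z.
  by move=> zd; rewrite /dom -ball_normE /= distrC (le_lt_trans zd).
have [w [w1 w3]] := mvt_ball d2 (bx _ x'd) (bx _ xd).
rewrite /dPhi derive1n1 w3 -mulrBl normrM ler_wpM2r //.
have rc : dom chis rPhi r y%:Z (Dc r chis y%:Z).
  by apply: bx; rewrite subrr normr0.
have lP := (projT2 (cid (H r y))).2 rR yp.
have := lP (w, Dc r chis y%:Z) (conj (bx _ (w1 _ _ x'd xd)) rc).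
rewrite /= -/(l r y) => h; apply: (le_trans h); apply: ler_pM => //; last exact: w1.
  exact: l0.
rewrite -/(l r y) (big_rem r) ?mem_index_iota //= (big_rem y) ?mem_index_iota //= -addrA lerDl.
by rewrite addr_ge0 //; apply: sumr_ge0 => // i _; apply: sumr_ge0.
Qed.

(** A sum over the cell stands in for the maximum: it bounds the constant at every site and can be
    exchanged with the sum over r, at the cost of the factor p in [sum_ell]. *)
Definition ell r : R := \sum_(1 <= y < p.+1)
  lip_const (dom chis rPhi r y%:Z) (fun z => r%:R * dPhi Phi 1 r z y%:Z).

(** On the domain the second derivative is at most its value at the centre plus its Lipschitz
    constant times the radius. *)
Lemma stress_lipschitz r : (1 <= r <= Rmax)%N ->
  forall y : nat, (1 <= y <= p)%N ->
  exists2 l : R, 0 <= l &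
   l.-lipschitz_(dom chis rPhi r y%:Z) (fun z => r%:R * dPhi Phi 1 r z y%:Z).
Proof.
move=> rR y yp; have [d1 d2 [l lP]] := potential_C21 rR y%:Z.
have r0 := rPhi_gt0 HA.
set c := Dc r chis y%:Z.
pose M : R := `|dPhi Phi 2 r c y%:Z| + `|l| * rPhi.
have M0 : 0 <= M by rewrite addr_ge0 ?mulr_ge0 // ltW.
exists (r%:R * M); first by rewrite mulr_ge0.
move=> [x x'] [/= xA x'A]; rewrite -mulrBr normrM ger0_norm // -mulrA ler_wpM2l //.
have [w [w1 w3]] := mvt_ball d2 x'A xA.
rewrite [leLHS](_ : _ = `|derive1 (derive1 (fun z => Phi r z y%:Z)) w * (x - x')|); last first.
  by rewrite -w3.
rewrite normrM ler_wpM2r //.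
have cA : dom chis rPhi r y%:Z c by rewrite /dom; exact: ballxx.
have wA : `|w - c| < rPhi.
  move: xA x'A; rewrite /dom -ball_normE /= !(distrC c) => xA x'A.
  rewrite (le_lt_trans (w1 _ (Num.max `|x - c| `|x' - c|) _ _)) ?le_max ?lexx ?orbT //.
  by rewrite gt_max xA x'A.
have wA' : dom chis rPhi r y%:Z w by rewrite /dom -ball_normE /= distrC.
have := lP (w, c) (conj wA' cA); rewrite /= => h.
have -> : derive1 (derive1 (fun z => Phi r z y%:Z)) w =
  dPhi Phi 2 r c y%:Z + (dPhi Phi 2 r w y%:Z - dPhi Phi 2 r c y%:Z) by rewrite addrC subrK.
rewrite (le_trans (ler_normD _ _)) // lerD // (le_trans h) //.
by rewrite (le_trans (ler_wpM2r _ (ler_norm l))) // ler_wpM2l // ltW.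
Qed.

Lemma ell_ge0 r : (1 <= r <= Rmax)%N -> 0 <= ell r.
Proof.
move=> rR; rewrite /ell big_nat; apply: sumr_ge0 => y yp.
by case: (lip_constP (stress_lipschitz rR yp)).
Qed.

Lemma stress_lip r x x' y : (1 <= r <= Rmax)%N ->
  `|x - Dc r chis y| < rPhi -> `|x' - Dc r chis y| < rPhi ->
  `|dPhi Phi 1 r x y - dPhi Phi 1 r x' y| <= r%:R^-1 * ell r * `|x - x'|.
Proof.
move=> rR; have r0 : 0 < r%:R :> R by rewrite ltr0n; case/andP: rR.
move: y x x'; apply: (@periodic_cell p) => // [y|y yp x x' xd x'd].
  rewrite Dc_chis_periodic; split => h x x' hx hx'; move: (h x x' hx hx');
  by rewrite !dPhi_periodic.
have bA z : `|z - Dc r chis y%:Z| < rPhi -> dom chis rPhi r y%:Z z.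
  by move=> zd; rewrite /dom -ball_normE /= distrC.
have [l0 /(_ x x' (bA _ xd) (bA _ x'd))] := lip_constP (stress_lipschitz rR yp).
rewrite -mulrBr normrM gtr0_norm // => h.
rewrite -mulrA ler_pdivlMl //; apply: (le_trans h); rewrite ler_wpM2r //.
rewrite /ell (bigD1_seq y) ?mem_index_iota ?iota_uniq //= lerDl big_seq_cond.
apply: sumr_ge0 => i; rewrite mem_index_iota => /andP[ip _].
by case: (lip_constP (stress_lipschitz rR ip)).
Qed.

Lemma sum_ell : \sum_(1 <= r < Rmax.+1) ell r <= p%:R * C_Phi11 p Rmax Phi chis rPhi.
Proof.
rewrite exchange_big /=.
have -> : p%:R * C_Phi11 p Rmax Phi chis rPhi =
    \sum_(1 <= y < p.+1) C_Phi11 p Rmax Phi chis rPhi.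
  by rewrite big_const_nat subSS subn0 iter_addr addr0 mulr_natl.
rewrite big_nat [leRHS]big_nat; apply: ler_sum => y yp.
rewrite /C_Phi11; apply: (Order.TotalTheory.le_bigmax_seq 0 y xpredT
  (fun y : nat => \sum_(1 <= r < Rmax.+1)
    lip_const (dom chis rPhi r y%:Z) (fun z => r%:R * dPhi Phi 1 r z y%:Z))) => //.
by rewrite mem_index_iota.
Qed.

Lemma potential_taylor r x x' y : (1 <= r <= Rmax)%N ->
  `|x - Dc r chis y| < rPhi -> `|x' - Dc r chis y| < rPhi ->
  `|Phi r x' y - Phi r x y - dPhi Phi 1 r x y * (x' - x)|
     <= r%:R^-1 * ell r * `|x' - x| ^+ 2.
Proof.
move=> rR xd x'd; have [d1 _ _] := potential_C21 rR y.
have xA : dom chis rPhi r y x by rewrite /dom -ball_normE /= distrC.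
have x'A : dom chis rPhi r y x' by rewrite /dom -ball_normE /= distrC.
have [w [w1 w3]] := mvt_ball d1 xA x'A.
rewrite w3 /dPhi derive1n1 -mulrBl normrM expr2 mulrA ler_wpM2r //.
have wA : `|w - Dc r chis y| < rPhi.
  rewrite (le_lt_trans (w1 _ (Num.max `|x - Dc r chis y| `|x' - Dc r chis y|) _ _))
    ?le_max ?lexx ?orbT //.
  by rewrite gt_max xd.
apply: (le_trans (stress_lip rR wA xd)); rewrite ler_wpM2l //.
  by rewrite mulr_ge0 ?invr_ge0 // ell_ge0.
by apply: w1; rewrite ?subrr ?normr0.
Qed.

End Potentials.

(** * Picard iteration *)

Section Picard.
Variables (R : realType) (K : Type).

Lemma le_geometric_le0 (q A x : R) : 0 <= q < 1 ->
  (forall m, x <= A * q ^+ m) -> x <= 0.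
Proof.
move=> /andP[q0 q1] h; rewrite -(mulr0 A).
have c : A * q ^+ m @[m --> \oo] --> A * 0.
  by apply: cvgMr; apply: cvg_expr; rewrite ger0_norm.
apply: (cvgr_to_ge c); exact: nearW.
Qed.

(** Contraction is expressed by bounds valid at every site, so no normed space of bounded functions
    is built. The limit is taken site by site, hence the closedness of [P] under pointwise
    convergence. *)
Lemma picard (P : set (K -> R)) (T : (K -> R) -> K -> R) (q C : R) (s0 : K -> R) :
  0 <= q < 1 -> P s0 -> (forall s, P s -> P (T s)) ->
  (forall s s' e, P s -> P s' -> (forall k, `|s k - s' k| <= e) ->
     forall k, `|T s k - T s' k| <= q * e) ->
  (forall (s_ : nat -> K -> R) s, (forall m, P (s_ m)) ->
     (forall k, s_ m k @[m --> \oo] --> s k) -> P s) ->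
  (forall k, `|T s0 k - s0 k| <= C) ->
  exists2 s, P s & forall k, T s k = s k.
Proof.
move=> /[dup] q01 /andP[q0 q1] Ps0 PT TL Pcl T0.
pose s_ m := iter m T s0.
have Ps m : P (s_ m) by elim: m => //= m IH; exact: PT.
have step m k : `|s_ m.+1 k - s_ m k| <= C * q ^+ m.
  elim: m k => [|m IH] k; first by rewrite expr0 mulr1; exact: T0.
  by rewrite exprS mulrCA; apply: (TL (s_ m.+1) (s_ m)).
have q1' : 0 < 1 - q by rewrite subr_gt0.
have tail m i k : `|s_ (i + m)%N k - s_ m k| <= C / (1 - q) * q ^+ m.
  (* Keeping the exact partial geometric sum is what makes the induction on i close. *)
  suff: `|s_ (i + m)%N k - s_ m k| <= C / (1 - q) * (1 - q ^+ i) * q ^+ m.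
    move=> /le_trans; apply; rewrite ler_wpM2r ?exprn_ge0 // ler_piMr //.
      have C0 : 0 <= C by apply: le_trans (T0 k).
      by rewrite divr_ge0 // ltW.
    by rewrite gerBl exprn_ge0.
  elim: i => [|i IH]; first by rewrite subrr normr0 expr0 subrr mulr0 mul0r.
  rewrite addSn -(subrK (s_ (i + m)%N k) (s_ _ k)) -addrA (le_trans (ler_normD _ _)) //.
  rewrite (le_trans (lerD (step _ _) IH)) // exprD exprS le_eqVlt; apply/orP; left.
  by apply/eqP; field; rewrite gt_eqF.
have cv k : cvgn (fun m => s_ m k).
  have : cvgn (series (telescope (fun m => s_ m k))).
    apply: normed_cvg; apply: (@series_le_cvg _ _ (geometric C q));
      [move=> m|move=> m|move=> m|].
    - exact: normr_ge0.
    - by apply: le_trans (step m k).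
    - exact: step.
    - by apply: is_cvg_geometric_series; rewrite ger0_norm.
  rewrite telescopeK => h.
  have -> : (fun m => s_ m k) = (fun m => (s_ m k - s_ 0%N k) + s_ 0%N k).
    by apply/funext => m; rewrite subrK.
  by apply: is_cvgD => //; exact: is_cvg_cst.
pose s k := limn (fun m => s_ m k).
have scv k : s_ m k @[m --> \oo] --> s k by exact: cv.
have PS : P s by exact: (Pcl s_).
have dist m k : `|s k - s_ m k| <= C / (1 - q) * q ^+ m.
  have c : (- `|s_ n k - s_ m k|) @[n --> \oo] --> - `|s k - s_ m k|.
    by apply: cvgN; apply: cvg_norm; apply: cvgB => //; exact: cvg_cst.
  rewrite -lerN2; apply: (cvgr_to_ge c); near=> n.
  rewrite lerN2 -(@subnK m n) //; near: n; exact: nbhs_infty_ge.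
exists s => // k; apply/eqP; rewrite -subr_eq0 -normr_le0.
apply: (@le_geometric_le0 q (C / (1 - q) * (q + q))) => // m.
have h : `|T s k - s_ m.+1 k| <= q * (C / (1 - q) * q ^+ m).
  by apply: (TL s (s_ m)) => // j; exact: dist.
have := dist m.+1 k; rewrite distrC => h'.
rewrite -(subrK (s_ m.+1 k) (T s k)) -addrA (le_trans (ler_normD _ _)) //.
rewrite (le_trans (lerD h h')) // exprS le_eqVlt; apply/orP; left; apply/eqP; ring.
Unshelve. all: by end_near. Qed.

End Picard.

(** * The stress and its linearization *)

Section Stress.
Variables (R : realType) (p Rmax : nat) (Phi : nat -> R -> int -> R).
Variables (chis : int -> R) (rPhi : R).
Hypotheses (p_gt0 : (0 < p)%N) (Rmax_gt0 : (0 < Rmax)%N).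
Hypothesis HA : assumptions p Rmax Phi chis rPhi.
Implicit Types (t s : int -> R) (n r : nat) (d e : R) (k : int).

Let sstar := Dc 1 chis.
Let a r y := dPhi Phi 2 r (Dc r chis y) y.

(** The first variation pairs each bond force with [D_r v = avg r (D v)]; moving the averages to the
    force collects all bonds into one field paired with [D v] ([weak_stress]). *)
Definition stress t k : R :=
  \sum_(1 <= r < Rmax.+1) avgT r (fun y => dPhi Phi 1 r (avg r t y) y) k.

Definition lin t k : R := \sum_(1 <= r < Rmax.+1) avgT r (fun y => a r y * avg r t y) k.

Definition near_ref d t : Prop := forall k, `|t k - sstar k| <= d.

Lemma Dc_chisE r : Dc r chis = avg r sstar.
Proof. by rewrite /Dc fdiff_avg. Qed.

Lemma near_ref_ge0 d t : near_ref d t -> 0 <= d.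
Proof. by move=> /(_ 0); apply: le_trans. Qed.

Lemma near_avg d t r y : near_ref d t -> `|avg r t y - Dc r chis y| <= d.
Proof.
move=> td; rewrite Dc_chisE -avgB; apply: ler_avg => //.
exact: near_ref_ge0 td.
Qed.

Lemma stress_periodic n t : (p %| n)%N -> lat_periodic n t -> lat_periodic n (stress t).
Proof.
move=> pn pt k; rewrite /stress big_nat [RHS]big_nat; apply: eq_bigr => r rR.
apply: (@avgT_periodic _ n r (fun y => dPhi Phi 1 r (avg r t y) y)) => y.
rewrite (avg_periodic r pt).
by apply: (@periodic_dvd _ p n (dPhi Phi 1 r (avg r t y)) pn) => j; rewrite (dPhi_periodic HA).
Qed.

Lemma a_periodic r : (1 <= r <= Rmax)%N -> lat_periodic p (a r).
Proof. by move=> rR y; rewrite /a (Dc_chis_periodic HA) (dPhi_periodic HA). Qed.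

(** The averaged strains may differ by an amount growing like r: [ell r] measures r times the bond
    force, so [stress_lip] carries a factor [r^-1] that cancels this growth. [recovered_stress]
    relies on it. *)
Lemma stress_diff_le t1 t2 d1 d2 e k :
  near_ref d1 t1 -> near_ref d2 t2 -> d1 < rPhi -> d2 < rPhi -> 0 <= e ->
  (forall r (j : nat), (1 <= r <= Rmax)%N -> (j < r)%N ->
     `|avg r t1 (k - j%:Z) - avg r t2 (k - j%:Z)| <= r%:R * e) ->
  `|stress t1 k - stress t2 k| <= p%:R * C_Phi11 p Rmax Phi chis rPhi * e.
Proof.
move=> n1 n2 d1r d2r e0 h; rewrite /stress -sumrB (le_trans (ler_norm_sum _ _ _)) //.
rewrite (le_trans _ (ler_wpM2r e0 (sum_ell p Rmax Phi chis rPhi))) // mulr_suml.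
rewrite big_nat [leRHS]big_nat; apply: ler_sum => r rR.
have l0 : 0 <= ell p Phi chis rPhi r by exact: (ell_ge0 p_gt0 HA).
have r0 : (0 < r%:R :> R) by rewrite ltr0n; case/andP: rR.
rewrite -avgTB; apply: ler_average => [|j jr]; first by rewrite mulr_ge0.
apply: le_trans (stress_lip p_gt0 HA rR _ _) _.
- exact: le_lt_trans (near_avg _ _ n1) d1r.
- exact: le_lt_trans (near_avg _ _ n2) d2r.
apply: le_trans (ler_wpM2l _ (h r j rR jr)) _.
  by rewrite mulr_ge0 // invr_ge0 ltW.
by rewrite mulrACA mulVf ?gt_eqF // mul1r.
Qed.

Lemma stress_lipschitz_sup t1 t2 d1 d2 e :
  near_ref d1 t1 -> near_ref d2 t2 -> d1 < rPhi -> d2 < rPhi ->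
  (forall k, `|t1 k - t2 k| <= e) ->
  forall k, `|stress t1 k - stress t2 k| <= p%:R * C_Phi11 p Rmax Phi chis rPhi * e.
Proof.
move=> n1 n2 d1r d2r te k; have e0 : 0 <= e by apply: le_trans (te 0).
apply: (stress_diff_le n1 n2 d1r d2r e0) => r j /andP[r1 _] _.
rewrite -avgB (le_trans (ler_avg _ e0 te _)) // ler_peMl // ler1n //.
Qed.

Variable L : R.
Hypothesis L_ge0 : 0 <= L.
Hypothesis LP : linearization_modulus Rmax Phi chis rPhi L.

Let kappa d := Rmax%:R * (L * d).

Lemma stress_linearization t1 t2 d e :
  near_ref d t1 -> near_ref d t2 -> d < rPhi ->
  (forall k, `|t1 k - t2 k| <= e) ->
  forall k, `|stress t1 k - stress t2 k - lin (fun k => t1 k - t2 k) k| <= kappa d * e.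
Proof.
move=> n1 n2 dr te k; have e0 : 0 <= e by apply: le_trans (te 0).
have d0 := near_ref_ge0 n1.
rewrite /stress /lin -!sumrB (le_trans (ler_norm_sum _ _ _)) //.
have -> : kappa d * e = \sum_(1 <= r < Rmax.+1) L * d * e.
  by rewrite big_const_nat subSS subn0 iter_addr addr0 -[RHS]mulr_natl /kappa !mulrA.
rewrite big_nat [leRHS]big_nat; apply: ler_sum => r rR.
rewrite -!avgTB; apply: ler_average => [|j jr]; first by rewrite !mulr_ge0.
rewrite avgB; apply: le_trans (@LP r _ _ (k - j%:Z) d rR dr (near_avg r _ n1) (near_avg r _ n2)) _.
by rewrite ler_wpM2l ?mulr_ge0 // -avgB ler_avg.
Qed.

Definition alpha : R := \big[Num.min/a 1%N 1]_(1 <= y < p.+1) a 1%N y%:Z.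
Definition beta : R :=
  \sum_(2 <= r < Rmax.+1) \big[Num.max/0]_(1 <= y < p.+1) `|a r y%:Z|.

Lemma beta_ge0 : 0 <= beta.
Proof. by apply: sumr_ge0 => r _; apply: bigmax_ge_id. Qed.

Lemma alpha_beta : 2 * beta < alpha.
Proof.
have /= := assumption3 HA; rewrite subr_gt0 -/alpha -/beta; lra.
Qed.

Lemma alpha_gt0 : 0 < alpha.
Proof. by have := alpha_beta; have := beta_ge0; lra. Qed.

Lemma alpha_le k : alpha <= a 1%N k.
Proof.
have R1 : (1 <= 1 <= Rmax)%N by rewrite Rmax_gt0.
move: k; apply: (@periodic_cell p (fun k => alpha <= a 1%N k) p_gt0) => [y|y yp].
  by rewrite (a_periodic R1).
apply: (Order.TotalTheory.bigmin_inf_seq _ y xpredT _ (fun y : nat => a 1%N y%:Z)) => //.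
by rewrite mem_index_iota.
Qed.

(** For r = 1 both averages are trivial and leave multiplication by a_1; every longer bond costs at
    most the maximum of its coefficient. *)
Lemma lin_diagonal t e : (forall k, `|t k| <= e) ->
  forall k, `|lin t k - a 1%N k * t k| <= beta * e.
Proof.
move=> te k; have e0 : 0 <= e by apply: le_trans (te 0).
rewrite /lin big_ltn // avgT1 avg1 addrAC subrr add0r.
rewrite (le_trans (ler_norm_sum _ _ _)) // /beta mulr_suml.
rewrite big_nat [leRHS]big_nat; apply: ler_sum => r rR.
have rR' : (1 <= r <= Rmax)%N by case/andP: rR => /ltnW ->.
apply: ler_average => [|j jr]; first by rewrite mulr_ge0 // bigmax_ge_id.
rewrite normrM; apply: ler_pM => //; last exact: ler_avg.
by apply: (normoo_ge p_gt0 (a_periodic rR')).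
Qed.

(* Row dominance: stress t1 - stress t2 is a_1 (t1 - t2) up to a perturbation of
   less than half the size in the sup norm. *)
Lemma stress_diagonal t1 t2 d e :
  near_ref d t1 -> near_ref d t2 -> d < rPhi ->
  (forall k, `|t1 k - t2 k| <= e) ->
  forall k, `|stress t1 k - stress t2 k - a 1%N k * (t1 k - t2 k)| <=
    (beta + kappa d) * e.
Proof.
move=> n1 n2 dr te k.
have h1 := stress_linearization n1 n2 dr te k.
have h2 := lin_diagonal te k.
rewrite -(subrK (lin (fun k => t1 k - t2 k) k) (stress t1 k - stress t2 k)) -addrA.
by rewrite (le_trans (ler_normD _ _)) // mulrDl [leRHS]addrC lerD.
Qed.

(** With D the sup norm of t1 - t2, dominance gives [alpha * D <= |c| + (beta + kappa d) * D], hence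
    [D <= 2 / alpha * |c|]. If c > 0, the off-diagonal part is then smaller than c, so a_1 (t1 - t2)
    is positive at every site. Both steps use the gap with its factor 2. *)
Lemma stress_injective n t1 t2 d (c : R) : (0 < n)%N ->
  near_ref d t1 -> near_ref d t2 -> d < rPhi -> 2 * (beta + kappa d) < alpha ->
  lat_periodic n (fun k => t1 k - t2 k) ->
  (forall k, stress t1 k - stress t2 k = c) ->
  (forall k, `|t1 k - t2 k| <= 2 / alpha * `|c|) /\
  (0 < c -> forall k, t2 k < t1 k).
Proof.
move=> n0 n1 n2 dr ab pt tc.
have a0 := alpha_gt0; have b0 := beta_ge0.
have k0 : 0 <= kappa d by rewrite /kappa !mulr_ge0 ?(near_ref_ge0 n1).
set D := normoo n (fun k => t1 k - t2 k).
have D0 : 0 <= D := normoo_ge0 _ _.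
have tD := normoo_ge n0 pt.
have err k : `|c - a 1%N k * (t1 k - t2 k)| <= (beta + kappa d) * D.
  by rewrite -(tc k); exact: (stress_diagonal n1 n2 dr).
have Dc' : D <= 2 / alpha * `|c|.
  have : D <= (`|c| + (beta + kappa d) * D) / alpha.
    apply: normoo_le => [|k].
      by rewrite divr_ge0 ?addr_ge0 ?mulr_ge0 // ?addr_ge0 // ltW.
    rewrite ler_pdivlMr //.
    apply: le_trans (_ : `|a 1%N k * (t1 k - t2 k)| <= _).
      rewrite normrM mulrC ler_wpM2r // (le_trans (alpha_le k)) //; exact: ler_norm.
    rewrite -[X in `|X|](subKr c) (le_trans (ler_normB _ _)) // lerD //.
  rewrite ler_pdivlMr // mulrAC ler_pdivlMr // => h.
  have : 2 * (beta + kappa d) * D <= alpha * D by rewrite ler_wpM2r // ltW.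
  by lra.
split=> [k|c0 k]; first exact: le_trans (tD k) Dc'.
have := err k; rewrite ler_norml => /andP[_ h].
have h2 : (beta + kappa d) * D < c.
  have [->|bk] := eqVneq (beta + kappa d) 0; first by rewrite mul0r.
  have bk0 : 0 < beta + kappa d by rewrite lt_def bk addr_ge0.
  apply: le_lt_trans (ler_wpM2l (ltW bk0) Dc') _.
  rewrite gtr0_norm // mulrA gtr_pMl // mulrA ltr_pdivrMr // mul1r mulrC; exact: ab.
have : 0 < a 1%N k * (t1 k - t2 k) by lra.
rewrite pmulr_rgt0 ?subr_gt0 //; exact: lt_le_trans (alpha_le k).
Qed.

End Stress.

(** * Inversion of the diagonal part modulo constants *)

Section WeightedCentering.
Variable R : realType.
Implicit Types (a g : int -> R) (n : nat).

(** The zero-mean solution s of [a * s = g - lambda] with an unknown constant lambda, which must be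
    the mean of g with weights 1/a. *)
Definition wcenter n a g (k : int) : R :=
  (g k - mean n (fun j => g j / a j) / mean n (fun j => (a j)^-1)) / a k.

Variables (n : nat) (a : int -> R) (al : R).
Hypotheses (n_gt0 : (0 < n)%N) (al_gt0 : 0 < al) (al_le : forall k, al <= a k).

Let a_gt0 k : 0 < a k. Proof. exact: lt_le_trans (al_le k). Qed.

Lemma mean_wcenter g : mean n (wcenter n a g) = 0.
Proof.
rewrite /wcenter; under eq_mean do rewrite mulrBl.
rewrite meanB meanZ divfK ?subrr // gt_eqF //.
by apply: mean_gt0 => // k; rewrite invr_gt0.
Qed.

Lemma wcenterB g g' k :
  wcenter n a (fun k => g k - g' k) k = wcenter n a g k - wcenter n a g' k.
Proof.
rewrite /wcenter -mulrBl; congr (_ / _).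
under [X in X / _]eq_mean do rewrite mulrBl.
by rewrite meanB; ring.
Qed.

(** The subtracted constant is a weighted average of g, so the numerator is at most 2 B. This 2 is
    the one that the factor 1/2 in Assumption 3 compensates. *)
Lemma wcenter_le g (B : R) : (forall k, `|g k| <= B) ->
  forall k, `|wcenter n a g k| <= 2 / al * B.
Proof.
move=> gB k; have B0 : 0 <= B by apply: le_trans (gB 0).
have m0 : 0 < mean n (fun j => (a j)^-1).
  by apply: mean_gt0 => // j; rewrite invr_gt0.
rewrite normrM normfV (gtr0_norm (a_gt0 k)) ler_pdivrMr //.
rewrite (@le_trans _ _ (2 * B)) //; last first.
  rewrite (_ : 2 / al * B * a k = 2 * B * (a k / al)); last by ring.
  by rewrite ler_peMr ?mulr_ge0 // ler_pdivlMr // mul1r.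
rewrite (le_trans (ler_normB _ _)) // mulrDl mul1r lerD //.
rewrite normrM normfV (gtr0_norm m0) ler_pdivrMr // -meanZ.
rewrite (le_trans (ler_norm_mean _ _)) //; apply: ler_mean => j.
by rewrite normrM normfV (gtr0_norm (a_gt0 j)) ler_wpM2r // invr_ge0 ltW.
Qed.

End WeightedCentering.

(** * Weak and strong equations for the stress, and their fixed-point solution *)

Section Solve.
Variables (R : realType) (p Rmax : nat) (Phi : nat -> R -> int -> R).
Variables (chis : int -> R) (rPhi : R).
Hypotheses (p_gt0 : (0 < p)%N) (Rmax_gt0 : (0 < Rmax)%N).
Hypothesis HA : assumptions p Rmax Phi chis rPhi.
Implicit Types (t s c u v g : int -> R) (n r : nat) (z d e gam rho : R) (k : int).

Local Notation sstar := (Dc 1 chis).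
Local Notation stress := (stress Rmax Phi).
Local Notation lin := (lin Rmax Phi chis).
Local Notation near_ref := (near_ref chis).
Local Notation alpha := (alpha p Phi chis).
Local Notation beta := (beta p Rmax Phi chis).
Local Notation K := (p%:R * C_Phi11 p Rmax Phi chis rPhi).

Lemma inner_suml n (F : nat -> int -> R) v :
  inner n (fun k => \sum_(1 <= r < Rmax.+1) F r k) v
  = \sum_(1 <= r < Rmax.+1) inner n (F r) v.
Proof. by rewrite /inner -mean_sum; apply: eq_mean => k; rewrite mulr_suml. Qed.

Lemma weak_stress n e t v : (p %| n)%N -> lat_periodic n t -> lat_periodic n v ->
  \sum_(1 <= r < Rmax.+1)
     inner n (fun y => dPhi Phi 1 r (avg r t y) y) (fdiff e r v)
  = inner n (stress t) (fdiff e 1 v).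
Proof.
move=> pn pt pv; rewrite inner_suml big_nat [RHS]big_nat; apply: eq_bigr => r rR.
rewrite fdiff_avg inner_avg //; first exact: fdiff_periodic.
move=> y; rewrite (avg_periodic r pt).
by apply: (@periodic_dvd _ p n (dPhi Phi 1 r (avg r t y)) pn) => j; rewrite (dPhi_periodic HA).
Qed.

Lemma weak_lin n e w v : (p %| n)%N -> lat_periodic n w -> lat_periodic n v ->
  \sum_(1 <= r < Rmax.+1)
     inner n (fun y => dPhi Phi 2 r (Dc r chis y) y * fdiff e r w y) (fdiff e r v)
  = inner n (lin (fdiff e 1 w)) (fdiff e 1 v).
Proof.
move=> pn pw pv; rewrite inner_suml big_nat [RHS]big_nat; apply: eq_bigr => r rR.
rewrite fdiff_avg [X in inner n _ X]fdiff_avg inner_avg //; first exact: fdiff_periodic.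
move=> y; rewrite (avg_periodic r (fdiff_periodic _ _ pw)).
by rewrite (periodic_dvd pn (a_periodic HA rR)).
Qed.

(** By [prim] the gradients of test functions are all zero-mean functions, and only constants are
    orthogonal to those. *)
Lemma cell_equationP z c : zero_mean p c ->
  cell_equation p Rmax Phi z c <->
  exists m, forall k, stress (fun k => z + Dc 1 c k) k = m.
Proof.
move=> [pc c0].
have pt : lat_periodic p (fun k => z + Dc 1 c k).
  by move=> k; rewrite /Dc (fdiff_periodic _ _ pc).
have E eta : lat_periodic p eta ->
    \sum_(1 <= r < Rmax.+1)
      inner p (fun y => dPhi Phi 1 r (z + Dc r c y) y) (Dc r eta)
    = inner p (stress (fun k => z + Dc 1 c k)) (Dc 1 eta).
  move=> pe; rewrite -(weak_stress 1 (dvdnn p) pt pe).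
  rewrite big_nat [RHS]big_nat; apply: eq_bigr => r /andP[r0 _].
  apply: eq_mean => k; congr (dPhi _ _ _ _ _ * _).
  by rewrite avgD avg_cst // /Dc fdiff_avg.
split=> [h|[m h] eta [pe _]].
  exists (mean p (stress (fun k => z + Dc 1 c k))).
  apply: ortho_zero_mean => // [|t zt]; first exact: (stress_periodic HA (dvdnn p) pt).
  rewrite -(fdiff_prim p_gt0 (oner_neq0 R) zt) -[fdiff _ _ _]/(Dc 1 _) -E.
    by apply: h; exact: zero_mean_prim.
  by case: (zero_mean_prim 1 t p_gt0).
rewrite E // /inner.
rewrite (eq_mean p (v := fun k => m * Dc 1 eta k)); last by move=> k; rewrite h.
by rewrite meanZ (zero_mean_fdiff 1 pe).2 mulr0.
Qed.

Variable L : R.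
Hypothesis L_ge0 : 0 <= L.
Hypothesis LP : linearization_modulus Rmax Phi chis rPhi L.
Local Notation kappa d := (Rmax%:R * (L * d)).

Lemma sstar_periodic n : (p %| n)%N -> lat_periodic n sstar.
Proof. by move=> pn; apply: (periodic_dvd pn); exact: (Dc_chis_periodic HA). Qed.

(** Used with z = 0 for the atomistic problem and with g = 0 for the cell problem. Inverting the
    diagonal part gives a fixed-point equation with rate [q = 2 / alpha * (beta + kappa d)]; the
    smallness condition says that the image of 0 is at most [(1 - q) * rho], so the ball of radius
    rho is preserved. *)
Lemma stress_solve n z g gam d rho : (0 < n)%N -> (p %| n)%N -> d < rPhi ->
  0 <= rho -> `|z| + rho <= d -> 2 * (beta + kappa d) < alpha ->
  lat_periodic n g -> (forall k, `|g k| <= gam) ->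
  2 * (gam + K * `|z|) <= (alpha - 2 * (beta + kappa d)) * rho ->
  exists s m, [/\ zero_mean n s, forall k, `|s k| <= rho &
    forall k, stress (fun k => z + sstar k + s k) k = g k + m].
Proof.
move=> n0 pn dr rho0 zd ab pg gB small.
have a0 := alpha_gt0 HA.
have d0 : 0 <= d by apply: le_trans zd; rewrite addr_ge0.
have b0 : 0 <= beta + kappa d by rewrite addr_ge0 ?beta_ge0 // !mulr_ge0.
have pa : lat_periodic n (fun y => dPhi Phi 2 1 (Dc 1 chis y) y).
  by apply: (periodic_dvd pn); apply: (a_periodic HA); rewrite Rmax_gt0.
(* By Assumption 2 the reference has constant stress. Subtracting it in [M] leaves at s = 0 only g
   and the effect of the shift z. *)
have [m0 sm0] : exists m, forall k, stress sstar k = m.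
  have /cell_equationP[|m h] := assumption2 HA; first exact: chis_zero_mean HA.
  exists m => k; rewrite -(h k); congr (stress _ k).
  by apply/funext => j; rewrite add0r.
set a := (fun y => _) in pa.
have aal k : alpha <= a k by exact: (alpha_le p_gt0 Rmax_gt0 HA).
pose tot s k := z + sstar k + s k.
pose M s k := g k - (stress (tot s) k - a k * s k - m0).
pose T s := wcenter n a (M s).
pose P : set (int -> R) := [set s | lat_periodic n s /\ forall k, `|s k| <= rho].
have near s : P s -> near_ref d (tot s).
  move=> [_ sr] k; rewrite /tot addrAC addrK (le_trans _ zd) //.
  by rewrite (le_trans (ler_normD _ _)) // lerD2l.
have Mdiff s s' e : P s -> P s' -> (forall k, `|s k - s' k| <= e) ->
    forall k, `|M s k - M s' k| <= (beta + kappa d) * e.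
  move=> Ps Ps' se k.
  have tt j : tot s j - tot s' j = s j - s' j by rewrite /tot; ring.
  have := @stress_diagonal _ _ _ _ _ _ p_gt0 Rmax_gt0 HA L L_ge0 LP
    (tot s) (tot s') d e (near _ Ps) (near _ Ps') dr _ k.
  rewrite tt -/(a k) distrC => h.
  have -> : M s k - M s' k =
     a k * (s k - s' k) - (stress (tot s) k - stress (tot s') k).
    by rewrite /M; ring.
  by apply: h => j; rewrite tt.
have pT s : lat_periodic n s -> lat_periodic n (T s).
  move=> ps k; rewrite /T /wcenter /M pa pg ps (stress_periodic HA pn) // => j.
  by rewrite /tot sstar_periodic // ps.
set q := 2 / alpha * (beta + kappa d).
have q0 : 0 <= q by rewrite /q mulr_ge0 // divr_ge0 // ltW.
have q1 : q < 1 by rewrite /q mulrAC ltr_pdivrMr // mul1r.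
have Tdiff s s' e : P s -> P s' -> (forall k, `|s k - s' k| <= e) ->
    forall k, `|T s k - T s' k| <= q * e.
  move=> Ps Ps' se k; rewrite /T -wcenterB /q -mulrA.
  apply: (wcenter_le n0 a0 aal); exact: Mdiff.
have P0 : P (fun=> 0) by split => // k; rewrite normr0.
have T0 k : `|T (fun=> 0) k| <= (1 - q) * rho.
  apply: le_trans (wcenter_le n0 a0 aal (B := gam + K * `|z|) _ k) _ => [j|].
    rewrite /M mulr0 subr0 (le_trans (ler_normB _ _)) // lerD //.
    rewrite -(sm0 j); apply: (stress_lipschitz_sup p_gt0 HA (d1 := d) (d2 := 0)) => //.
    - exact: near.
    - by move=> i; rewrite subrr normr0.
    - exact: rPhi_gt0 HA.
    - by move=> i; rewrite /tot addr0 addrK.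
  rewrite mulrAC ler_pdivrMr // (le_trans small) // /q le_eqVlt; apply/orP; left.
  by apply/eqP; field; rewrite gt_eqF.
have PT s : P s -> P (T s).
  move=> Ps; split; first exact: pT Ps.1.
  move=> k; rewrite -(subrK (T (fun=> 0) k) (T s k)) (le_trans (ler_normD _ _)) //.
  have -> : rho = q * rho + (1 - q) * rho by ring.
  apply: lerD; last exact: T0.
  by apply: Tdiff => // j; rewrite subr0; exact: Ps.2.
have [||||||s Ps sT] := @picard R int P T q ((1 - q) * rho) (fun=> 0).
- by rewrite q0.
- exact: P0.
- exact: PT.
- exact: Tdiff.
- move=> s_ s Ps_ cs; split => [k|k].
    have := cs (k + n%:Z); rewrite (eq_cvg _ _ (fun m => (Ps_ m).1 k)) => csn.
    exact: cvg_unique csn (cs k).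
  rewrite -lerN2; apply: (cvgr_to_ge (cvgN (cvg_norm (cs k)))).
  by apply: nearW => m; rewrite lerN2; exact: (Ps_ m).2.
- by move=> k; rewrite subr0; exact: T0.
exists s, (m0 - mean n (fun j => M s j / a j) / mean n (fun j => (a j)^-1)).
split.
- split; first exact: Ps.1.
  by rewrite -(mean_wcenter n0 a0 aal (M s)); apply: eq_mean => k; rewrite -sT.
- exact: Ps.2.
(* Multiplied by [a k], the fixed-point equation loses its diagonal term, and the stress equals g
   plus the constant just exhibited. *)
move=> k; have := sT k; rewrite /T /wcenter => /eqP.
rewrite eq_sym eq_sym; have ak : a k != 0 by rewrite gt_eqF // (lt_le_trans a0).
move=> /eqP /(congr1 (fun x => x * a k)); rewrite divfK //.
rewrite {1}/M -/(tot s) => h; lra.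
Qed.

End Solve.

(** * Derivatives of finite sums and continuity from Lipschitz bounds *)

Section RealLemmas.
Variable R : realType.
Implicit Types (f : R -> R).

Lemma is_derive_sum_seq (I : eqType) (r : seq I) (F : I -> R -> R) (dF : I -> R)
    (x : R) : (forall i, i \in r -> is_derive x 1 (F i) (dF i)) ->
  is_derive x 1 (fun t => \sum_(i <- r) F i t) (\sum_(i <- r) dF i).
Proof.
elim: r => [|i r IH] h.
  have -> : (fun t => \sum_(i <- [::]) F i t) = cst 0.
    by apply/funext => t; rewrite big_nil.
  by rewrite big_nil; exact: is_derive_cst.
have -> : (fun t => \sum_(j <- i :: r) F j t) = F i \+ (fun t => \sum_(j <- r) F j t).
  by apply/funext => t; rewrite big_cons.
rewrite big_cons; apply: is_deriveD; first by apply: h; rewrite mem_head.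
by apply: IH => j jr; apply: h; rewrite inE jr orbT.
Qed.

Lemma is_derive_mean n (F : int -> R -> R) (dF : int -> R) (x : R) :
  (forall k, is_derive x 1 (F k) (dF k)) ->
  is_derive x 1 (fun t => mean n (fun k => F k t)) (mean n dF).
Proof.
move=> h; rewrite /mean.
by apply: (@is_deriveZ R R R (fun t => \sum_(1 <= k < n.+1) F k%:Z t)); apply: is_derive_sum_seq.
Qed.

Lemma is_derive_affine f (a b df : R) : is_derive a 1 f df ->
  is_derive (0 : R) 1 (fun t : R => f (a + t * b)) (df * b).
Proof.
move=> h; apply: (@is_derive1_comp R f (fun t => a + t * b)).
  by rewrite mul0r addr0.
have -> : (fun t : R => a + t * b) = cst a \+ b \*: (id : R -> R).
  by apply/funext => t; rewrite /= [t * b]mulrC.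
have h1 : is_derive (0 : R) 1 (cst a \+ b \*: (id : R -> R)) (0 + b *: 1).
  exact: is_deriveD.
by apply: is_derive_eq h1 _; rewrite add0r /GRing.scale /= mulr1.
Qed.

(** Lets [Phi0] be differentiated from a second-order remainder bound, without differentiating the
    corrector. *)
Lemma is_derive_quadratic f (z m C eta : R) : 0 < eta ->
  (forall z', `|z' - z| < eta -> `|f z' - f z - m * (z' - z)| <= C * `|z' - z| ^+ 2) ->
  is_derive z 1 f m.
Proof.
move=> eta0 h.
have C0 : 0 <= C.
  have := h (z + eta / 2); rewrite addrC addKr gtr0_norm ?divr_gt0 // => h'.
  have /h'/(le_trans (normr_ge0 _)) : eta / 2 < eta by lra.
  by rewrite pmulr_lge0 // exprn_gt0 // divr_gt0.
have c : (fun h => h^-1 *: ((f \o shift z) (h *: 1) - f z)) @ 0^' --> m.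
  apply/cvgrPdist_le => e e0; near=> x.
  have x0 : x != 0 by near: x; exact: nbhs_dnbhs_neq.
  have xe : `|x| < eta.
    near: x; apply: dnbhs0_lt; exact: eta0.
  have xC : `|x| < e / (C + 1).
    near: x; apply: dnbhs0_lt; rewrite divr_gt0 //; lra.
  have := h (x + z); rewrite addrK => /(_ xe) hx.
  rewrite /= [_ *: 1]mulr1 /shift /= -normrN opprB.
  rewrite -[X in _ - X](mulKf x0) -[_ *: _]/(_ * _) -mulrBr normrM normfV.
  rewrite ler_pdivrMl ?normr_gt0 // [x * m]mulrC (le_trans hx) //.
  rewrite expr2 mulrCA ler_wpM2l //.
  move: xC; rewrite ltr_pdivlMr; last lra.
  rewrite mulrDr mulr1 mulrC => xC; have := normr_ge0 x; lra.
split; first by apply/cvg_ex; exists m.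
exact: cvg_lim.
Unshelve. all: by end_near. Qed.

Lemma lipschitz_within f (a b l : R) :
  (forall x y, a <= x <= b -> a <= y <= b -> `|f x - f y| <= l * `|x - y|) ->
  {within `[a, b], continuous f}.
Proof.
move=> h; apply/subspace_continuousP => x; rewrite /= in_itv /= => xab.
apply/cvgrPdist_lt => e e0; near=> y.
have yab : a <= y <= b.
  by have : `[a, b]%classic y by near: y; exact: withinT.
have l0 : 0 < `|l| + 1 by rewrite ltr_wpDl.
have xy : `|x - y| < e / (`|l| + 1).
  near: y; apply: cvg_within; apply: nbhsx_ballx; first exact: divr_gt0.
rewrite (le_lt_trans (h _ _ xab yab)) // (@le_lt_trans _ _ ((`|l| + 1) * `|x - y|)) //.
  by rewrite ler_wpM2r // (le_trans (ler_norm l)) // lerDl.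
by rewrite mulrC -ltr_pdivlMr.
Unshelve. all: by end_near. Qed.

End RealLemmas.

(** * First variation of the energy and inf-sup stability *)

Section Stability.
Variables (R : realType) (p Rmax : nat) (Phi : nat -> R -> int -> R).
Variables (chis : int -> R) (rPhi : R).
Hypotheses (p_gt0 : (0 < p)%N) (Rmax_gt0 : (0 < Rmax)%N).
Hypothesis HA : assumptions p Rmax Phi chis rPhi.
Implicit Types (t s c u v g : int -> R) (n r : nat) (z d e gam rho m : R) (k : int).

Local Notation sstar := (Dc 1 chis).
Local Notation stress := (stress Rmax Phi).
Local Notation lin := (lin Rmax Phi chis).
Local Notation near_ref := (near_ref chis).
Local Notation alpha := (alpha p Phi chis).
Local Notation beta := (beta p Rmax Phi chis).
Local Notation K := (p%:R * C_Phi11 p Rmax Phi chis rPhi).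

Lemma variation_energy N d u v : (0 < N)%N -> (p %| N)%N -> lat_periodic N u ->
  lat_periodic N v -> near_ref d (Dl N 1 u) -> d < rPhi ->
  Defs.variation (energy N Rmax Phi) u v = inner N (stress (Dl N 1 u)) (Dl N 1 v).
Proof.
move=> N0 pN pu pv nu dr; rewrite /Defs.variation derive1E.
rewrite -(weak_stress HA _ pN (fdiff_periodic _ _ pu) pv) /energy.
rewrite /inner -mean_sum.
apply: derive_val; apply: is_derive_mean => k.
apply: is_derive_sum_seq => r; rewrite mem_index_iota => rR.
have -> : (fun t : R => Phi r (Dl N r (fun k => u k + t * v k) k) k) =
    (fun t : R => Phi r (Dl N r u k + t * Dl N r v k) k).
  by apply/funext => t; congr (Phi r _ k); rewrite /Dl /fdiff; ring.
apply: (@is_derive_affine _ (fun z => Phi r z k)).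
rewrite -[fdiff _ 1 u]/(Dl N 1 u) -fdiff_avg -[fdiff _ r u]/(Dl N r u).
apply: (potential_is_derive p_gt0 HA rR).
by rewrite [Dl N r u]fdiff_avg (le_lt_trans (near_avg r k nu)).
Qed.

(** One form for two conditions: [n = p], [e = 1] is the coercivity on the cell, [n = N], [e = 1/N]
    the one on the lattice. *)
Definition infsup_lin n e m : Prop :=
  infsup_ge m [set w | zero_mean n w /\ normoo n (fdiff e 1 w) = 1]
    [set v | zero_mean n v /\ norm1 n (fdiff e 1 v) = 1]
    (fun w v => \sum_(1 <= r < Rmax.+1)
       inner n (fun x => dPhi Phi 2 r (Dc r chis x) x * fdiff e r w x) (fdiff e r v)).

Lemma avgZ r (a : R) t k : avg r (fun k => a * t k) k = a * avg r t k.
Proof. by rewrite /avg -mulr_sumr mulrCA. Qed.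

Lemma avgTZ r (a : R) t k : avgT r (fun k => a * t k) k = a * avgT r t k.
Proof. by rewrite /avgT -mulr_sumr mulrCA. Qed.

Lemma linZ (a : R) t k : lin (fun k => a * t k) k = a * lin t k.
Proof.
rewrite /lin mulr_sumr; apply: eq_bigr => r _; rewrite -avgTZ.
by congr (avgT r _ k); apply/funext => y; rewrite avgZ mulrCA.
Qed.

(** Scaled to unit sup norm and integrated by [prim], t becomes an admissible w, and gradients of
    admissible v are among the tau of the hypothesis. A vanishing t cannot be scaled and is covered
    by [0 <= B]. *)
Lemma infsup_bound n e m t (B : R) : (0 < n)%N -> (p %| n)%N -> e != 0 -> 0 <= m -> 0 <= B ->
  infsup_lin n e m -> zero_mean n t ->
  (forall tau, zero_mean n tau -> norm1 n tau = 1 -> inner n (lin t) tau <= B) ->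
  forall k, m * `|t k| <= B.
Proof.
move=> n0 pn e0 m0 B0 mis zt h k.
have tD := normoo_ge n0 zt.1 k; set D := normoo n t in tD.
have [D0|D0] := eqVneq D 0.
  have -> : `|t k| = 0 by apply/eqP; rewrite eq_le normr_ge0 andbT -D0.
  by rewrite mulr0.
have Dp : 0 < D by rewrite lt_def D0 normoo_ge0.
pose t1 k := D^-1 * t k.
have zt1 : zero_mean n t1.
  by split; [move=> j; rewrite /t1 zt.1 | rewrite meanZ zt.2 mulr0].
pose w := prim n e t1.
have wt : fdiff e 1 w = t1 by exact: fdiff_prim.
have zw : zero_mean n w by exact: zero_mean_prim.
suff : m <= B / D.
  rewrite ler_pdivlMr // => /(le_trans _); apply; exact: ler_wpM2l.
rewrite -lee_fin; apply: (le_trans mis).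
apply: le_trans (ereal_inf_lbound _) _.
  exists w => //; split => //; rewrite wt normooZ gtr0_norm ?invr_gt0 //.
  by rewrite mulVf.
apply: ge_ereal_sup => _ [v [zv v1] <-].
rewrite lee_fin (weak_lin HA e pn zw.1 zv.1) wt.
rewrite /inner (eq_mean n (v := fun k => D^-1 * (lin t k * fdiff e 1 v k))); last first.
  by move=> j; rewrite (linZ D^-1 t j) -mulrA.
rewrite meanZ mulrC; apply: ler_wpM2r; first by rewrite invr_ge0 ltW.
by apply: h => //; apply: zero_mean_fdiff; exact: zv.1.
Qed.

Variable L : R.
Hypothesis L_ge0 : 0 <= L.
Hypothesis LP : linearization_modulus Rmax Phi chis rPhi L.
Local Notation kappa d := (Rmax%:R * (L * d)).

(** The linearization at the reference misses the stress difference by at most [kappa d <= c0] times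
    the sup norm of t1 - t2; absorbing this leaves c0 out of 2 c0. As tau has zero mean, stresses
    count only modulo constants. *)
Lemma stress_stability n e t1 t2 d (c0 B : R) : (0 < n)%N -> (p %| n)%N ->
  e != 0 -> 0 < c0 -> 0 <= B -> near_ref d t1 -> near_ref d t2 -> d < rPhi ->
  kappa d <= c0 -> infsup_lin n e (2 * c0) ->
  zero_mean n (fun k => t1 k - t2 k) ->
  (forall tau, zero_mean n tau -> norm1 n tau = 1 ->
    inner n (fun k => stress t1 k - stress t2 k) tau <= B) ->
  forall k, c0 * `|t1 k - t2 k| <= B.
Proof.
move=> n0 pn e0 c00 B0 n1 n2 dr kc mis zt h.
set t := fun k => t1 k - t2 k in zt *; set D := normoo n t.
have tD : forall k, `|t k| <= D := normoo_ge n0 zt.1.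
have D0 : 0 <= D := normoo_ge0 _ _.
have k0 : 0 <= kappa d by rewrite !mulr_ge0 // (near_ref_ge0 n1).
have h1 k : 2 * c0 * `|t k| <= B + kappa d * D.
  move: k; apply: (infsup_bound n0 pn e0) => //; first by rewrite mulr_ge0 // ltW.
    by rewrite addr_ge0 // mulr_ge0.
  move=> tau ztau tau1.
  have err := stress_linearization L_ge0 LP n1 n2 dr tD.
  have -> : inner n (lin t) tau = inner n (fun k => stress t1 k - stress t2 k) tau
      - inner n (fun k => stress t1 k - stress t2 k - lin t k) tau.
    by rewrite /inner -meanB; apply: eq_mean => j; ring.
  rewrite lerD ?h //; have := inner_le n tau err; rewrite tau1 mulr1.
  by rewrite ler_norml => /andP[]; rewrite lerNl.
have h2 : D <= (B + kappa d * D) / (2 * c0).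
  apply: normoo_le => [|k].
    have Bk : 0 <= B + kappa d * D by rewrite addr_ge0 // mulr_ge0.
    by rewrite divr_ge0 // mulr_ge0 // ltW.
  by rewrite ler_pdivlMr ?mulr_gt0 // mulrC.
move: h2; rewrite ler_pdivlMr ?mulr_gt0 // => h2 k.
have h3 : kappa d * D <= c0 * D by rewrite ler_wpM2r.
have h4 : c0 * `|t k| <= c0 * D by rewrite ler_wpM2l // ltW.
by apply: (le_trans h4); lra.
Qed.

End Stability.

(** * Corrector and homogenized potential *)

Section Homogenized.
Variables (R : realType) (p Rmax : nat) (Phi : nat -> R -> int -> R).
Variables (chis : int -> R) (rPhi : R).
Hypotheses (p_gt0 : (0 < p)%N) (Rmax_gt0 : (0 < Rmax)%N).
Hypothesis HA : assumptions p Rmax Phi chis rPhi.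
Implicit Types (t s c u v g : int -> R) (n r : nat) (x z d e gam rho m : R) (k : int).

Local Notation sstar := (Dc 1 chis).
Local Notation stress := (stress Rmax Phi).
Local Notation near_ref := (near_ref chis).
Local Notation alpha := (alpha p Phi chis).
Local Notation beta := (beta p Rmax Phi chis).
Local Notation K := (p%:R * C_Phi11 p Rmax Phi chis rPhi).
Local Notation infsup_lin := (infsup_lin Rmax Phi chis).

Variable L : R.
Hypothesis L_ge0 : 0 <= L.
Hypothesis LP : linearization_modulus Rmax Phi chis rPhi L.
Local Notation kappa d := (Rmax%:R * (L * d)).

Variables (chi : R -> int -> R) (rz rchi : R).
Hypothesis HC : corrector p Rmax Phi chis rPhi chi rz rchi.

Lemma K_ge0 : 0 <= K.
Proof. by rewrite mulr_ge0 //; apply: bigmax_ge_id. Qed.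

Lemma fdiffD e r u v : fdiff e r (fun k => u k + v k) = fun k => fdiff e r u k + fdiff e r v k.
Proof. by apply/funext => k; rewrite /fdiff -mulrDl; congr (_ / _); ring. Qed.

Lemma fdiffB e r u v : fdiff e r (fun k => u k - v k) = fun k => fdiff e r u k - fdiff e r v k.
Proof. by apply/funext => k; rewrite /fdiff -mulrBl; congr (_ / _); ring. Qed.

Lemma corrector_near z rho d : d < rPhi -> 0 <= rho -> `|z| + rho <= d ->
  2 * (beta + kappa d) < alpha -> `|z| < rz -> rho < rchi ->
  2 * (K * `|z|) <= (alpha - 2 * (beta + kappa d)) * rho ->
  forall k, `|Dc 1 (chi z) k - sstar k| <= rho.
Proof.
move=> dr rho0 zd ab zrz rchi' small.
have [||s [m [zs srho sm]]] := stress_solve (z := z) (g := fun=> 0) (gam := 0)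
  p_gt0 Rmax_gt0 HA L_ge0 LP p_gt0 (dvdnn p) dr rho0 zd ab (fun k => erefl).
- by move=> k; rewrite normr0.
- by rewrite add0r.
pose c k := chis k + prim p 1 s k.
have zc := zero_mean_prim 1 s p_gt0.
have Dcc : Dc 1 c = fun k => sstar k + s k.
  by rewrite /Dc fdiffD fdiff_prim // oner_neq0.
have zmc : zero_mean p c.
  have [pchis chis0] := chis_zero_mean HA.
  by split; [move=> k; rewrite /c pchis zc.1 | rewrite meanD chis0 zc.2 addr0].
have [_ uniq] := correctorP HC zrz.
have -> : chi z = c.
  apply: uniq; split => //.
    rewrite (le_lt_trans _ rchi') //; apply: normoo_le => // k.
    rewrite (_ : (fun y => c y - chis y) = prim p 1 s); last first.
      by apply/funext => y; rewrite /c addrC addKr.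
    by rewrite /Dc fdiff_prim ?oner_neq0.
  apply/(cell_equationP p_gt0 HA) => //; exists (0 + m) => k; rewrite -(sm k) Dcc.
  by congr (stress _ k); apply/funext => j; rewrite addrA.
by move=> k; rewrite Dcc addrC addKr.
Qed.

Definition strain z k : R := z + Dc 1 (chi z) k.
(** This is the derivative of [Phi0] for small z ([Phi0_is_derive]); the averaged function is then
    constant ([stress_strain]). *)
Definition dPhi0 z : R := mean p (stress (strain z)).

(** [d0] is the radius where the linearization is controlled, [rho0] bounds the change of the
    corrector gradient, and [z1] bounds macroscopic strains; [zrho] keeps all [z' + D chi(z)] within
    [d0]. *)
Variables (c0 d0 rho0 z1 : R).
Hypotheses (c0_gt0 : 0 < c0) (d0_lt : d0 < rPhi) (d0c : kappa d0 <= c0).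
Hypothesis (d0ab : 2 * (beta + kappa d0) < alpha).
Hypotheses (z1_gt0 : 0 < z1) (z1_le : z1 <= rz) (zrho : z1 + rho0 <= d0).
Hypothesis chi_near : forall z, `|z| < z1 -> forall k, `|Dc 1 (chi z) k - sstar k| <= rho0.
Hypothesis cell_infsup : infsup_lin p 1 (2 * c0).

Lemma chi_zero_mean z : `|z| < z1 -> zero_mean p (chi z).
Proof. by move=> zz; case: (correctorP HC (lt_le_trans zz z1_le)) => -[]. Qed.

Lemma strain_periodic z : `|z| < z1 -> lat_periodic p (strain z).
Proof.
by move=> /chi_zero_mean[pc _] k; rewrite /strain /Dc (fdiff_periodic _ _ pc).
Qed.

Lemma near_mixed z z' : `|z| < z1 -> `|z'| < z1 -> near_ref d0 (fun k => z' + Dc 1 (chi z) k).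
Proof.
move=> zz zz' k; rewrite -addrA (le_trans (ler_normD _ _)) // (le_trans _ zrho) //.
by rewrite lerD ?chi_near // ltW.
Qed.

Lemma stress_strain z : `|z| < z1 -> forall k, stress (strain z) k = dPhi0 z.
Proof.
move=> zz k; have [[_ _ ce] _] := correctorP HC (lt_le_trans zz z1_le).
have [m h] := (cell_equationP p_gt0 HA z (chi_zero_mean zz)).1 ce.
by rewrite /dPhi0 (eq_mean _ h) mean_cst // h.
Qed.

Lemma mean_strain z : `|z| < z1 -> mean p (strain z) = z.
Proof.
move=> zz; rewrite /strain meanD mean_cst // (zero_mean_fdiff 1 (chi_zero_mean zz).1).2.
by rewrite addr0.
Qed.

(** Stability on the cell compares z' + D chi(z) with z' + D chi(z'), whose difference has zero
    mean. The stresses of [strain z] and [strain z'] are constants and vanish against tau; what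
    remains is the effect on the stress of shifting z to z' with the corrector fixed. *)
Lemma Dc_chi_lip z z' : `|z| < z1 -> `|z'| < z1 ->
  forall k, `|Dc 1 (chi z) k - Dc 1 (chi z') k| <= K / c0 * `|z - z'|.
Proof.
move=> zz zz' k; rewrite mulrAC ler_pdivlMr // mulrC.
have [[p1 _] [p2 _]] := (chi_zero_mean zz, chi_zero_mean zz').
have := @stress_stability _ _ _ _ _ _ HA L L_ge0 LP p 1
  (fun k => z' + Dc 1 (chi z) k) (strain z') d0 c0 (K * `|z - z'|) p_gt0 (dvdnn p)
  (oner_neq0 R) c0_gt0 (mulr_ge0 K_ge0 (normr_ge0 _)) (near_mixed zz zz')
  (near_mixed zz' zz') d0_lt d0c cell_infsup _ _ k.
have -> : Dc 1 (chi z) k - Dc 1 (chi z') k = z' + Dc 1 (chi z) k - strain z' k.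
  by rewrite /strain; ring.
apply.
  rewrite (_ : (fun k => _) = fdiff 1 1 (fun k => chi z k - chi z' k)).
    by apply: zero_mean_fdiff => j; rewrite p1 p2.
  by rewrite fdiffB; apply/funext => j; rewrite /strain /Dc; ring.
move=> tau ztau tau1.
have -> : inner p (fun k => stress (fun k => z' + Dc 1 (chi z) k) k
      - stress (strain z') k) tau
  = inner p (fun k => stress (fun k => z' + Dc 1 (chi z) k) k - stress (strain z) k) tau
    + (dPhi0 z - dPhi0 z') * mean p tau.
  rewrite -meanZ /inner -meanD; apply: eq_mean => j.
  by rewrite !stress_strain //; ring.
rewrite ztau.2 mulr0 addr0.
have h j : `|stress (fun k => z' + Dc 1 (chi z) k) j - stress (strain z) j| <= K * `|z - z'|.
  apply: (stress_lipschitz_sup p_gt0 HA (near_mixed zz zz') (near_mixed zz zz) d0_lt d0_lt).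
  move=> i; rewrite /strain (_ : z' + Dc 1 (chi z) i - (z + Dc 1 (chi z) i) = z' - z).
    by rewrite distrC.
  by ring.
have := inner_le p tau h; rewrite tau1 mulr1; apply: le_trans; exact: ler_norm.
Qed.

(** The additional factor p is the Poincare constant of the cell. *)
Lemma chi_lip z z' : `|z| < z1 -> `|z'| < z1 ->
  forall k, `|chi z k - chi z' k| <= p%:R * (K / c0) * `|z - z'|.
Proof.
move=> zz zz' k; rewrite -mulrA.
have [[p1 m1] [p2 m2]] := (chi_zero_mean zz, chi_zero_mean zz').
apply: (@zero_mean_le _ p (fun k => chi z k - chi z' k)) => //.
  by split; [move=> j; rewrite p1 p2 | rewrite meanB m1 m2 subrr].
move=> j; have := Dc_chi_lip zz zz' j; rewrite /Dc !fdiffE !divr1.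
by congr (`|_| <= _); ring.
Qed.

Lemma strain_lip z z' : `|z| < z1 -> `|z'| < z1 ->
  forall k, `|strain z k - strain z' k| <= (1 + K / c0) * `|z - z'|.
Proof.
move=> zz zz' k; have -> : strain z k - strain z' k =
  (z - z') + (Dc 1 (chi z) k - Dc 1 (chi z') k) by rewrite /strain; ring.
by rewrite (le_trans (ler_normD _ _)) // mulrDl mul1r lerD ?Dc_chi_lip.
Qed.

Lemma dPhi0_lip z z' : `|z| < z1 -> `|z'| < z1 ->
  `|dPhi0 z - dPhi0 z'| <= K * (1 + K / c0) * `|z - z'|.
Proof.
move=> zz zz'; rewrite -(stress_strain zz 0) -(stress_strain zz' 0) -mulrA.
apply: (stress_lipschitz_sup p_gt0 HA (near_mixed zz zz) (near_mixed zz' zz') d0_lt d0_lt).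
exact: strain_lip.
Qed.

(** Two strains of constant stress are exactly the situation of [stress_injective], and averaging
    over the cell replaces them by z and z'. The result makes [dPhi0] invertible with a Lipschitz
    inverse. *)
Lemma dPhi0_expand z z' : `|z| < z1 -> `|z'| < z1 ->
  `|z - z'| <= 2 / alpha * `|dPhi0 z - dPhi0 z'| /\ (dPhi0 z' < dPhi0 z -> z' < z).
Proof.
move=> zz zz'.
have [|k|h1 h2] := stress_injective p_gt0 Rmax_gt0 HA L_ge0 LP p_gt0 (near_mixed zz zz)
  (near_mixed zz' zz') d0_lt d0ab _ (c := dPhi0 z - dPhi0 z').
- by move=> k; rewrite -!/(strain _ _) !strain_periodic.
- by rewrite -[LHS]/(stress (strain z) k - stress (strain z') k) !stress_strain.
have mz : z - z' = mean p (fun k => strain z k - strain z' k).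
  by rewrite meanB !mean_strain.
split=> [|Szz].
  rewrite mz (le_trans (ler_norm_mean _ _)) // -(mean_cst (2 / alpha * _) p_gt0).
  exact: ler_mean.
rewrite -subr_gt0 mz; apply: mean_gt0 => // k; rewrite subr_gt0; apply: h2.
by rewrite subr_gt0.
Qed.

Lemma dPhi0_mono z z' : `|z| < z1 -> `|z'| < z1 -> z < z' -> dPhi0 z < dPhi0 z'.
Proof.
move=> zz zz' lzz'; rewrite ltNge le_eqVlt; apply/negP.
move=> /orP[/eqP e|/(dPhi0_expand zz zz').2 h].
  have := (dPhi0_expand zz zz').1; rewrite e subrr normr0 mulr0 normr_le0 subr_eq0 => /eqP h.
  by move: lzz'; rewrite h ltxx.
by have := lt_trans lzz' h; rewrite ltxx.
Qed.

(* The cell equation at z annihilates the variation of the corrector, so that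
   Lipschitz continuity of chi is enough for the derivative of Phi0. *)
Lemma Phi0_is_derive z : `|z| < z1 -> is_derive z 1 (Phi0 p Rmax Phi chi) (dPhi0 z).
Proof.
move=> zz; apply: (@is_derive_quadratic _ _ z (dPhi0 z) (K * (1 + K / c0) ^+ 2) (z1 - `|z|)).
  by rewrite subr_gt0.
move=> z'; rewrite ltrBrDr => zz1.
have zz' : `|z'| < z1.
  by rewrite (le_lt_trans _ zz1) // -{1}(subrK z z') ler_normD.
have near w : `|w| < z1 -> forall r y, (1 <= r)%N -> `|w + Dc r (chi w) y - Dc r chis y| < rPhi.
  move=> ww r y r0; have := near_avg r y (near_mixed ww ww).
  by rewrite avgD avg_cst // -fdiff_avg => /le_lt_trans; apply.
have -> : dPhi0 z * (z' - z) = \sum_(1 <= r < Rmax.+1) mean p (fun y =>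
    dPhi Phi 1 r (z + Dc r (chi z) y) y * ((z' + Dc r (chi z') y) - (z + Dc r (chi z) y))).
  transitivity (inner p (stress (strain z)) (fun k => strain z' k - strain z k)).
    rewrite /inner (eq_mean p (v := fun k => dPhi0 z * (strain z' k - strain z k))); last first.
      by move=> k; rewrite stress_strain.
    by rewrite meanZ meanB !mean_strain.
  rewrite inner_suml big_nat [RHS]big_nat; apply: eq_bigr => r /andP[r0 rR].
  have rR' : (1 <= r <= Rmax)%N by rewrite r0.
  rewrite -inner_avg.
  - apply: eq_mean => y; congr (dPhi _ _ _ _ _ * _).
      by rewrite /strain avgD avg_cst // -fdiff_avg.
    by rewrite avgB /strain !avgD !avg_cst // -!fdiff_avg.
  - by move=> k; rewrite !strain_periodic.
  - move=> y; rewrite (avg_periodic r (strain_periodic zz)).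
    exact: dPhi_periodic HA 1 r rR' _ _.
rewrite /Phi0 -!sumrB (le_trans (ler_norm_sum _ _ _)) //.
have q0 : 0 <= (1 + K / c0) ^+ 2 * `|z' - z| ^+ 2 by rewrite -exprMn sqr_ge0.
rewrite -mulrA (le_trans _ (ler_wpM2r q0 (sum_ell p Rmax Phi chis rPhi))) // mulr_suml.
rewrite big_nat [leRHS]big_nat; apply: ler_sum => r /andP[r0 rR].
have rR' : (1 <= r <= Rmax)%N by rewrite r0.
have l0 : 0 <= ell p Phi chis rPhi r by exact: (ell_ge0 p_gt0 HA).
rewrite -!meanB (le_trans (ler_norm_mean _ _)) //.
rewrite -[leRHS](mean_cst _ p_gt0); apply: ler_mean => y.
apply: le_trans (potential_taylor p_gt0 HA rR' (near z zz r y r0) (near z' zz' r y r0)) _.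
rewrite -mulrA -[leRHS]mul1r; apply: ler_pM.
- by rewrite invr_ge0.
- by rewrite mulr_ge0.
- by rewrite invf_le1 ?ltr0n // ler1n.
rewrite ler_wpM2l // -exprMn ler_pXn2r ?nnegrE //; last first.
  by rewrite mulr_ge0 // addr_ge0 // divr_ge0 ?K_ge0 // ltW.
have -> : z' + Dc r (chi z') y - (z + Dc r (chi z) y) =
    avg r (fun k => strain z' k - strain z k) y.
  by rewrite avgB /strain !avgD !avg_cst // -!fdiff_avg.
apply: ler_avg => [|k]; last exact: strain_lip.
by rewrite mulr_ge0 // addr_ge0 // divr_ge0 ?K_ge0 // ltW.
Qed.

Lemma variation_energy0 N u v : (0 < N)%N ->
  (forall k, `|Dl N 1 u k| < z1) ->
  Defs.variation (energy0 N p Rmax Phi chi) u v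
    = inner N (fun k => dPhi0 (Dl N 1 u k)) (Dl N 1 v).
Proof.
move=> N0 uz; rewrite /Defs.variation derive1E /energy0.
apply: derive_val; apply: is_derive_mean => k.
have -> : (fun t : R => Phi0 p Rmax Phi chi (Dl N 1 (fun k => u k + t * v k) k)) =
    (fun t : R => Phi0 p Rmax Phi chi (Dl N 1 u k + t * Dl N 1 v k)).
  by apply/funext => t; congr (Phi0 _ _ _ _ _); rewrite /Dl /fdiff; ring.
by apply: is_derive_affine; exact: Phi0_is_derive.
Qed.

(** The equation is local: [dPhi0] is inverted site by site, and the free constant is then adjusted
    to make the mean vanish. Each step is an application of the intermediate value theorem. *)
Lemma hom_solve n g gam z2 : (0 < n)%N -> 0 < z2 < z1 -> lat_periodic n g ->
  (forall k, `|g k| <= gam) -> 2 * gam <= alpha / 2 * z2 ->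
  exists s m, [/\ zero_mean n s, forall k, `|s k| <= z2 & forall k, dPhi0 (s k) = g k + m].
Proof.
move=> n0 /andP[z20 z21] pg gB small.
have a0 := alpha_gt0 HA.
have gam0 : 0 <= gam by apply: le_trans (gB 0).
have in1 z : - z2 <= z <= z2 -> `|z| < z1.
  by move=> h; rewrite (le_lt_trans _ z21) // ler_norml.
have z00 : `|0 : R| < z1 by rewrite normr0.
have zz2 : `|z2| < z1 by apply: in1; lra.
have zzN2 : `|- z2| < z1 by apply: in1; lra.
have Sup : dPhi0 0 + alpha / 2 * z2 <= dPhi0 z2.
  have := (dPhi0_expand zz2 z00).1.
  rewrite subr0 gtr0_norm // gtr0_norm ?subr_gt0; last exact: dPhi0_mono.
  by rewrite mulrAC ler_pdivlMr // => h; lra.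
have Sdown : dPhi0 (- z2) <= dPhi0 0 - alpha / 2 * z2.
  have := (dPhi0_expand z00 zzN2).1; rewrite sub0r opprK gtr0_norm // gtr0_norm ?subr_gt0.
    by rewrite mulrAC ler_pdivlMr // => h; lra.
  by apply: dPhi0_mono => //; rewrite oppr_lt0.
(* By [Sup] and [Sdown] the range contains this interval around [dPhi0 0]. The premise sits under
   the existential so that choice yields a total inverse [psi]. *)
have surj x : exists z, `|x - dPhi0 0| <= alpha / 2 * z2 -> - z2 <= z <= z2 /\ dPhi0 z = x.
  have [xs|] := boolP (`|x - dPhi0 0| <= alpha / 2 * z2); last by exists 0.
  move: (xs); rewrite ler_norml => /andP[x1 x2].
  have [| | |z] := @IVT R dPhi0 (- z2) z2 x; first lra.
  - apply: (@lipschitz_within _ _ _ _ (K * (1 + K / c0))) => y y' yz y'z.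
    by apply: dPhi0_lip; exact: in1.
  - rewrite ge_min le_max; apply/andP; split; apply/orP; [left|right]; lra.
  by rewrite in_itv /= => zz Sz; exists z.
pose psi x := projT1 (cid (surj x)).
have psiP x : `|x - dPhi0 0| <= alpha / 2 * z2 -> - z2 <= psi x <= z2 /\ dPhi0 (psi x) = x.
  exact: (projT2 (cid (surj x))).
have psi_lip x y : `|x - dPhi0 0| <= alpha / 2 * z2 -> `|y - dPhi0 0| <= alpha / 2 * z2 ->
    `|psi x - psi y| <= 2 / alpha * `|x - y|.
  move=> /psiP[xz Sx] /psiP[yz Sy]; rewrite -{2}Sx -{2}Sy.
  by apply: (dPhi0_expand _ _).1; exact: in1.
have gr k (c : R) : dPhi0 0 - gam <= c <= dPhi0 0 + gam -> `|g k + c - dPhi0 0| <= alpha / 2 * z2.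
  move=> h; have := gB k; rewrite !ler_norml => /andP[? ?]; apply/andP; split; lra.
(* At [c = dPhi0 0 - gam] every argument of [psi] is at most [dPhi0 0], so every strain is
   nonpositive; at [dPhi0 0 + gam] every strain is nonnegative. *)
pose H (c : R) := mean n (fun k => psi (g k + c)).
have [| | |c] := @IVT R H (dPhi0 0 - gam) (dPhi0 0 + gam) 0; first lra.
- apply: (@lipschitz_within _ _ _ _ (2 / alpha)) => x y xr yr.
  rewrite /H -meanB (le_trans (ler_norm_mean _ _)) //.
  rewrite -[leRHS](mean_cst _ n0); apply: ler_mean => k.
  have -> : x - y = (g k + x) - (g k + y) by ring.
  by apply: psi_lip; exact: gr.
- have sgn x : `|x - dPhi0 0| <= alpha / 2 * z2 ->
     (x <= dPhi0 0 -> psi x <= 0) /\ (dPhi0 0 <= x -> 0 <= psi x).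
    move=> /psiP[xz Sx]; split=> h; rewrite leNgt; apply/negP => h'.
      by have := dPhi0_mono z00 (in1 _ xz) h'; rewrite Sx ltNge h.
    by have := dPhi0_mono (in1 _ xz) z00 h'; rewrite Sx ltNge h.
  have Hl : H (dPhi0 0 - gam) <= 0.
    rewrite -[leRHS](mean_cst 0 n0); apply: ler_mean => k; apply: (sgn _ _).1.
      by apply: gr; lra.
    by have := gB k; rewrite ler_norml => /andP[? ?]; lra.
  have Hr : 0 <= H (dPhi0 0 + gam).
    apply: mean_ge0 => k; apply: (sgn _ _).2; first by apply: gr; lra.
    by have := gB k; rewrite ler_norml => /andP[? ?]; lra.
  by rewrite ge_min le_max Hl Hr orbT.
rewrite in_itv /= => cr Hc.
exists (fun k => psi (g k + c)), c; split.
- by split => // k; rewrite pg.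
- by move=> k; rewrite ler_norml; apply: (psiP _ _).1; exact: gr.
- by move=> k; apply: (psiP _ _).2; exact: gr.
Qed.

End Homogenized.

(** * Averages over the elements *)

Section ElementAverages.
(** [L i] stands for the offset from the node [x0] of the left node of the element containing
    [x0 + i]; the elements are the level sets of [L] among the offsets below N. *)
Variables (R : realType) (N : nat) (x0 : int) (L : nat -> nat).
Hypothesis N_gt0 : (0 < N)%N.
Hypothesis L_mono : forall i j, (i <= j)%N -> (L i <= L j)%N.
Hypothesis L_le : forall i, (L i <= i)%N.
Hypothesis L_idem : forall i, L (L i) = L i.
Implicit Types (s t f g : int -> R) (i j : nat) (k : int) (B : R).

Definition idx k : nat := `|((k - x0) %% N%:Z)%Z|%N.

Lemma idx_lt k : (idx k < N)%N.
Proof.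
rewrite /idx -ltz_nat gez0_abs ?modz_ge0 ?ltz_pmod //.
by rewrite -lt0n.
Qed.

Lemma idxK i : (i < N)%N -> idx (x0 + i%:Z) = i.
Proof. by move=> iN; rewrite /idx addrC addKr modz_nat absz_nat modn_small. Qed.

Lemma idx_periodic k : idx (k + N%:Z) = idx k.
Proof. by rewrite /idx addrAC modzDr. Qed.

Lemma idx_window t k : lat_periodic N t -> t (x0 + (idx k)%:Z) = t k.
Proof.
move=> pt; rewrite /idx gez0_abs; last by rewrite modz_ge0 // -lt0n.
rewrite -(periodic_mulz pt _ ((k - x0) %/ N%:Z)%Z); congr t.
by have := divz_eq (k - x0) N%:Z; lia.
Qed.

Definition elt_card i : R := \sum_(0 <= j < N | L j == L i) 1.

Lemma elt_card_ge1 i : (i < N)%N -> 1 <= elt_card i.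
Proof.
move=> iN; rewrite /elt_card big_mkcond (bigD1_seq i) ?mem_index_iota ?iota_uniq //=.
by rewrite eqxx lerDl; apply: sumr_ge0 => j _; case: ifP.
Qed.

Definition elt_avg t k : R :=
  (elt_card (idx k))^-1 * \sum_(0 <= j < N | L j == L (idx k)) t (x0 + j%:Z).

Lemma elt_avg_periodic t : lat_periodic N (elt_avg t).
Proof. by move=> k; rewrite /elt_avg idx_periodic. Qed.

Lemma elt_avgE t i : (i < N)%N ->
  elt_avg t (x0 + i%:Z) = (elt_card i)^-1 * \sum_(0 <= j < N | L j == L i) t (x0 + j%:Z).
Proof. by move=> iN; rewrite /elt_avg idxK. Qed.

Lemma elt_avg_self_adjoint s t : lat_periodic N s -> lat_periodic N t ->
  inner N (elt_avg s) t = inner N s (elt_avg t).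
Proof.
move=> ps pt; have pe := elt_avg_periodic.
rewrite /inner !(@mean_window _ N _ _ x0); last 2 first.
- by move=> k; rewrite ps pe.
- by move=> k; rewrite pe pt.
congr (_ * _).
pose G i j := if L j == L i then (elt_card i)^-1 * s (x0 + j%:Z) * t (x0 + i%:Z) else 0.
transitivity (\sum_(0 <= i < N) \sum_(0 <= j < N) G i j).
  rewrite big_nat [RHS]big_nat; apply: eq_bigr => i /andP[_ iN].
  rewrite elt_avgE // -mulrA mulr_suml mulr_sumr big_mkcond.
  by apply: eq_bigr => j _; rewrite /G; case: ifP => // _; rewrite mulrA.
rewrite exchange_big big_nat [RHS]big_nat; apply: eq_bigr => i /andP[_ iN].
rewrite elt_avgE // mulrCA mulr_sumr [in RHS]mulr_sumr [RHS]big_mkcond.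
apply: eq_bigr => j _; rewrite /G eq_sym; case: eqP => // e.
by rewrite -mulrA /elt_card e.
Qed.

Lemma elt_avg_local t j (c : R) : (j < N)%N ->
  (forall j', (j' < N)%N -> L j' = L j -> t (x0 + j'%:Z) = c) ->
  elt_avg t (x0 + j%:Z) = c.
Proof.
move=> jN tc; rewrite elt_avgE //.
have -> : \sum_(0 <= j' < N | L j' == L j) t (x0 + j'%:Z) = elt_card j * c.
  rewrite /elt_card mulr_suml big_nat_cond [RHS]big_nat_cond.
  by apply: eq_bigr => j' /andP[/andP[_ j'N] /eqP e]; rewrite mul1r tc.
by rewrite mulKf // gt_eqF // (lt_le_trans ltr01) // elt_card_ge1.
Qed.

Lemma elt_avg_id g : lat_periodic N g ->
  (forall i j, (i < N)%N -> (j < N)%N -> L i = L j -> g (x0 + i%:Z) = g (x0 + j%:Z)) ->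
  elt_avg g = g.
Proof.
move=> pg gL; apply/funext => k.
rewrite -(idx_window k pg) -(idx_window k (elt_avg_periodic g)).
by apply: elt_avg_local (idx_lt k) _ => j jN e; apply: gL => //; exact: idx_lt.
Qed.

Lemma elt_avg_const t i j : (i < N)%N -> (j < N)%N -> L i = L j ->
  elt_avg t (x0 + i%:Z) = elt_avg t (x0 + j%:Z).
Proof. by move=> iN jN ij; rewrite !elt_avgE // /elt_card ij. Qed.

Lemma elt_avg_comp (phi : R -> R) t :
  elt_avg (fun k => phi (elt_avg t k)) = fun k => phi (elt_avg t k).
Proof.
apply: elt_avg_id => [k|i j iN jN ij]; first by rewrite elt_avg_periodic.
by rewrite (elt_avg_const t iN jN ij).
Qed.

Lemma elt_avg_idem t : elt_avg (elt_avg t) = elt_avg t.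
Proof. exact: (elt_avg_comp id). Qed.

Lemma elt_avg_lin (a : R) s t :
  elt_avg (fun k => a * s k + t k) = fun k => a * elt_avg s k + elt_avg t k.
Proof.
apply/funext => k; rewrite /elt_avg big_split /= mulrDr -mulr_sumr; ring.
Qed.

Lemma elt_avg_cst (a : R) : elt_avg (fun=> a) = fun=> a.
Proof. exact: elt_avg_id. Qed.

Lemma ler_elt_avg s t : (forall k, s k <= t k) -> forall k, elt_avg s k <= elt_avg t k.
Proof.
move=> st k; apply: ler_wpM2l; last by apply: ler_sum => j _; exact: st.
by rewrite invr_ge0; apply: sumr_ge0.
Qed.

Lemma elt_avg_norm t k : `|elt_avg t k| <= elt_avg (fun k => `|t k|) k.
Proof.
rewrite /elt_avg normrM ger0_norm; last by rewrite invr_ge0; apply: sumr_ge0.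
by apply: ler_wpM2l; [rewrite invr_ge0; apply: sumr_ge0 | exact: ler_norm_sum].
Qed.

Lemma elt_avg_le t B : (forall k, `|t k| <= B) -> forall k, `|elt_avg t k| <= B.
Proof.
move=> tB k; rewrite (le_trans (elt_avg_norm _ _)) //.
by rewrite (le_trans (ler_elt_avg tB k)) // elt_avg_cst.
Qed.

Lemma mean_elt_avg t : lat_periodic N t -> mean N (elt_avg t) = mean N t.
Proof.
move=> pt; have := elt_avg_self_adjoint pt (fun k => erefl (1 : R)).
rewrite elt_avg_cst /inner => h.
by rewrite (eq_mean N (v := fun k => elt_avg t k * 1)) ?h => [|k];
  [apply: eq_mean => k; rewrite mulr1 | rewrite mulr1].
Qed.

Lemma norm1_elt_avg t : lat_periodic N t -> norm1 N (elt_avg t) <= norm1 N t.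
Proof.
move=> pt; rewrite /norm1 -[leRHS]mean_elt_avg; last by move=> k; rewrite pt.
by apply: ler_mean => k; exact: elt_avg_norm.
Qed.

(** A sum up to i is a pairing with the indicator of the sites before i, and self-adjointness moves
    the defect onto this indicator. The latter is constant on each element not containing i, and on
    all elements when i is a left node, so at most one element remains, with coefficients in
    [-1, 1]. *)
Lemma elt_avg_defect t i : lat_periodic N t -> (i < N)%N ->
  `|\sum_(0 <= j < i) (elt_avg t (x0 + j%:Z) - t (x0 + j%:Z))| <=
    if L i == i then 0 else \sum_(0 <= j < N | L j == L i) `|t (x0 + j%:Z)|.
Proof.
move=> pt iN.
pose one k : R := (idx k < i)%N%:R.
have pone : lat_periodic N one by move=> k; rewrite /one idx_periodic.
have -> : \sum_(0 <= j < i) (elt_avg t (x0 + j%:Z) - t (x0 + j%:Z)) =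
    \sum_(0 <= j < N) (elt_avg one (x0 + j%:Z) - one (x0 + j%:Z)) * t (x0 + j%:Z).
  transitivity (N%:R * (inner N one (elt_avg t) - inner N one t)); last first.
    rewrite -elt_avg_self_adjoint // /inner -meanB (@mean_window _ N _ _ x0).
      rewrite mulrA mulfV ?mul1r ?pnatr_eq0 -?lt0n //.
      by apply: eq_bigr => j _; rewrite mulrBl.
    by move=> k; rewrite !elt_avg_periodic pone pt.
  rewrite /inner -meanB (@mean_window _ N _ _ x0); last first.
    by move=> k; rewrite !elt_avg_periodic pone pt.
  rewrite mulrA mulfV ?mul1r ?pnatr_eq0 -?lt0n //.
  rewrite (big_nat_widen _ _ N) ?(ltnW iN) // big_mkcond /= big_nat [RHS]big_nat.
  apply: eq_bigr => j /andP[_ jN]; rewrite -mulrBr /one idxK //.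
  by case: ltnP; rewrite ?mul1r ?mul0r.
have oneE j : (j < N)%N -> one (x0 + j%:Z) = (j < i)%N%:R.
  by move=> jN; rewrite /one idxK.
have cmp j : L j != L i -> (j < i)%N = (L j < L i)%N.
  move=> ne; case: (ltnP j i) => [/ltnW|] /L_mono; first by rewrite ltn_neqAle ne => ->.
  by rewrite ltnNge => ->.
have off j : (j < N)%N -> (L j != L i) || (L i == i) ->
    elt_avg one (x0 + j%:Z) - one (x0 + j%:Z) = 0.
  move=> jN h; rewrite oneE //; apply/eqP; rewrite subr_eq0; apply/eqP.
  apply: elt_avg_local => // j' j'N e; rewrite oneE //; congr (nat_of_bool _)%:R.
  have [ji|ji] := eqVneq (L j) (L i); last by rewrite !cmp ?e.
  move: h; rewrite ji eqxx /= => /eqP Li.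
  by rewrite !ltnNge -{1}Li -{1}ji -{1}e L_le -{1}Li -{1}ji L_le.
case: ifP => [Li|Li].
  rewrite big_nat big1 ?normr0 // => j /andP[_ jN].
  by rewrite off ?mul0r // Li orbT.
have -> : \sum_(0 <= j < N | L j == L i) `|t (x0 + j%:Z)| =
    \sum_(0 <= j < N) if L j == L i then `|t (x0 + j%:Z)| else 0 by exact: big_mkcond.
rewrite (le_trans (ler_norm_sum _ _ _)) // big_nat [leRHS]big_nat.
apply: ler_sum => j /andP[_ jN]; case: ifP => [ji|/negbT ji]; last first.
  by rewrite off ?mul0r ?normr0 // ji.
rewrite normrM ler_piMl //.
have one01 k : 0 <= one k <= 1 by rewrite /one; case: (_ < _)%N; rewrite lexx ler01.
have a0 : 0 <= elt_avg one (x0 + j%:Z).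
  have := @ler_elt_avg (fun=> 0) one _ (x0 + j%:Z); rewrite elt_avg_cst; apply.
  by move=> k; case/andP: (one01 k).
have a1 : elt_avg one (x0 + j%:Z) <= 1.
  have := @ler_elt_avg one (fun=> 1) _ (x0 + j%:Z); rewrite elt_avg_cst; apply.
  by move=> k; case/andP: (one01 k).
by have /andP[? ?] := one01 (x0 + j%:Z); rewrite ler_norml; apply/andP; split; lra.
Qed.

Lemma elt_card_pred j : (j < N)%N ->
  \sum_(0 <= i < N | (L j == L i) && (L i != i)) 1 = elt_card j - 1 :> R.
Proof.
move=> jN; have LjN : (L j < N)%N by exact: leq_ltn_trans (L_le j) jN.
rewrite /elt_card big_mkcond (bigD1_seq (L j)) ?mem_index_iota ?iota_uniq //=.
rewrite [in RHS]big_mkcond [in RHS](bigD1_seq (L j)) ?mem_index_iota ?iota_uniq //=.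
rewrite !L_idem !eqxx /= add0r [1 + _]addrC addrK; apply: eq_bigr => i ij.
by rewrite eq_sym; case: eqP => //= ->; rewrite eq_sym ij.
Qed.

(** The defect vanishes at left nodes, so an element with m sites contributes only m - 1 terms, each
    at most B / (m - 1) times the norm of t on the element. As h = m eps, the weight (m - 1) eps is
    h - eps. *)
Lemma interpolation_error f t B : lat_periodic N t ->
  (forall i, (i < N)%N -> `|(elt_card i - 1) * N%:R^-1 * f (x0 + i%:Z)| <= B) ->
  `|N%:R^-1 * \sum_(0 <= i < N) f (x0 + i%:Z) *
      (N%:R^-1 * \sum_(0 <= j < i) (elt_avg t (x0 + j%:Z) - t (x0 + j%:Z)))|
   <= B * norm1 N t.
Proof.
move=> pt fB; have B0 : 0 <= B by apply: le_trans (fB 0%N N_gt0).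
have Ni : 0 <= N%:R^-1 :> R by rewrite invr_ge0.
rewrite /norm1 (@mean_window _ N (fun k => `|t k|) _ x0); last by move=> k; rewrite pt.
rewrite mulrCA normrM ger0_norm // ler_wpM2l // (le_trans (ler_norm_sum _ _ _)) //.
pose G i j := if (L j == L i) && (L i != i) then B / (elt_card i - 1) * `|t (x0 + j%:Z)| else 0.
apply: (@le_trans _ _ (\sum_(0 <= i < N) \sum_(0 <= j < N) G i j)).
  rewrite big_nat [leRHS]big_nat; apply: ler_sum => i /andP[_ iN].
  rewrite !normrM (ger0_norm Ni).
  have := elt_avg_defect pt iN; case: ifP => Li.
    rewrite normr_le0 => /eqP ->; rewrite normr0 !mulr0; apply: sumr_ge0 => j _.
    by rewrite /G Li andbF.
  move=> h; have c1 : 0 < elt_card i - 1.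
    rewrite -elt_card_pred // big_mkcond (bigD1_seq i) ?mem_index_iota ?iota_uniq //=.
    rewrite Li eqxx /= ltr_pwDl //; apply: sumr_ge0 => j _; by case: ifP.
  have -> : \sum_(0 <= j < N) G i j =
      B / (elt_card i - 1) * \sum_(0 <= j < N | L j == L i) `|t (x0 + j%:Z)|.
    rewrite mulr_sumr [RHS]big_mkcond; apply: eq_bigr => j _.
    by rewrite /G Li andbT.
  rewrite mulrA; apply: ler_pM => //.
  rewrite ler_pdivlMr // mulrC.
  rewrite mulrCA mulrC; have := fB i iN.
  by rewrite !normrM (gtr0_norm c1) (ger0_norm Ni).
rewrite exchange_big mulr_sumr big_nat [leRHS]big_nat; apply: ler_sum => j /andP[_ jN].
have -> : \sum_(0 <= i < N) G i j = (B / (elt_card j - 1) * (elt_card j - 1)) * `|t (x0 + j%:Z)|.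
  rewrite -[X in _ * X * _](elt_card_pred jN) mulr_sumr mulr_suml [RHS]big_mkcond.
  apply: eq_bigr => i _; rewrite /G; case: ifP => // /andP[/eqP e _].
  by rewrite mulr1 /elt_card e.
rewrite ler_wpM2r //; have [->|ne] := eqVneq (elt_card j - 1) 0; first by rewrite mulr0.
by rewrite divfK.
Qed.

End ElementAverages.

(** * Forces and the coarse space *)

Section LatticeForces.
Variables (R : realType) (N : nat).
Hypothesis N_gt0 : (0 < N)%N.
Implicit Types (f g u v t : int -> R) (i j k : int).

Let e : R := N%:R^-1.

Let e_neq0 : e != 0.
Proof. by rewrite invr_eq0 pnatr_eq0 -lt0n. Qed.

Lemma zero_mean_force g : lat_periodic N g -> zero_mean N (fun k => (g (k - 1) - g k) / e).
Proof.
move=> pg; split=> [k|]; first by rewrite addrAC !pg.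
rewrite (eq_mean N (v := fun k => e^-1 * (g (k - 1) - g k))); last first.
  by move=> k; rewrite mulrC.
by rewrite meanZ meanB mean_shift // subrr mulr0.
Qed.

(** Ensures that the sets under the suprema in [norm_neg1oo] and the coarse dual norms are bounded,
    so that these are genuine suprema. *)
Lemma force_bounded f : zero_mean N f ->
  exists2 B, 0 <= B & forall v, lat_periodic N v -> `|inner N f v| <= B * norm_11 N v.
Proof.
move=> zf; have [g pg fg] := force_potential N_gt0 e_neq0 zf.
exists (normoo N g) => [|v pv]; first exact: normoo_ge0.
have -> : inner N f v = inner N g (fdiff e 1 v).
  by rewrite inner_fdiff //; apply: eq_mean => k; rewrite fg.
by apply: inner_le; exact: normoo_ge.
Qed.

Lemma norm_neg1oo_ub f : zero_mean N f ->
  has_ubound [set inner N f v | v in [set v | zero_mean N v /\ norm_11 N v = 1]].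
Proof.
move=> zf; have [B B0 fB] := force_bounded zf.
exists B => _ [v [[pv _] v1] <-]; have := fB v pv; rewrite v1 mulr1.
by apply: le_trans; exact: ler_norm.
Qed.

Lemma norm_neg1oo_ge f v : zero_mean N f -> zero_mean N v -> norm_11 N v = 1 ->
  inner N f v <= norm_neg1oo N f.
Proof.
move=> zf zv v1; apply: sup_upper_bound; last by exists v.
by split; [exists (inner N f v), v | exact: norm_neg1oo_ub].
Qed.

Lemma inner_opp f v : inner N f (fun k => - v k) = - inner N f v.
Proof. by rewrite /inner -meanN; apply: eq_mean => k; rewrite mulrN. Qed.

Lemma norm_neg1oo_ge0 f : zero_mean N f -> 0 <= norm_neg1oo N f.
Proof.
move=> zf; have [[x [v [zv v1] _]]|] := pselect ([set inner N f v | v in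
    [set v | zero_mean N v /\ norm_11 N v = 1]] !=set0); last first.
  by move=> /set0P/negP/negPn/eqP h; rewrite /norm_neg1oo h sup0.
have zv' : zero_mean N (fun k => - v k).
  by split; [move=> k; rewrite zv.1 | rewrite meanN zv.2 oppr0].
have v1' : norm_11 N (fun k => - v k) = 1.
  rewrite -v1; apply: eq_mean => k; rewrite /Dl !fdiffE -normrN.
  by congr `|_|; ring.
have := norm_neg1oo_ge zf zv v1; have := norm_neg1oo_ge zf zv' v1'.
rewrite inner_opp; lra.
Qed.

Lemma delta_neq0 g i k : lat_periodic N g -> delta R N i k != 0 -> g k = g i.
Proof.
move=> pg; rewrite /delta.
have [h _|_ /eqP //] := eqVneq ((k - i) %% N%:Z)%Z 0.
rewrite [in LHS](_ : k = i + ((k - i) %/ N%:Z)%Z * N%:Z); first exact: periodic_mulz.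
by have := divz_eq (k - i) N%:Z; rewrite h; lia.
Qed.

(** The primitive of N/2 (delta_i - delta_j) has unit norm for sites distinct modulo N and is paired
    with f to (g i - g j) / 2. Congruent sites fall under the case g i = g j. *)
Lemma potential_osc f g : zero_mean N f -> lat_periodic N g ->
  (forall k, f k = (g (k - 1) - g k) / e) ->
  forall i j, `|g i - g j| <= 2 * norm_neg1oo N f.
Proof.
move=> zf pg fg i j.
wlog gij : i j / g j <= g i => [hw|].
  by case: (leP (g j) (g i)) => [/hw //|/ltW/hw]; rewrite distrC.
have [e1|ne] := eqVneq (g i) (g j).
  by rewrite e1 subrr normr0 mulr_ge0 // norm_neg1oo_ge0.
rewrite ger0_norm ?subr_ge0 // mulrC -ler_pdivrMr //.
have Nn : N%:R != 0 :> R by rewrite pnatr_eq0 -lt0n.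
pose t k : R := N%:R / 2 * (delta R N i k - delta R N j k).
have mdelta l : mean N (delta R N l) = e.
  rewrite /e; have := mean_delta l N_gt0 (fun k => erefl (1 : R)); rewrite mulr1 => <-.
  by apply: eq_mean => k; rewrite mul1r.
have zt : zero_mean N t.
  split; first by move=> k; rewrite /t !delta_periodic.
  by rewrite meanZ meanB !mdelta subrr mulr0.
have Dv : fdiff e 1 (prim N e t) = t by exact: fdiff_prim.
have zv := zero_mean_prim e t N_gt0.
have v1 : norm_11 N (prim N e t) = 1.
  rewrite /norm_11 -[Dl N 1 _]/(fdiff e 1 _) Dv /norm1.
  rewrite (eq_mean N (v := fun k => N%:R / 2 * (delta R N i k + delta R N j k))).
    by rewrite meanZ meanD !mdelta /e; field.
  move=> k; rewrite /t normrM ger0_norm ?divr_ge0 //; congr (_ * _).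
  have [hi|hi] := eqVneq (delta R N i k) 0; have [hj|hj] := eqVneq (delta R N j k) 0.
  - by rewrite hi hj subrr normr0 addr0.
  - by rewrite hi sub0r normrN add0r /delta ger0_norm.
  - by rewrite hj subr0 addr0 /delta ger0_norm.
  - by move: ne; rewrite -(delta_neq0 pg hi) -(delta_neq0 pg hj) eqxx.
apply: le_trans (norm_neg1oo_ge zf zv v1).
have -> : inner N f (prim N e t) = inner N g t.
  rewrite -[in RHS]Dv inner_fdiff //; last exact: zv.1.
  by apply: eq_mean => k; rewrite fg.
rewrite /inner (eq_mean N (v := fun k => N%:R / 2 * (g k * delta R N i k - g k * delta R N j k))).
  rewrite meanZ meanB !mean_delta // le_eqVlt; apply/orP; left; apply/eqP; field.
  by rewrite Nn.
by move=> k; rewrite /t; ring.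
Qed.

End LatticeForces.

Section CoarseSpace.
Variables (R : realType) (N : nat) (node : pred int) (x0 : int).
Hypotheses (N_gt0 : (0 < N)%N) (node_per : forall k : int, node (k + N%:Z) = node k).
Hypothesis node_x0 : node x0.
Implicit Types (f g u v t s h : int -> R) (i j : nat) (k : int).

(** The value 0 at the start is correct because [x0] is itself a node. *)
Fixpoint last_node i : nat :=
  if i is i'.+1 then (if node (x0 + i%:Z) then i else last_node i') else 0%N.

Lemma last_node_le i : (last_node i <= i)%N.
Proof. by elim: i => //= i IH; case: ifP => // _; rewrite ltnW. Qed.

Lemma last_node_node i : node (x0 + (last_node i)%:Z).
Proof. by elim: i => [|i IH] /=; [rewrite addr0 | case: ifP]. Qed.

Lemma last_node_id i : node (x0 + i%:Z) -> last_node i = i.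
Proof. by case: i => //= i ->. Qed.

Lemma last_node_idem i : last_node (last_node i) = last_node i.
Proof. exact/last_node_id/last_node_node. Qed.

Lemma last_node_mono i j : (i <= j)%N -> (last_node i <= last_node j)%N.
Proof.
elim: j => [|j IH]; first by rewrite leqn0 => /eqP ->.
rewrite leq_eqVlt ltnS => /orP[/eqP -> //|ij] /=; case: ifP => [_|_]; last exact: IH.
by rewrite (leq_trans (last_node_le i)) // leqW.
Qed.

Let e : R := N%:R^-1.

Let e_neq0 : e != 0.
Proof. by rewrite invr_eq0 pnatr_eq0 -lt0n. Qed.

Local Notation Q := (@elt_avg R N x0 last_node).
Local Notation card := (@elt_card R N last_node).
Local Notation idx := (idx N x0).

Lemma node_idx k : node (x0 + (idx k)%:Z) = node k.
Proof.
have pn : lat_periodic N (fun k => (node k)%:R : R) by move=> j; rewrite node_per.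
have /eqP := idx_window x0 N_gt0 k pn; rewrite eqr_nat.
by case: (node _); case: (node _).
Qed.

(** With [elt_avg_coarse] this identifies the coarse functions as those whose gradient is fixed by
    the element average. *)
Lemma coarse_elt_avg u : coarse N node u -> Q (Dl N 1 u) = Dl N 1 u.
Proof.
move=> [pu cu]; have pt := fdiff_periodic e 1 pu.
apply: (elt_avg_id N_gt0) => // i j _ _ ij.
have h n : Dl N 1 u (x0 + n%:Z) = Dl N 1 u (x0 + (last_node n)%:Z).
  elim: n => //= n IH; case: ifP => // /negbT /cu <-; rewrite -IH.
  by congr (Dl N 1 u _); lia.
by rewrite h ij -h.
Qed.

Lemma elt_avg_coarse u : lat_periodic N u -> Q (Dl N 1 u) = Dl N 1 u -> coarse N node u.
Proof.
move=> pu Qu; split=> // xi nxi.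
have pt : lat_periodic N (Dl N 1 u) by exact: fdiff_periodic.
have iN := idx_lt x0 N_gt0 xi.
rewrite -(idx_window x0 N_gt0 xi pt).
have pt1 : lat_periodic N (fun k => Dl N 1 u (k - 1)).
  by move=> k; rewrite addrAC pt.
rewrite -(idx_window x0 N_gt0 xi pt1).
move: nxi iN; rewrite -node_idx; case: (idx xi) => [|i]; first by rewrite addr0 node_x0.
move=> ni iN; have -> : x0 + i.+1%:Z - 1 = x0 + i%:Z by lia.
rewrite -Qu; apply: elt_avg_const => //; first exact: ltnW.
by rewrite /= (negbTE ni).
Qed.

(** The right end is the first node beyond [x0 + i]. It is at most [x0 + N], a node by periodicity,
    so no element crosses the end of the window. *)
Lemma card_element i : (i < N)%N -> exists xi eta : int,
  [/\ consecutive node xi eta, xi <= x0 + i%:Z < eta & card i = (eta - xi)%:~R].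
Proof.
move=> iN; have ex : exists m, (i < m)%N && node (x0 + m%:Z).
  by exists N; rewrite iN node_per.
case: (ex_minnP ex) => m /andP[im nm] mmin.
have mN : (m <= N)%N by apply: mmin; rewrite iN node_per.
have li := last_node_le i.
exists (x0 + (last_node i)%:Z), (x0 + m%:Z); split.
- split => //; first exact: last_node_node.
    by rewrite ltrD2l ltz_nat (leq_ltn_trans li).
  move=> k /andP[k1 k2]; apply/negP => nk.
  have [j kj] : exists j : nat, k = x0 + j%:Z.
    exists `|(k - x0)%R|%N; rewrite gez0_abs; first by rewrite addrC subrK.
    by lia.
  move: k1 k2 nk; rewrite kj !ltrD2l !ltz_nat => k1 k2 nk.
  have [ij|ji] := ltnP i j.
    by have := mmin j; rewrite ij nk leqNgt k2 => /(_ isT).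
  by have := last_node_mono ji; rewrite (last_node_id nk) leqNgt k1.
- by rewrite lerD2l ltrD2l lez_nat ltz_nat li im.
have -> : x0 + m%:Z - (x0 + (last_node i)%:Z) = (m - last_node i)%N%:Z.
  by rewrite -subzn; [lia | rewrite (leq_trans li) // ltnW].
have lm : last_node m = m by exact: last_node_id.
have E j : (last_node j == last_node i) = (j < m)%N && (last_node i <= j)%N.
  apply/eqP/andP => [ji|[jm ij]].
    rewrite -{1}ji last_node_le; split=> //; rewrite ltnNge; apply/negP => /last_node_mono.
    by rewrite lm ji leqNgt (leq_ltn_trans li im).
  have h1 : (last_node i <= last_node j)%N.
    by rewrite -(last_node_idem i) last_node_mono.
  apply/eqP; rewrite eqn_leq h1 andbT.
  have [ji|ij'] := leqP (last_node j) i.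
    by rewrite -(last_node_idem j) last_node_mono.
  have := mmin (last_node j); rewrite ij' last_node_node => /(_ isT).
  by rewrite leqNgt (leq_ltn_trans (last_node_le j) jm).
rewrite /elt_card (eq_bigl _ _ E) -big_nat_widenl // -(big_nat_widen _ _ _ xpredT).
  by rewrite big_const_nat iter_addr addr0.
by [].
Qed.

Lemma mesh_sizeE h : mesh_size N node h ->
  forall i, (i < N)%N -> h (x0 + i%:Z) = card i * N%:R^-1.
Proof.
move=> hh i iN; have [xi [eta [c xr ->]]] := card_element iN.
exact: hh c _ xr.
Qed.

(** Centring changes nothing for a gradient, and extends the construction to strains of nonzero mean
    such as the Kronecker deltas of [coarse_riesz]. *)
Definition coarse_proj t : int -> R := prim N e (Defs.center N (Q t)).

Lemma fdiff_coarse_proj t : lat_periodic N t ->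
  Dl N 1 (coarse_proj t) = Defs.center N (Q t).
Proof.
by move=> pt; apply: fdiff_prim => //; apply: zero_mean_center => //; exact: elt_avg_periodic.
Qed.

Lemma coarse_coarse_proj t : lat_periodic N t -> coarse_zero_mean N node (coarse_proj t).
Proof.
move=> pt; have [pp p0] := zero_mean_prim e (Defs.center N (Q t)) N_gt0.
split => //; apply: elt_avg_coarse => //; rewrite fdiff_coarse_proj //.
exact: (@elt_avg_comp R N x0 last_node N_gt0 (fun x => x - mean N (Q t)) t).
Qed.

Lemma coarse_proj_id v : coarse_zero_mean N node v -> coarse_proj (Dl N 1 v) = v.
Proof.
move=> [cv v0]; have pv := cv.1.
apply: (fdiff_inj N_gt0 e_neq0).
- exact: zero_mean_prim.
- by split.
rewrite -[LHS]/(Dl N 1 _) fdiff_coarse_proj; last exact: fdiff_periodic.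
rewrite coarse_elt_avg //; apply/funext => k.
by rewrite /Defs.center (zero_mean_fdiff e pv).2 subr0.
Qed.

Lemma coarse_proj_lin (a : R) s t : lat_periodic N s -> lat_periodic N t ->
  coarse_proj (fun k => a * s k + t k) = fun k => a * coarse_proj s k + coarse_proj t k.
Proof.
move=> ps pt; have ppj s' : zero_mean N (coarse_proj s') by exact: zero_mean_prim.
apply: (fdiff_inj N_gt0 e_neq0) => //.
  split; first by move=> k; rewrite !(ppj _).1.
  by rewrite meanD meanZ !(ppj _).2 mulr0 addr0.
have -> : fdiff e 1 (fun k => a * coarse_proj s k + coarse_proj t k)
    = fun k => a * Dl N 1 (coarse_proj s) k + Dl N 1 (coarse_proj t) k.
  by apply/funext => k; rewrite /Dl /fdiff -/e; ring.
rewrite -[LHS]/(Dl N 1 _) !fdiff_coarse_proj //; last by move=> k; rewrite ps pt.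
apply/funext => k; rewrite /Defs.center elt_avg_lin meanD meanZ; ring.
Qed.

Variable F : (int -> R) -> R.
Hypothesis HF : coarse_functional N node F.

(** F after [coarse_proj] is linear on all periodic strains, so its values on Kronecker deltas form
    a density; N compensates the normalisation of the mean. *)
Lemma coarse_riesz : exists2 g, lat_periodic N g &
  forall t, lat_periodic N t -> F (coarse_proj t) = inner N g t.
Proof.
have Flin := HF.1.
pose l t := F (coarse_proj t).
have llin (a : R) s t : lat_periodic N s -> lat_periodic N t ->
    l (fun k => a * s k + t k) = a * l s + l t.
  move=> ps pt; rewrite /l coarse_proj_lin // Flin //.
    exact: (coarse_coarse_proj ps).1.
  exact: (coarse_coarse_proj pt).1.
have p0 : lat_periodic N (fun=> 0 : R) by [].
have l0 : l (fun=> 0) = 0.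
  have := llin 1 _ _ p0 p0; under [X in l X]eq_fun do rewrite mulr0 addr0.
  by rewrite mul1r => /eqP; rewrite -subr_eq0 opprD addNKr oppr_eq0 => /eqP.
exists (fun i : int => N%:R * l (delta R N i)) => [i|t pt].
  congr (_ * l _); apply/funext => k; rewrite /delta opprD addrA.
  by rewrite -[in RHS](modzDr (k - i)) -modzDr addrNK modzDr.
have lsum (r : seq nat) : l (fun k => \sum_(i <- r) t i%:Z * delta R N i%:Z k)
     = \sum_(i <- r) t i%:Z * l (delta R N i%:Z).
  elim: r => [|i r IH].
    by rewrite big_nil -[RHS]l0; congr l; apply/funext => k; rewrite big_nil.
  rewrite big_cons -IH -llin.
  - by congr l; apply/funext => k; rewrite big_cons.
  - exact: delta_periodic.
  - by move=> k; apply: eq_bigr => j _; rewrite delta_periodic.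
have -> : F (coarse_proj t) = \sum_(1 <= i < N.+1) t i%:Z * l (delta R N i%:Z).
  by rewrite -lsum -/(l t); congr l; apply/funext => k; exact: delta_sum.
rewrite /inner /mean mulr_sumr; apply: eq_bigr => i _.
by rewrite [t _ * _]mulrC !mulrA mulVf ?mul1r // pnatr_eq0 -lt0n.
Qed.

Lemma coarse_force : exists2 f, zero_mean N f &
  forall v, zero_mean N v -> inner N f v = F (coarse_proj (Dl N 1 v)).
Proof.
have [g pg gF] := coarse_riesz.
exists (fun k => (g (k - 1) - g k) / e); first exact: zero_mean_force.
move=> v [pv v0]; rewrite gF; last exact: fdiff_periodic.
by rewrite inner_fdiff.
Qed.

Lemma norm_coarse_proj v : lat_periodic N v ->
  norm_11 N (coarse_proj (Dl N 1 v)) <= norm_11 N v.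
Proof.
move=> pv; have pt : lat_periodic N (Dl N 1 v) by exact: fdiff_periodic.
rewrite /norm_11 fdiff_coarse_proj //.
have -> : Defs.center N (Q (Dl N 1 v)) = Q (Dl N 1 v).
  by apply/funext => k; rewrite /Defs.center mean_elt_avg // (zero_mean_fdiff e pv).2 subr0.
exact: norm1_elt_avg.
Qed.

Lemma coarseZ (a : R) v : coarse_zero_mean N node v ->
  coarse_zero_mean N node (fun k => a * v k).
Proof.
move=> [[pv cv] v0]; split; last by rewrite meanZ v0 mulr0.
split=> [k|xi nxi]; first by rewrite pv.
have E k : Dl N 1 (fun k => a * v k) k = a * Dl N 1 v k.
  by rewrite /Dl !fdiffE -mulrBr mulrA.
by rewrite !E cv.
Qed.

Lemma coarse_functionalZ (a : R) v : coarse_zero_mean N node v ->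
  F (fun k => a * v k) = a * F v.
Proof.
move=> [cv _]; have c0 : coarse N node (fun=> 0 : R).
  by split=> // xi _; rewrite /Dl !fdiffE.
have F0 : F (fun=> 0) = 0.
  have := HF.1 1 _ _ c0 c0; under [X in F X]eq_fun do rewrite mulr0 addr0.
  by rewrite mul1r => /eqP; rewrite -subr_eq0 opprD addNKr oppr_eq0 => /eqP.
rewrite -[RHS]addr0 -F0 -HF.1 //; congr F; apply/funext => k.
by rewrite addr0.
Qed.

(* A bound on the coarse unit sphere controls the coarse part of any fine test
   function, whose coarse interpolant may degenerate to a constant. *)
Lemma coarse_sphere_le G B v : zero_mean N v -> norm_11 N v = 1 ->
  (forall (a : R) v, coarse_zero_mean N node v -> G (fun k => a * v k) = a * G v) ->
  (forall v, coarse_unit_sphere N node v -> `|G v| <= B) -> 0 <= B ->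
  `|G (coarse_proj (Dl N 1 v))| <= B.
Proof.
move=> [pv v0] v1 GZ GB B0; set vh := coarse_proj _.
have pt : lat_periodic N (Dl N 1 v) by exact: fdiff_periodic.
have cvh : coarse_zero_mean N node vh by exact: coarse_coarse_proj.
have le1 : norm_11 N vh <= 1 by rewrite -v1; exact: norm_coarse_proj.
have [n0|n0] := eqVneq (norm_11 N vh) 0.
  have vh0 : vh = fun k => 0 * vh k.
    apply: (fdiff_inj N_gt0 e_neq0); [by split; [exact: cvh.1.1 | exact: cvh.2]| |].
      by have [[? _] ?] := coarseZ 0 cvh.
    apply/funext => k; have pvh := fdiff_periodic e 1 cvh.1.1.
    have h := @mean_eq0 _ N (fun k => `|fdiff e 1 vh k|) N_gt0 _ (fun=> normr_ge0 _) n0 k.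
    have /eqP := h (fun k => congr1 _ (pvh k)); rewrite normr_eq0 => /eqP ->.
    by rewrite fdiffE !mul0r subrr mul0r.
  by rewrite vh0 GZ // mul0r normr0.
have np : 0 < norm_11 N vh by rewrite lt_def n0; apply: mean_ge0 => k.
have -> : vh = fun k => norm_11 N vh * ((norm_11 N vh)^-1 * vh k).
  by apply/funext => k; rewrite mulVKf.
have cs := coarseZ (norm_11 N vh)^-1 cvh.
rewrite GZ // normrM (gtr0_norm np) -[leRHS]mul1r; apply: ler_pM => //; first exact: ltW.
apply: GB; split => //; rewrite /norm_11 /norm1.
rewrite (eq_mean N (v := fun k => (norm_11 N vh)^-1 * `|Dl N 1 vh k|)).
  by rewrite meanZ -/(norm1 _ _) -/(norm_11 _ _) mulVf.
move=> k; rewrite /Dl !fdiffE -mulrBr -mulrA normrM gtr0_norm ?invr_gt0 //.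
Qed.

(** As f has zero mean, the interpolation error may be normalised to vanish at the node [x0]; it is
    then the running sum of the gradient defect. *)
Lemma interpolation_force_error f h v : zero_mean N f -> zero_mean N v ->
  lat_periodic N h -> mesh_size N node h ->
  `|inner N f (coarse_proj (Dl N 1 v)) - inner N f v|
    <= normoo N (fun k => (h k - N%:R^-1) * f k) * norm_11 N v.
Proof.
move=> [pf f0] [pv v0] ph hh; set vh := coarse_proj _.
have pt : lat_periodic N (Dl N 1 v) by exact: fdiff_periodic.
have cvh : coarse_zero_mean N node vh by exact: coarse_coarse_proj.
pose w k := vh k - v k.
have pw : lat_periodic N w by move=> k; rewrite /w cvh.1.1 pv.
have wE i : w (x0 + i%:Z) - w x0 =
    e * \sum_(0 <= j < i) (Q (Dl N 1 v) (x0 + j%:Z) - Dl N 1 v (x0 + j%:Z)).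
  rewrite -telescope_int mulr_sumr; apply: eq_bigr => j _.
  have -> : Q (Dl N 1 v) (x0 + j%:Z) = Dl N 1 vh (x0 + j%:Z).
    rewrite /vh fdiff_coarse_proj // /Defs.center mean_elt_avg //.
    by rewrite (zero_mean_fdiff e pv).2 subr0.
  by rewrite /Dl !fdiffE -/e /w; field.
have -> : inner N f vh - inner N f v =
    e * \sum_(0 <= i < N) f (x0 + i%:Z) *
      (e * \sum_(0 <= j < i) (Q (Dl N 1 v) (x0 + j%:Z) - Dl N 1 v (x0 + j%:Z))).
  transitivity (mean N (fun k => f k * (w k - w x0))).
    rewrite -[LHS]subr0 -[X in _ - X](mulr0 (w x0)) -f0 -meanZ /inner -!meanB.
    by apply: eq_mean => k; rewrite /w; ring.
  rewrite (@mean_window _ N _ _ x0); last by move=> k; rewrite pf pw.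
  by congr (_ * _); apply: eq_bigr => i _; rewrite wE.
apply: interpolation_error => //;
  [exact: last_node_mono|exact: last_node_le|exact: last_node_idem|].
move=> i iN; have := mesh_sizeE hh iN => hi.
have pu : lat_periodic N (fun k => (h k - N%:R^-1) * f k) by move=> k; rewrite ph pf.
have := normoo_ge N_gt0 pu (x0 + i%:Z); rewrite hi.
by rewrite [(card i - 1) / _]mulrBl mul1r.
Qed.

End CoarseSpace.

(** * Fine and coarse equilibrium problems *)

Section FineProblems.
Variables (R : realType) (p Rmax : nat) (Phi : nat -> R -> int -> R).
Variables (chis : int -> R) (rPhi : R).
Hypotheses (p_gt0 : (0 < p)%N) (Rmax_gt0 : (0 < Rmax)%N).
Hypothesis HA : assumptions p Rmax Phi chis rPhi.
Implicit Types (t s u v g f h : int -> R) (n r : nat) (x z m : R) (k : int).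

Local Notation sstar := (Dc 1 chis).
Local Notation stress := (stress Rmax Phi).
Local Notation near_ref := (near_ref chis).
Local Notation alpha := (alpha p Phi chis).
Local Notation beta := (beta p Rmax Phi chis).
Local Notation K := (p%:R * C_Phi11 p Rmax Phi chis rPhi).
Local Notation infsup_lin := (infsup_lin Rmax Phi chis).

Variable L : R.
Hypothesis L_ge0 : 0 <= L.
Hypothesis LP : linearization_modulus Rmax Phi chis rPhi L.
Local Notation kappa d := (Rmax%:R * (L * d)).

Variables (chi : R -> int -> R) (rz rchi : R).
Hypothesis HC : corrector p Rmax Phi chis rPhi chi rz rchi.

Variables (c0 d0 rho0 z1 : R).
Hypotheses (c0_gt0 : 0 < c0) (d0_lt : d0 < rPhi) (d0c : kappa d0 <= c0).
Hypothesis (d0ab : 2 * (beta + kappa d0) < alpha).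
Hypotheses (z1_gt0 : 0 < z1) (z1_le : z1 <= rz) (zrho : z1 + rho0 <= d0).
Hypothesis chi_near : forall z, `|z| < z1 -> forall k, `|Dc 1 (chi z) k - sstar k| <= rho0.
Hypothesis cell_infsup : infsup_lin p 1 (2 * c0).
Local Notation X := (p%:R * (K / c0)).
Local Notation dPhi0 := (dPhi0 p Rmax Phi chi).

Variable ru0 : R.
Hypotheses (ru0_le : ru0 <= z1) (ru0_d0 : (1 + 2 * X) * ru0 + rho0 <= d0).

Lemma rho0_ge0 : 0 <= rho0.
Proof. by have := @chi_near 0; rewrite normr0 => /(_ z1_gt0 0); apply: le_trans. Qed.

Lemma X_ge0 : 0 <= X.
Proof. by rewrite mulr_ge0 // divr_ge0 ?K_ge0 // ltW. Qed.

Variable N : nat.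
Hypotheses (N_gt0 : (0 < N)%N) (pN : (p %| N)%N).
Let e : R := N%:R^-1.

Let e_neq0 : e != 0.
Proof. by rewrite invr_eq0 pnatr_eq0 -lt0n. Qed.

Lemma Dl_lt u ru : lat_periodic N u -> norm_1oo N u < ru -> forall k, `|Dl N 1 u k| < ru.
Proof.
by move=> pu h k; apply: le_lt_trans h; apply: normoo_ge => //; exact: fdiff_periodic.
Qed.

Lemma Dl_ref k : Dl N 1 (fun k => N%:R^-1 * chis k) k = sstar k.
Proof. by rewrite /Dl /Dc !fdiffE divr1 -mulrBr mulrAC divff ?mul1r. Qed.

Lemma chis_periodic : lat_periodic N chis.
Proof. by apply: (periodic_dvd pN); case: (chis_zero_mean HA). Qed.

Lemma atomistic_near u ru : ru <= ru0 -> zero_mean N u ->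
  norm_1oo N (fun k => u k - N%:R^-1 * chis k) < ru -> near_ref d0 (Dl N 1 u).
Proof.
move=> ruru [pu _] h k.
have pw : lat_periodic N (fun k => u k - N%:R^-1 * chis k).
  by move=> j; rewrite pu chis_periodic.
have := Dl_lt pw h k; rewrite /Dl fdiffB -![fdiff _ 1 _ k]/(Dl N 1 _ k) Dl_ref.
move=> /ltW /le_trans; apply; rewrite (le_trans ruru) // (le_trans ru0_le) //.
by rewrite (le_trans _ zrho) // lerDl rho0_ge0.
Qed.

(** [sig] is the atomistic stress or [dPhi0 (Du)]: both problems become a pointwise equation with
    one unknown constant. *)
Lemma strong_form (sig f g : int -> R) : lat_periodic N sig -> lat_periodic N g ->
  (forall k, f k = (g (k - 1) - g k) / e) ->
  (forall v, zero_mean N v -> inner N sig (Dl N 1 v) = inner N f v) <->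
  exists m, forall k, sig k = g k + m.
Proof.
move=> ps pg fg.
have fgE v : lat_periodic N v -> inner N f v = inner N g (Dl N 1 v).
  by move=> pv; rewrite inner_fdiff //; apply: eq_mean => k; rewrite fg.
split=> [h|[m h] v [pv _]].
  exists (mean N (fun k => sig k - g k)) => k.
  rewrite -(@ortho_zero_mean _ N (fun k => sig k - g k) N_gt0 _ _ k); first by ring.
    by move=> j; rewrite ps pg.
  move=> t zt; have zv := zero_mean_prim e t N_gt0.
  have := h _ zv; rewrite fgE; last exact: zv.1.
  rewrite /Dl fdiff_prim // => E.
  transitivity (inner N sig t - inner N g t); last by rewrite E subrr.
  by rewrite /inner -meanB; apply: eq_mean => j; ring.
rewrite fgE // /inner.
transitivity (mean N (fun k => g k * Dl N 1 v k) + m * mean N (Dl N 1 v)).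
  by rewrite -meanZ -meanD; apply: eq_mean => k; rewrite h; ring.
by rewrite (zero_mean_fdiff e pv).2 mulr0 addr0.
Qed.

(** Normalising the potential at 0 turns the oscillation bound into a sup bound. *)
Lemma small_potential f rf : zero_mean N f -> norm_neg1oo N f < rf ->
  exists g, [/\ lat_periodic N g, forall k, f k = (g (k - 1) - g k) / e &
    forall k, `|g k| <= 2 * rf].
Proof.
move=> zf frf; have [g pg fg] := force_potential N_gt0 e_neq0 zf.
exists (fun k => g k - g 0); split=> [k|k|k]; first by rewrite pg.
  by rewrite fg; congr (_ / _); ring.
rewrite (le_trans (potential_osc N_gt0 zf pg fg k 0)) // ler_wpM2l //; exact: ltW.
Qed.

Lemma atomistic_variation u ru v : ru <= ru0 -> zero_mean N u ->
  norm_1oo N (fun k => u k - N%:R^-1 * chis k) < ru -> zero_mean N v ->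
  Defs.variation (energy N Rmax Phi) u v = inner N (stress (Dl N 1 u)) (Dl N 1 v).
Proof.
move=> ruru zu h [pv _].
exact: (variation_energy p_gt0 HA N_gt0 pN zu.1 pv (atomistic_near ruru zu h) d0_lt).
Qed.

Lemma zero_mean_sub u v : zero_mean N u -> zero_mean N v ->
  zero_mean N (fun k => u k - v k).
Proof.
by move=> [pu u0] [pv v0]; split; [move=> k; rewrite pu pv | rewrite meanB u0 v0 subrr].
Qed.

Lemma zero_mean_Dl_sub u v : lat_periodic N u -> lat_periodic N v ->
  zero_mean N (fun k => Dl N 1 u k - Dl N 1 v k).
Proof. by move=> pu pv; apply: zero_mean_sub; exact: zero_mean_fdiff. Qed.

(** In the uniqueness proofs this excludes two different constants in the strong form, since those
    would order the two strains strictly at every site. *)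
Lemma Dl_not_lt u v : zero_mean N u -> zero_mean N v ->
  ~ (forall k, Dl N 1 v k < Dl N 1 u k).
Proof.
move=> [pu _] [pv _] lt; have := (zero_mean_Dl_sub pu pv).2 => /eqP.
by rewrite gt_eqF // mean_gt0 // => k; rewrite subr_gt0.
Qed.

Lemma atomistic_unique f ru u u' : ru <= ru0 -> zero_mean N f ->
  atomistic_solution N Rmax Phi chis ru f u ->
  atomistic_solution N Rmax Phi chis ru f u' -> u = u'.
Proof.
move=> ruru zf [zu nu su] [zu' nu' su'].
have [g pg fg] := force_potential N_gt0 e_neq0 zf.
have pt (w : int -> R) : zero_mean N w -> lat_periodic N (Dl N 1 w).
  by move=> [pw _]; exact: fdiff_periodic.
have ps w : zero_mean N w -> lat_periodic N (stress (Dl N 1 w)).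
  by move=> /pt; exact: (stress_periodic HA pN).
have [m sm] : exists m, forall k, stress (Dl N 1 u) k = g k + m.
  apply/(strong_form (ps _ zu) pg fg) => v zv.
  by rewrite -(atomistic_variation ruru) // su.
have [m' sm'] : exists m, forall k, stress (Dl N 1 u') k = g k + m.
  apply/(strong_form (ps _ zu') pg fg) => v zv.
  by rewrite -(atomistic_variation ruru) // su'.
have [n n'] := (atomistic_near ruru zu nu, atomistic_near ruru zu' nu').
have pd (w w' : int -> R) : zero_mean N w -> zero_mean N w' ->
    lat_periodic N (fun k => Dl N 1 w k - Dl N 1 w' k).
  by move=> zw zw' k; rewrite !pt.
have inj := stress_injective p_gt0 Rmax_gt0 HA L_ge0 LP N_gt0.
have [|h1 h2] := inj _ _ _ (m - m') n n' d0_lt d0ab (pd _ _ zu zu').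
  by move=> k; rewrite sm sm'; ring.
have [|_ h3] := inj _ _ _ (m' - m) n' n d0_lt d0ab (pd _ _ zu' zu).
  by move=> k; rewrite sm sm'; ring.
have mm : m = m'.
  have [mm|mm|//] := ltgtP m m'.
    by exfalso; apply: (@Dl_not_lt u' u) => //; apply: h3; rewrite subr_gt0.
  by exfalso; apply: (@Dl_not_lt u u') => //; apply: h2; rewrite subr_gt0.
apply: (fdiff_inj N_gt0 e_neq0 zu zu'); apply/funext => k; apply/eqP.
by rewrite -subr_eq0 -normr_le0 (le_trans (h1 k)) // mm subrr normr0 mulr0.
Qed.

Lemma atomistic_exists f rf rho : 0 <= rho -> rho < ru0 ->
  2 * (2 * rf) <= (alpha - 2 * (beta + kappa d0)) * rho ->
  zero_mean N f -> norm_neg1oo N f < rf ->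
  exists u, atomistic_solution N Rmax Phi chis ru0 f u.
Proof.
move=> rho_ge0 rho_lt small zf frf.
have [g [pg fg gB]] := small_potential zf frf.
have rd0 : `|0 : R| + rho <= d0.
  rewrite normr0 add0r (le_trans (ltW rho_lt)) // (le_trans ru0_le) //.
  by rewrite (le_trans _ zrho) // lerDl rho0_ge0.
have [|s [m [zs srho sm]]] := stress_solve (z := 0) (g := g) (gam := 2 * rf)
  p_gt0 Rmax_gt0 HA L_ge0 LP N_gt0 pN d0_lt rho_ge0 rd0 d0ab pg gB.
  by rewrite normr0 mulr0 addr0.
have zt : zero_mean N (fun k => sstar k + s k).
  split; first by move=> k; rewrite zs.1 (sstar_periodic HA pN).
  by rewrite meanD zs.2 addr0 (zero_mean_fdiff 1 chis_periodic).2.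
pose u := prim N e (fun k => sstar k + s k).
have zu : zero_mean N u by exact: zero_mean_prim.
have Du : Dl N 1 u = fun k => sstar k + s k by exact: fdiff_prim.
have nu : norm_1oo N (fun k => u k - N%:R^-1 * chis k) < ru0.
  apply: le_lt_trans rho_lt; apply: normoo_le => // k.
  rewrite /Dl fdiffB -![fdiff _ 1 _ k]/(Dl N 1 _ k) Dl_ref Du.
  by rewrite addrC addKr.
exists u; split=> // v zv; rewrite (atomistic_variation (lexx _) zu nu zv).
have pst : lat_periodic N (stress (Dl N 1 u)).
  by apply: (stress_periodic HA pN); exact: fdiff_periodic zu.1.
apply: (strong_form pst pg fg).2 v zv; exists m => k.
rewrite -sm Du; congr (stress _ k); apply/funext => j; by rewrite add0r.
Qed.

Lemma dPhi0_comp_periodic u : lat_periodic N u -> lat_periodic N (fun k => dPhi0 (Dl N 1 u k)).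
Proof. by move=> pu k; rewrite /Dl (fdiff_periodic _ _ pu). Qed.

Lemma homogenized_variation u ru v : ru <= ru0 -> zero_mean N u -> norm_1oo N u < ru ->
  Defs.variation (energy0 N p Rmax Phi chi) u v
    = inner N (fun k => dPhi0 (Dl N 1 u k)) (Dl N 1 v).
Proof.
move=> ruru [pu _] nu.
apply: (variation_energy0 p_gt0 HA L_ge0 LP HC c0_gt0 d0_lt d0c z1_le zrho
  chi_near cell_infsup _ N_gt0) => k.
exact: lt_le_trans (Dl_lt pu nu k) (le_trans ruru ru0_le).
Qed.

Lemma dPhi0_injective x x' : `|x| < z1 -> `|x'| < z1 -> dPhi0 x = dPhi0 x' -> x = x'.
Proof.
move=> xz x'z E; apply/eqP; rewrite -subr_eq0 -normr_le0.
have [h _] := dPhi0_expand p_gt0 Rmax_gt0 HA L_ge0 LP HC d0_lt d0ab z1_le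
  zrho chi_near xz x'z.
by rewrite (le_trans h) // E subrr normr0 mulr0.
Qed.

Lemma dPhi0_increasing x x' : `|x| < z1 -> `|x'| < z1 -> dPhi0 x < dPhi0 x' -> x < x'.
Proof.
move=> xz x'z.
by have [_ h] := dPhi0_expand p_gt0 Rmax_gt0 HA L_ge0 LP HC d0_lt d0ab z1_le
  zrho chi_near x'z xz.
Qed.

Lemma homogenized_unique f ru u u' : ru <= ru0 -> zero_mean N f ->
  homogenized_solution N p Rmax Phi chi ru f u ->
  homogenized_solution N p Rmax Phi chi ru f u' -> u = u'.
Proof.
move=> ruru zf [zu nu su] [zu' nu' su'].
have [g pg fg] := force_potential N_gt0 e_neq0 zf.
have [m sm] : exists m, forall k, dPhi0 (Dl N 1 u k) = g k + m.
  apply/(strong_form (dPhi0_comp_periodic zu.1) pg fg) => v zv.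
  by rewrite -(homogenized_variation _ ruru) // su.
have [m' sm'] : exists m, forall k, dPhi0 (Dl N 1 u' k) = g k + m.
  apply/(strong_form (dPhi0_comp_periodic zu'.1) pg fg) => v zv.
  by rewrite -(homogenized_variation _ ruru) // su'.
have uz k : `|Dl N 1 u k| < z1.
  exact: lt_le_trans (Dl_lt zu.1 nu k) (le_trans ruru ru0_le).
have u'z k : `|Dl N 1 u' k| < z1.
  exact: lt_le_trans (Dl_lt zu'.1 nu' k) (le_trans ruru ru0_le).
have mm : m = m'.
  have [mm|mm|//] := ltgtP m m'; exfalso.
    by apply: (@Dl_not_lt u' u) => // k; apply: dPhi0_increasing => //; rewrite sm sm' ltrD2l.
  by apply: (@Dl_not_lt u u') => // k; apply: dPhi0_increasing => //; rewrite sm sm' ltrD2l.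
apply: (fdiff_inj N_gt0 e_neq0 zu zu'); apply/funext => k.
by apply: dPhi0_injective; rewrite ?uz ?u'z // sm sm' mm.
Qed.

Lemma homogenized_exists f rf rho : 0 < rho -> rho < ru0 ->
  2 * (2 * rf) <= alpha / 2 * rho -> zero_mean N f -> norm_neg1oo N f < rf ->
  exists u, homogenized_solution N p Rmax Phi chi ru0 f u.
Proof.
move=> rho_gt0 rho_lt small zf frf.
have [g [pg fg gB]] := small_potential zf frf.
have rho1 : 0 < rho < z1 by rewrite rho_gt0 (lt_le_trans rho_lt).
have [s [m [zs srho sm]]] := hom_solve p_gt0 Rmax_gt0 HA L_ge0 LP HC c0_gt0 d0_lt d0c
  d0ab z1_gt0 z1_le zrho chi_near cell_infsup N_gt0 rho1 pg gB small.
pose u := prim N e s.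
have zu : zero_mean N u by exact: zero_mean_prim.
have Du : Dl N 1 u = s by exact: fdiff_prim.
have nu : norm_1oo N u < ru0.
  by apply: le_lt_trans rho_lt; apply: normoo_le; [exact: ltW | move=> k; rewrite Du].
exists u; split=> // v zv; rewrite (homogenized_variation _ (lexx _) zu nu).
apply: (strong_form (dPhi0_comp_periodic zu.1) pg fg).2 v zv.
by exists m => k; rewrite Du.
Qed.

Variables (node : pred int) (F : (int -> R) -> R) (x0 : int).
Hypotheses (node_per : forall k : int, node (k + N%:Z) = node k) (node_x0 : node x0).
Hypothesis HF : coarse_functional N node F.

Local Notation Q := (@elt_avg R N x0 (last_node node x0)).
Local Notation proj := (coarse_proj N node x0).

(** [dPhi0 (Du)] is constant on elements, so it does not see the difference between a gradient and
    its element average. Hence a coarse solution may be tested with any fine function. *)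
Lemma coarse_stress u v : coarse N node u -> lat_periodic N v ->
  inner N (fun k => dPhi0 (Dl N 1 u k)) (Dl N 1 v)
  = inner N (fun k => dPhi0 (Dl N 1 u k)) (Dl N 1 (proj (Dl N 1 v))).
Proof.
move=> cu pv; have pt : lat_periodic N (Dl N 1 v) by exact: fdiff_periodic.
have Qu := coarse_elt_avg N_gt0 node_x0 cu.
have -> : Dl N 1 (proj (Dl N 1 v)) = Q (Dl N 1 v).
  rewrite fdiff_coarse_proj //; apply/funext => k.
  by rewrite /Defs.center mean_elt_avg // (zero_mean_fdiff e pv).2 subr0.
rewrite -elt_avg_self_adjoint //; last exact: dPhi0_comp_periodic cu.1.
have := @elt_avg_comp R N x0 (last_node node x0) N_gt0 dPhi0 (Dl N 1 u).
by rewrite Qu => ->.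
Qed.

Lemma coarse_solution_variation ru u v : ru <= ru0 ->
  coarse_solution N p Rmax Phi chi ru node F u -> lat_periodic N v ->
  inner N (fun k => dPhi0 (Dl N 1 u k)) (Dl N 1 v) = F (proj (Dl N 1 v)).
Proof.
move=> ruru [[cu u0] nu su] pv; have zu : zero_mean N u by split; [exact: cu.1 | ].
rewrite coarse_stress //.
rewrite -(homogenized_variation _ ruru zu nu) su //.
by apply: coarse_coarse_proj => //; exact: fdiff_periodic.
Qed.

Lemma coarse_sphere_bounded G f : zero_mean N f ->
  (forall v, coarse_zero_mean N node v -> G v = inner N f v) ->
  has_ubound [set `|G v| | v in coarse_unit_sphere N node].
Proof.
move=> zf Gf; have [B B0 fB] := force_bounded N_gt0 zf.
exists B => _ [v [cv v1] <-]; rewrite Gf //.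
by have := fB v cv.1.1; rewrite v1 mulr1.
Qed.

Lemma sup_sphere_ge0 (G : (int -> R) -> R) :
  has_ubound [set `|G v| | v in coarse_unit_sphere N node] ->
  0 <= sup [set `|G v| | v in coarse_unit_sphere N node].
Proof.
move=> ub; have [[x [v cv _]]|] :=
    pselect ([set `|G v| | v in coarse_unit_sphere N node] !=set0); last first.
  by move=> /set0P/negP/negPn/eqP ->; rewrite sup0.
apply: (@le_trans _ _ `|G v|) => //; apply: sup_upper_bound; last by exists v.
by split=> //; exists `|G v|, v.
Qed.

Lemma sup_sphere_ge (G : (int -> R) -> R) v :
  has_ubound [set `|G v| | v in coarse_unit_sphere N node] ->
  coarse_unit_sphere N node v ->
  `|G v| <= sup [set `|G v| | v in coarse_unit_sphere N node].
Proof.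
move=> ub cv; apply: sup_upper_bound; last by exists v.
by split=> //; exists `|G v|, v.
Qed.

(** Coarse interpolation does not increase the norm of a test function, so extending F to the fine
    lattice keeps it below [rf]. *)
Lemma norm_neg1oo_dual f : zero_mean N f ->
  (forall v, zero_mean N v -> inner N f v = F (proj (Dl N 1 v))) ->
  norm_neg1oo N f <= dual_norm N node F.
Proof.
move=> zf fF.
have ub : has_ubound [set `|F v| | v in coarse_unit_sphere N node].
  apply: (coarse_sphere_bounded zf) => v cv.
  by rewrite fF ?coarse_proj_id //; split; [exact: cv.1.1 | exact: cv.2].
have d_ge0 : 0 <= dual_norm N node F by exact: sup_sphere_ge0.
have [ne|] := pselect ([set inner N f v | v in
    [set v | zero_mean N v /\ norm_11 N v = 1]] !=set0); last first.
  by move=> /set0P/negP/negPn/eqP h; rewrite /norm_neg1oo h sup0.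
apply: sup_le_ub => // _ [v [zv v1] <-]; rewrite fF // (le_trans (ler_norm _)) //.
apply: (coarse_sphere_le N_gt0 node_per node_x0) => //.
  by move=> a w cw; exact: (coarse_functionalZ HF).
by move=> w cw; exact: (sup_sphere_ge ub).
Qed.

Lemma coarse_exists_unique rf ru : ru <= ru0 ->
  (forall f, zero_mean N f -> norm_neg1oo N f < rf ->
    exists u, homogenized_solution N p Rmax Phi chi ru f u) ->
  dual_norm N node F < rf ->
  exists! uh, coarse_solution N p Rmax Phi chi ru node F uh.
Proof.
move=> ruru hom dF.
have [f zf fF] := coarse_force N_gt0 node_per node_x0 HF.
have [u [zu nu su]] := hom f zf (le_lt_trans (norm_neg1oo_dual zf fF) dF).
set s := Dl N 1 u; have ps : lat_periodic N s by exact: fdiff_periodic zu.1.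
have pQ : lat_periodic N (Q s) by exact: elt_avg_periodic.
have sz k : `|s k| < z1.
  exact: lt_le_trans (Dl_lt zu.1 nu k) (le_trans ruru ru0_le).
have Qz k : `|Q s k| < z1.
  apply: le_lt_trans (_ : norm_1oo N u < z1).
    by apply: elt_avg_le => //; exact: normoo_ge.
  exact: lt_le_trans nu (le_trans ruru ru0_le).
have QE : elt_avg N x0 (last_node node x0) s = s.
  (* The test strain has zero element averages, so its coarse interpolant and the load vanish, and
     [dPhi0 (Q s)] is orthogonal to it as well. Subtracting leaves a zero mean of the nonnegative
     products (dPhi0 s - dPhi0 (Q s)) (s - Q s), all of which must vanish. *)
  pose w k := s k - Q s k.
  have zw : zero_mean N w.
    split; first by move=> k; rewrite /w ps pQ.
    by rewrite meanB mean_elt_avg // subrr.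
  pose v := prim N e w; have zv : zero_mean N v by exact: zero_mean_prim.
  have Dv : Dl N 1 v = w by exact: fdiff_prim.
  have Qw : Q w = fun=> 0.
    have -> : w = fun k => (-1) * Q s k + s k.
      by apply/funext => k; rewrite /w; ring.
    rewrite elt_avg_lin elt_avg_idem //; apply/funext => k; ring.
  have projw : proj w = fun k => 0 * proj w k.
    have cpw := coarse_coarse_proj N_gt0 node_per node_x0 zw.1.
    apply: (fdiff_inj N_gt0 e_neq0).
    - by split; [exact: cpw.1.1 | exact: cpw.2].
    - by have [[? _] ?] := coarseZ 0 cpw.
    rewrite -[LHS]/(Dl N 1 _) fdiff_coarse_proj //; last exact: zw.1.
    apply/funext => k; rewrite fdiffE !mul0r subrr mul0r Qw.
    by rewrite /Defs.center mean_cst // subrr.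
  have h1 : inner N (fun k => dPhi0 (s k)) w = 0.
    rewrite -{1}Dv -(homogenized_variation _ ruru zu nu) su // fF // Dv projw.
    rewrite (coarse_functionalZ HF) ?mul0r //.
    exact: (coarse_coarse_proj N_gt0 node_per node_x0 zw.1).
  have h2 : inner N (fun k => dPhi0 (Q s k)) w = 0.
    have pS : lat_periodic N (fun k => dPhi0 (Q s k)) by move=> k; rewrite pQ.
    have := @elt_avg_self_adjoint R N x0 (last_node node x0) _ _ pS zw.1.
    rewrite elt_avg_comp // Qw => ->; rewrite /inner.
    by under eq_mean do rewrite mulr0; rewrite mean_cst.
  have h3 : mean N (fun k => (dPhi0 (s k) - dPhi0 (Q s k)) * (s k - Q s k)) = 0.
    rewrite -[RHS](subrr 0) -{1}h1 -h2 /inner -meanB.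
    by apply: eq_mean => k; rewrite /w; ring.
  apply/funext => k; apply/eqP; rewrite eq_sym.
  have := mean_eq0 N_gt0 _ _ h3 k.
  have pm : lat_periodic N (fun k => (dPhi0 (s k) - dPhi0 (Q s k)) * (s k - Q s k)).
    by move=> j; rewrite ps pQ.
  have mono j : 0 <= (dPhi0 (s j) - dPhi0 (Q s j)) * (s j - Q s j).
    have [lt|gt|->] := ltgtP (dPhi0 (s j)) (dPhi0 (Q s j)).
    - by rewrite nmulr_rge0 ?subr_lt0 // subr_le0 ltW // dPhi0_increasing.
    - by rewrite mulr_ge0 // subr_ge0 ltW // dPhi0_increasing.
    - by rewrite subrr mul0r.
  move=> /(_ pm mono) /eqP; rewrite mulf_eq0 !subr_eq0 => /orP[/eqP E|//].
  by apply/eqP/dPhi0_injective.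
have cu : coarse_zero_mean N node u.
  by split; [exact: (elt_avg_coarse N_gt0 node_per node_x0 zu.1 QE) | exact: zu.2].
exists u; split.
  split=> // v cv; have zv : zero_mean N v by split; [exact: cv.1.1 | exact: cv.2].
  by rewrite su // fF // coarse_proj_id.
(* A competing coarse solution can be tested with fine functions, so it solves the same homogenized
   problem. *)
move=> u' cu'; apply: (homogenized_unique ruru zf) => //.
case: (cu') => [[cc m0] nu' _]; have zu' : zero_mean N u' by split; [exact: cc.1 | ].
split=> // v zv; rewrite (homogenized_variation _ ruru zu' nu') fF //.
exact: (coarse_solution_variation ruru cu' zv.1).
Qed.

Lemma max_jump_ge u : coarse N node u ->
  forall k, `|Dl N 1 u k - Dl N 1 u (k - 1)| <= max_jump N node u.
Proof.
move=> [pu cu]; have pt : lat_periodic N (Dl N 1 u) by exact: fdiff_periodic.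
apply: (@periodic_cell N (fun k => `|Dl N 1 u k - Dl N 1 u (k - 1)| <= _) N_gt0) => [k|k kN].
  by rewrite addrAC !pt.
have [nk|nk] := boolP (node k%:Z).
  rewrite /max_jump; apply: (Order.TotalTheory.le_bigmax_seq 0 k (fun k : nat => node k%:Z)
    (fun k : nat => `|Dl N 1 u k%:Z - Dl N 1 u (k%:Z - 1)|)) => //.
  by rewrite mem_index_iota.
by rewrite cu // subrr normr0; apply: bigmax_ge_id.
Qed.

Lemma increment_window s J r : 0 <= J -> (forall k, `|s (k + 1) - s k| <= J) ->
  forall (k : int) (i j : nat), (i <= r)%N -> (j <= r)%N ->
  `|s (k + i%:Z) - s (k + j%:Z)| <= r%:R * J.
Proof.
move=> J0 sJ k i j ir jr.
wlog ji : i j ir jr / (j <= i)%N => [hw|].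
  by case: (leqP j i) => [/hw //|/ltnW/hw]; rewrite distrC; apply.
rewrite -(subnKC ji) PoszD addrA (le_trans (increment_le sJ _ _)) //.
by rewrite ler_wpM2r // ler_nat (leq_trans (leq_subr _ _)).
Qed.

Lemma fdiff_shifted u (psi : int -> R) (c : R) k :
  fdiff e 1 (fun k => u k + e * psi k - c) k = fdiff e 1 u k + (psi (k + 1) - psi k).
Proof. by rewrite !fdiffE; field. Qed.

Lemma Dl_recovered u k : Dl N 1 (recovered N chi u) k =
  Dl N 1 u k + (chi (Dl N 1 u (k + 1)) (k + 1) - chi (Dl N 1 u k) k).
Proof. exact: (fdiff_shifted u (fun k => chi (Dl N 1 u k) k)). Qed.

Lemma chi_lipschitz x x' : `|x| < z1 -> `|x'| < z1 ->
  forall k, `|chi x k - chi x' k| <= X * `|x - x'|.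
Proof.
exact: (chi_lip p_gt0 HA L_ge0 LP HC c0_gt0 d0_lt d0c z1_le zrho chi_near cell_infsup).
Qed.

Lemma recovered_near u ru : ru <= ru0 -> lat_periodic N u -> norm_1oo N u < ru ->
  near_ref d0 (Dl N 1 (recovered N chi u)).
Proof.
move=> ruru pu nu k.
have uz j : `|Dl N 1 u j| < ru0 by exact: lt_le_trans (Dl_lt pu nu j) ruru.
have uz1 j : `|Dl N 1 u j| < z1 by exact: lt_le_trans (uz j) ru0_le.
rewrite Dl_recovered (_ : _ - _ = Dl N 1 u k
  + (chi (Dl N 1 u (k + 1)) (k + 1) - chi (Dl N 1 u k) (k + 1))
  + (Dc 1 (chi (Dl N 1 u k)) k - sstar k)); last first.
  by rewrite /Dc !fdiffE !divr1; ring.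
apply: le_trans ru0_d0; rewrite (le_trans (ler_normD _ _)) // lerD ?chi_near //.
rewrite (le_trans (ler_normD _ _)) // mulrDl mul1r; apply: lerD; first exact: ltW.
rewrite (le_trans (chi_lipschitz (uz1 _) (uz1 _) _)) // [2 * X]mulrC -[X * 2 * ru0]mulrA.
rewrite ler_wpM2l ?X_ge0 // (le_trans (ler_normB _ _)) //.
by rewrite mulrDl mul1r lerD // ltW.
Qed.

(** Freezing the strain at z = Du(k) gives a configuration whose stress is exactly [dPhi0 z]. Bonds
    of range r meeting k see Du vary by at most [r * J], the growth that [stress_diff_le]
    tolerates. *)
Lemma recovered_stress u ru J : ru <= ru0 -> lat_periodic N u -> norm_1oo N u < ru ->
  0 <= J -> (forall k, `|Dl N 1 u (k + 1) - Dl N 1 u k| <= J) ->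
  forall k, `|stress (Dl N 1 (recovered N chi u)) k - dPhi0 (Dl N 1 u k)|
    <= K * ((1 + 2 * X) * J).
Proof.
move=> ruru pu nu J0 uJ k; set s := Dl N 1 u in uJ *.
have sz j : `|s j| < z1.
  exact: lt_le_trans (Dl_lt pu nu j) (le_trans ruru ru0_le).
rewrite -(stress_strain p_gt0 HA HC z1_le (sz k) k).
have X0 := X_ge0.
apply: (stress_diff_le p_gt0 HA (recovered_near ruru pu nu)
  (near_mixed zrho chi_near (sz k) (sz k)) d0_lt d0_lt).
  by rewrite mulr_ge0 // addr_ge0 // mulr_ge0.
move=> r j /andP[r0 _] jr; set m := k - j%:Z.
have rn0 : 0 < r%:R :> R by rewrite ltr0n.
have km : k = m + j%:Z by rewrite subrK.
have sk i : (i <= r)%N -> `|s (m + i%:Z) - s k| <= r%:R * J.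
  by move=> ir; rewrite km; apply: (increment_window J0 uJ) => //; exact: ltnW.
pose psi i := chi (s i) i.
(* Corrector increments telescope, so only the two ends of the window contribute. *)
have -> : avg r (Dl N 1 (recovered N chi u)) m - avg r (strain chi (s k)) m =
    avg r (fun i => s i - s k) m + r%:R^-1 * ((psi (m + r%:Z) - chi (s k) (m + r%:Z))
      - (psi m - chi (s k) m)).
  have -> : Dl N 1 (recovered N chi u) = fun i => s i + (psi (i + 1) - psi i).
    by apply/funext => i; exact: Dl_recovered.
  have -> : avg r (fun i => s i + (psi (i + 1) - psi i)) m =
      avg r s m + r%:R^-1 * (psi (m + r%:Z) - psi m).
    by rewrite avgD; congr (_ + _); rewrite /avg telescope_int.
  rewrite /strain avgB avgD !avg_cst // -(fdiff_avg 1 r (chi (s k))) /fdiff mulr1.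
  ring.
have -> : r%:R * ((1 + 2 * X) * J) = r%:R * J + r%:R * (2 * X * J) by ring.
rewrite (le_trans (ler_normD _ _)) // lerD //.
  by apply: ler_average => [|i ir]; [rewrite mulr_ge0 | apply: sk; exact: ltnW].
have c1 i : (i <= r)%N -> `|psi (m + i%:Z) - chi (s k) (m + i%:Z)| <= X * (r%:R * J).
  move=> ir; rewrite (le_trans (chi_lipschitz (sz _) (sz _) _)) //.
  by rewrite ler_wpM2l // sk.
rewrite normrM gtr0_norm ?invr_gt0 // ler_pdivrMl //.
have := c1 r (leqnn r); have := c1 0%N (leq0n r); rewrite addr0 => h1 h2.
rewrite (le_trans (ler_normB _ _)) // (le_trans (lerD h2 h1)) //.
have -> : X * (r%:R * J) + X * (r%:R * J) = 1 * (r%:R * (2 * X * J)) by ring.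
apply: ler_wpM2r; last by rewrite ler1n.
by apply: mulr_ge0 => //; apply: mulr_ge0 => //; apply: mulr_ge0.
Qed.

Lemma error_estimate ru uh f u h : ru <= ru0 -> infsup_lin N e (2 * c0) ->
  coarse_solution N p Rmax Phi chi ru node F uh -> zero_mean N f ->
  atomistic_solution N Rmax Phi chis ru f u ->
  lat_periodic N h -> mesh_size N node h ->
  norm_1oo N (fun k => recovered N chi uh k - u k) <=
    c0^-1 * (K * ((1 + 2 * X) * max_jump N node uh)
      + normoo N (fun k => (h k - N%:R^-1) * f k) + coarse_force_error N node F f).
Proof.
move=> ruru is_N cs zf [zu nu su] ph hh.
have [[cuh uh0] nuh _] := cs; have puh := cuh.1.
set J := max_jump N node uh; have J0 : 0 <= J by exact: bigmax_ge_id.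
have uJ k : `|Dl N 1 uh (k + 1) - Dl N 1 uh k| <= J.
  by have := max_jump_ge cuh (k + 1); rewrite addrK.
have [fF zfF fFE] := coarse_force N_gt0 node_per node_x0 HF.
have GE v : coarse_zero_mean N node v ->
    F v - inner N f v = inner N (fun k => fF k - f k) v.
  move=> cv; have zv : zero_mean N v by split; [exact: cv.1.1 | exact: cv.2].
  rewrite -{1}(coarse_proj_id N_gt0 node_x0 cv) -fFE // /inner -meanB.
  by apply: eq_mean => k; ring.
(* On coarse functions F - f is a fine force, which bounds the set under the supremum in
   [coarse_force_error]. *)
have ub := coarse_sphere_bounded (zero_mean_sub zfF zf) GE.
have E0 : 0 <= coarse_force_error N node F f by exact: sup_sphere_ge0 ub.
have pr : lat_periodic N (recovered N chi uh).
  move=> k; rewrite /recovered /Defs.center puh.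
  have -> : Dl N 1 uh (k + N%:Z) = Dl N 1 uh k by exact: (fdiff_periodic e 1 puh).
  rewrite (periodic_dvd pN (chi_zero_mean HC z1_le _).1) //.
  exact: lt_le_trans (Dl_lt puh nuh k) (le_trans ruru ru0_le).
have X0 := X_ge0.
set B := _ + _ + _.
have B0 : 0 <= B.
  rewrite /B !addr_ge0 ?normoo_ge0 //; apply: mulr_ge0; first exact: K_ge0.
  by rewrite mulr_ge0 // addr_ge0 // mulr_ge0.
have stab := stress_stability HA L_ge0 LP N_gt0 pN e_neq0 c0_gt0 B0
  (recovered_near ruru puh nuh) (atomistic_near ruru zu nu) d0_lt d0c is_N
  (zero_mean_Dl_sub pr zu.1).
rewrite /norm_1oo; apply: normoo_le => [|k].
  by rewrite mulr_ge0 // invr_ge0 ltW.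
rewrite ler_pdivlMl // /Dl fdiffB; apply: stab => tau ztau tau1.
pose v := prim N e tau; have zv : zero_mean N v by exact: zero_mean_prim.
have Dv : Dl N 1 v = tau by exact: fdiff_prim.
have v1 : norm_11 N v = 1 by rewrite /norm_11 Dv.
(* Three errors: the stress of the recovered strain against [dPhi0 (Du_h)], the interpolation of v
   in the pairing with f, and F against f on the interpolant. *)
have -> : inner N (fun k => stress (Dl N 1 (recovered N chi uh)) k - stress (Dl N 1 u) k) tau
  = inner N (fun k => stress (Dl N 1 (recovered N chi uh)) k - dPhi0 (Dl N 1 uh k)) tau
    + (inner N f (proj (Dl N 1 v)) - inner N f v)
    + (F (proj (Dl N 1 v)) - inner N f (proj (Dl N 1 v))).
  have -> : inner N f v = inner N (stress (Dl N 1 u)) tau.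
    by rewrite -Dv -su // (atomistic_variation ruru zu nu zv).
  rewrite -(coarse_solution_variation ruru cs zv.1) Dv.
  transitivity (inner N (stress (Dl N 1 (recovered N chi uh))) tau
    - inner N (stress (Dl N 1 u)) tau).
    by rewrite /inner -meanB; apply: eq_mean => j; ring.
  have -> : inner N (fun k => stress (Dl N 1 (recovered N chi uh)) k - dPhi0 (Dl N 1 uh k)) tau
     = inner N (stress (Dl N 1 (recovered N chi uh))) tau
       - inner N (fun k => dPhi0 (Dl N 1 uh k)) tau.
    by rewrite /inner -meanB; apply: eq_mean => j; ring.
  ring.
rewrite /B; apply: lerD; first apply: lerD.
- have := inner_le N tau (recovered_stress ruru puh nuh J0 uJ); rewrite tau1 mulr1.
  by apply: le_trans; exact: ler_norm.
- rewrite (le_trans (ler_norm _)) //.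
  have := interpolation_force_error N_gt0 node_per node_x0 zf zv ph hh.
  by rewrite v1 mulr1.
- rewrite (le_trans (ler_norm _)) //.
  apply: (@coarse_sphere_le R N node x0 N_gt0 node_per node_x0
    (fun v => F v - inner N f v)) => //.
    move=> a w cw; rewrite (coarse_functionalZ HF) // mulrBr; congr (_ - _).
    by rewrite /inner -meanZ; apply: eq_mean => j; ring.
  by move=> w cw; exact: (sup_sphere_ge ub).
Qed.

End FineProblems.

(** * Choice of the radii and conclusion *)

Lemma exists_pos_le3 (R : realType) (a b c : R) : 0 < a -> 0 < b -> 0 < c ->
  exists x, [/\ 0 < x, x <= a, x <= b & x <= c].
Proof.
move=> a0 b0 c0; exists (Num.min a (Num.min b c)).
by rewrite !lt_min a0 b0 c0 !ge_min !lexx !orbT.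
Qed.

Theorem theorem2p2 (R : realType) (p : nat) (p_gt0 : (0 < p)%N) :
  exists Const : R -> R,
  forall (Rmax : nat) (Phi : nat -> R -> int -> R) (chis : int -> R) (rPhi : R),
    (0 < Rmax)%N -> assumptions p Rmax Phi chis rPhi ->
  forall (chi : R -> int -> R) (rz rchi : R),
    corrector p Rmax Phi chis rPhi chi rz rchi ->
  forall c0 : R, 0 < c0 -> cell_coercive p Rmax Phi chis chi c0 ->
  exists rf0 ru0 : R,
    [/\ 0 < rf0, 0 < ru0, ru0 <= rPhi & ru0 <= rz] /\
    forall N : nat, (0 < N)%N -> (p %| N)%N ->
      lattice_coercive N p Rmax Phi chis chi c0 ->
      radii N p Rmax Phi chis chi rf0 ru0 /\
      forall rf ru : R, 0 < rf -> 0 < ru -> ru <= ru0 ->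
        radii N p Rmax Phi chis chi rf ru ->
      forall node : pred int, mesh N node ->
      forall F : (int -> R) -> R, coarse_functional N node F ->
        dual_norm N node F < rf ->
        (exists! uh : int -> R, coarse_solution N p Rmax Phi chi ru node F uh)
        /\
        forall uh f u h : int -> R,
          coarse_solution N p Rmax Phi chi ru node F uh ->
          zero_mean N f ->
          atomistic_solution N Rmax Phi chis ru f u ->
          lat_periodic N h -> mesh_size N node h ->
          norm_1oo N (fun k => recovered N chi uh k - u k) <=
            Const (c0^-1 * C_Phi11 p Rmax Phi chis rPhi) * max_jump N node uh
            + c0^-1 * normoo N (fun k => (h k - N%:R^-1) * f k)
            + c0^-1 * coarse_force_error N node F f.
Proof.
(* At [t = c0^-1 * C_Phi11], [p * t] is [K / c0] and [p * (p * t)] is [X]. *)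
exists (fun t => p%:R * t * (1 + 2 * (p%:R * (p%:R * t)))).
move=> Rmax Phi chis rPhi Rmax_gt0 HA chi rz rchi HC c0 c0_gt0 [cell_infsup _].
have [L L_ge0 LP] := potential_linearization p_gt0 HA.
have r0 := rPhi_gt0 HA; have rz0 := corrector_rz HC; have rchi0 := corrector_rchi HC.
set al := alpha p Phi chis; set be := beta p Rmax Phi chis.
set K := p%:R * C_Phi11 p Rmax Phi chis rPhi.
have ab : 2 * be < al := alpha_beta HA.
have K0 : 0 <= K := K_ge0 p Rmax Phi chis rPhi.
set A := Rmax%:R * L; have A0 : 0 <= A by rewrite mulr_ge0.
(* The last two bounds make [kappa d0] at most [c0] and [2 * kappa d0] at most half the dominance
   gap; [A + 1] is positive even if [A] is 0. *)
have [d0 [d00 d0r d0c d0a]] : exists d0, [/\ 0 < d0, d0 <= rPhi / 2,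
    d0 <= c0 / (A + 1) & d0 <= (al - 2 * be) / (4 * (A + 1))].
  by apply: exists_pos_le3; rewrite ?divr_gt0 ?mulr_gt0 ?subr_gt0 // ltr_wpDl.
have A1 : 0 < A + 1 by rewrite ltr_wpDl.
have d0_lt : d0 < rPhi by lra.
have kd0 : Rmax%:R * (L * d0) <= c0.
  move: d0c; rewrite ler_pdivlMr // mulrDr mulr1 => d0c.
  by rewrite mulrA -/A mulrC; lra.
have d0ab : 2 * (be + Rmax%:R * (L * d0)) < al.
  move: d0a; rewrite ler_pdivlMr ?mulr_gt0 // mulrA -/A => d0a.
  have : 0 < d0 * A + d0 by rewrite ltr_wpDl // mulr_ge0 // ltW.
  have -> : A * d0 = d0 * A by rewrite mulrC.
  by move: d0a; rewrite mulrCA mulrDr mulr1; lra.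
set gam := al - 2 * (be + Rmax%:R * (L * d0)).
have gam0 : 0 < gam by rewrite subr_gt0.
have [rho0 [rho00 rho0d rho0c _]] : exists rho0, [/\ 0 < rho0, rho0 <= d0 / 4,
    rho0 <= rchi / 2 & rho0 <= 1].
  by apply: exists_pos_le3; rewrite ?divr_gt0.
have K1 : 0 < K + 1 by rewrite ltr_wpDl.
(* The last bound is the smallness condition of [corrector_near]. *)
have [z1 [z10 z1rz z1d z1K]] : exists z1, [/\ 0 < z1, z1 <= rz, z1 <= d0 / 4 &
    z1 <= gam * rho0 / (2 * (K + 1))].
  by apply: exists_pos_le3; rewrite ?divr_gt0 ?mulr_gt0.
have zrho : z1 + rho0 <= d0 by lra.
have chi_near z : `|z| < z1 -> forall k, `|Dc 1 (chi z) k - Dc 1 chis k| <= rho0.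
  move=> zz; apply: (corrector_near p_gt0 Rmax_gt0 HA L_ge0 LP HC d0_lt (ltW rho00)) => //.
  - by lra.
  - exact: lt_le_trans zz z1rz.
  - by lra.
  rewrite -/al -/be -/gam -/K.
  move: z1K; rewrite ler_pdivlMr ?mulr_gt0 // => z1K.
  have h : K * `|z| <= K * z1 by rewrite ler_wpM2l // ltW.
  by move: z1K; rewrite mulrCA mulrDr mulr1 => z1K; rewrite [K * z1]mulrC in h; lra.
set X := p%:R * (K / c0).
have X0 : 0 <= X by rewrite mulr_ge0 // divr_ge0 // ltW.
have X1 : 0 < 1 + 2 * X by rewrite ltr_pwDl // mulr_ge0.
have [ru0 [ru00 ru0z ru0d _]] : exists ru0, [/\ 0 < ru0, ru0 <= z1,
    ru0 <= d0 / 4 / (1 + 2 * X) & ru0 <= 1].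
  by apply: exists_pos_le3; rewrite ?divr_gt0.
have ru0_d0 : (1 + 2 * X) * ru0 + rho0 <= d0.
  by move: ru0d; rewrite ler_pdivlMr // mulrC; lra.
have al0 : 0 < al := alpha_gt0 HA.
(* Solutions are sought in the ball of radius [ru0 / 2], which gives the strict bound [ru0]; the 4
   is the factor in [2 * (2 * rf)], the potential being bounded by [2 * rf]. *)
have [rf0 [rf00 rf0g rf0a _]] : exists rf0, [/\ 0 < rf0, rf0 <= gam * (ru0 / 2) / 4,
    rf0 <= al / 2 * (ru0 / 2) / 4 & rf0 <= 1].
  by apply: exists_pos_le3; rewrite ?divr_gt0 ?mulr_gt0 ?divr_gt0.
exists rf0, ru0; split; first by split=> //; lra.
move=> N N_gt0 pN [lat_infsup _].
have hru : 0 < ru0 / 2 by lra.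
have hru' : ru0 / 2 < ru0 by lra.
have unique_near := atomistic_unique p_gt0 Rmax_gt0 HA L_ge0 LP d0_lt d0ab z10 zrho
  chi_near ru0z N_gt0 pN.
split.
  move=> f zf frf; split.
    have [|u su] := atomistic_exists p_gt0 Rmax_gt0 HA L_ge0 LP d0_lt d0ab z10 zrho
      chi_near ru0z N_gt0 pN (ltW hru) hru' _ zf frf; first by rewrite -/al -/be -/gam; lra.
    by exists u; split=> // u'; exact: (unique_near _ _ _ _ (lexx _) zf su).
  have [|u su] := homogenized_exists p_gt0 Rmax_gt0 HA L_ge0 LP HC c0_gt0 d0_lt kd0 d0ab
    z10 z1rz zrho chi_near cell_infsup ru0z N_gt0 hru hru' _ zf frf.
    by rewrite -/al; lra.
  exists u; split=> // u'.
  exact: (homogenized_unique p_gt0 Rmax_gt0 HA L_ge0 LP HC c0_gt0 d0_lt kd0 d0ab z1rz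
    zrho chi_near cell_infsup ru0z N_gt0 (lexx _) zf su).
move=> rf ru rf_gt0 ru_gt0 ruru rad node [node_per [x0 node_x0]] F HF dF.
split.
  apply: (coarse_exists_unique p_gt0 Rmax_gt0 HA L_ge0 LP HC c0_gt0 d0_lt kd0 d0ab z1rz
    zrho chi_near cell_infsup ru0z N_gt0 node_per node_x0 HF ruru _ dF) => f zf frf.
  by have [_ [u [su _]]] := rad f zf frf; exists u.
move=> uh f u h cs zf su ph hh.
have := error_estimate p_gt0 HA L_ge0 LP HC c0_gt0 d0_lt kd0 z10 z1rz zrho chi_near
  cell_infsup ru0z ru0_d0 N_gt0 pN node_per node_x0 HF ruru lat_infsup cs zf su ph hh.
move=> /le_trans; apply; rewrite !mulrDr !lerD2r le_eqVlt; apply/orP; left; apply/eqP.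
by rewrite /K; ring.
Qed.
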